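(* Every strictly unital $A_\infty$-category $\mathscr A$ admits a semi-free resolution which has cofibrant morphisms; in particular there exist a semi-free $A_\infty$-category $\mathscr A^{\mathrm{sf}}$ and a strict (strictly unital) quasi-equivalence $\Psi_{\mathscr A}:\mathscr A^{\mathrm{sf}}\to\mathscr A$ which is surjective on the morphisms. Moreover the resolution can be made functorial in $A_\infty\mathrm{Cat}_{\mathrm{strict}}$: the assignment $\mathscr A\mapsto\mathscr A^{\mathrm{sf}}$ can be extended to a functor $F\mapsto F^{\mathrm{sf}}$ on $A_\infty\mathrm{Cat}_{\mathrm{strict}}$ with $\Psi_{\mathscr B}\cdot F^{\mathrm{sf}}=F\cdot\Psi_{\mathscr A}$ for every morphism $F:\mathscr A\to\mathscr B$ of $A_\infty\mathrm{Cat}_{\mathrm{strict}}$.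
   Context: $R$ is a commutative ring; categories are small. A graded $R$-linear quiver has a set of objects and graded $R$-modules $\mathrm{Hom}(x,y)$; a DG quiver also has differentials $d$ of degree $1$ on each $\mathrm{Hom}(x,y)$. A non unital $A_\infty$-category $\mathscr A$ is a graded $R$-linear quiver with $R$-linear maps $m^n_{\mathscr A}:\mathrm{Hom}(x_{n-1},x_n)\otimes\cdots\otimes\mathrm{Hom}(x_0,x_1)\to\mathrm{Hom}(x_0,x_n)[2-n]$ ($n\ge1$) such that $\sum_{m=1}^n\sum_{d=0}^{n-m}(-1)^{\dagger_d}m^{n-m+1}(f_n,\dots,f_{d+m+1},m^m(f_{d+m},\dots,f_{d+1}),f_d,\dots,f_1)=0$, with $\dagger_d=\sum_{i\le d}\deg f_i-d$. Its underlying DG quiver is $|\mathscr A|=(\mathscr A,m^1)$. It is strictly unital if every $x$ has a closed degree $0$ morphism $1_x$ with $m^2(f,1_x)=f=(-1)^{\deg f}m^2(1_y,f)$ for $f:x\to y$, and $m^n(\dots,1_x,\dots)=0$ for $n\ge3$. A strict $A_\infty$-functor $F:\mathscr A\to\mathscr B$ is a map $F^0$ on objects and degree $0$ $R$-linear maps $F^1:\mathrm{Hom}_{\mathscr A}(x,y)\to\mathrm{Hom}_{\mathscr B}(F^0x,F^0y)$ commuting with all $m^n$; it is strictly unital if $F^1(1_x)=1_{F^0x}$. $A_\infty\mathrm{Cat}_{\mathrm{strict}}$ is the category of strictly unital $A_\infty$-categories and strict strictly unital $A_\infty$-functors. $F$ is a quasi-equivalence if every $F^1$ is a quasi-isomorphism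 for $m^1$ and the induced functor $H^0(F)$ is essentially surjective. ''Surjective on the morphisms'' means $F^1$ is surjective on all Hom modules (and here $\Psi_{\mathscr A}$ is the identity on objects). $\mathscr A$ has cofibrant morphisms if every DG $R$-module $(\mathrm{Hom}_{\mathscr A}(x,y),m^1)$ is cofibrant in the projective model structure on unbounded DG $R$-modules (weak equivalences the quasi-isomorphisms, fibrations the degreewise surjections), i.e. it is h-projective and degreewise projective; $M$ is h-projective if $\mathrm{Hom}(M,N)$ is acyclic for each acyclic $N$. Free $A_\infty$-categories. The functor $\mathscr A\mapsto|\mathscr A|$ from non unital $A_\infty$-categories with strict functors to DG quivers has a left adjoint $Q\mapsto\mathfrak F(Q)$ (the free $A_\infty$-category; same objects, morphisms spanned by planar rooted trees all of whose internal vertices have at least two inputs, with leaves labelled by composable morphisms of $Q$, operations $m^{n\ge2}$ given by grafting). An $A_\infty$-ideal of $\mathscr A$ is a DG subquiver $I$ of $|\mathscr A|$ such that every $m^n$ with one input in $I$ lies in $I$; $\mathscr A/I$ has the quotient Hom modules and induced operations. Semi-free. $\mathrm{disc}(\mathscr A)$ has the objects of $\mathscr A$, $\mathrm{Hom}(x,x)=R\cdot1_x$ free of rank one, $\mathrm{Hom}(x,y)=0$ for $x\ne y$, zero differential. A strictly unital $\mathscr A$ is semi-free if it is the union of an increasing sequence of strictly unital $A_\infty$-subcategories $\mathscr A_0\subset\mathscr A_1\subset\cdots$ with the same objects, with DG quivers $|\mathscr A_0|\subset Q_1\subset|\mathscr A_1|\subset Q_2\subset\cdots\subset|\mathscr A|$,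 such that: (1) $\mathscr A_0$ is the isomorphic image of $\mathrm{disc}(\mathscr A)$ under a strict functor that is bijective on objects; (2) for $n\ge1$, $Q_n\simeq|\mathscr A_{n-1}|\oplus B_n$ as graded quivers for some graded quiver $B_n$; (3) for $n\ge1$, compatibly with $Q_n\subset|\mathscr A_n|$, $\mathscr A_n\simeq\mathfrak F(Q_n)/I_n$ where $I_n$ is the ideal generated by the elements $m^k_{\mathfrak F(Q_n)}(f_k,\dots,f_1)-m^k_{\mathscr A_{n-1}}(f_k,\dots,f_1)$ ($k\ge2$, $f_i\in\mathscr A_{n-1}$) and by the relations saying that the $1_x$ of $\mathscr A_0$ are strict units; (4) $Q_n/|\mathscr A_{n-1}|$ has zero differential and free Hom $R$-modules. A semi-free resolution of $\mathscr A$ is a semi-free $A_\infty$-category with a strict, strictly unital quasi-equivalence to $\mathscr A$. *)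

(* Defs.v *)
(* R is a comPzRingType throughout, so the zero ring is allowed. *)
From HB Require Import structures.
From mathcomp Require Import all_boot all_order all_algebra.
Set Implicit Arguments.
Unset Strict Implicit.
Unset Printing Implicit Defensive.
Import GRing.Theory.
Local Open Scope ring_scope.

(* [chain H x_0 x_n] is the type of composable strings (f_1, ..., f_n) with
   f_i : H x_{i-1} x_i.  The FIRST arrow is the head, so what is usually written
   m^n(f_n, ..., f_1) is [op (ccons f_1 (... (ccons f_n (cnil x_n))))]. *)
Inductive chain (O : Type) (H : O -> O -> Type) : O -> O -> Type :=
| cnil x : chain H x x
| ccons x y z : H x y -> chain H y z -> chain H x z.

Arguments cnil {O H} x.
Arguments ccons {O H x y z} f p.

Fixpoint clen (O : Type) (H : O -> O -> Type) x y (p : chain H x y) : nat :=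
  match p with
  | cnil _ => 0%N
  | ccons _ _ _ _ p' => (clen p').+1
  end.

Fixpoint ccat (O : Type) (H : O -> O -> Type) x y z (p : chain H x y) :
    chain H y z -> chain H x z :=
  match p with
  | cnil _ => fun q => q
  | ccons _ _ _ f p' => fun q => ccons f (ccat p' q)
  end.

Definition csing (O : Type) (H : O -> O -> Type) x y (f : H x y) : chain H x y :=
  ccons f (cnil y).

Fixpoint cmap (O O' : Type) (H : O -> O -> Type) (H' : O' -> O' -> Type)
    (F0 : O -> O') (F1 : forall x y, H x y -> H' (F0 x) (F0 y)) x y
    (p : chain H x y) : chain H' (F0 x) (F0 y) :=
  match p with
  | cnil x => cnil (F0 x)
  | ccons _ _ _ f p' => ccons (F1 _ _ f) (@cmap O O' H H' F0 F1 _ _ p')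
  end.

Arguments cmap {O O' H} H' F0 F1 {x y} p.

(* [csplits p] lists the clen p + 1 ways of writing p as a concatenation. *)
Record csplit (O : Type) (H : O -> O -> Type) (x y : O) := CSplit
  { cmid : O; cpre : chain H x cmid; cpost : chain H cmid y }.

Fixpoint csplits (O : Type) (H : O -> O -> Type) x y (p : chain H x y) :
    seq (csplit H x y) :=
  match p with
  | cnil x => [:: CSplit (cnil x) (cnil x)]
  | ccons _ _ _ f p' =>
      CSplit (cnil _) (ccons f p') ::
      [seq CSplit (ccons f (cpre s)) (cpost s) | s <- csplits p']
  end.

Lemma cmap_ccat (O O' : Type) (H : O -> O -> Type) (H' : O' -> O' -> Type)
    (F0 : O -> O') (F1 : forall x y, H x y -> H' (F0 x) (F0 y)) x y z
    (p : chain H x y) (q : chain H y z) :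
  cmap H' F0 F1 (ccat p q) = ccat (cmap H' F0 F1 p) (cmap H' F0 F1 q).
Proof. by elim: p q => //= *; congr ccons. Qed.

Lemma cmap_id (O : Type) (H : O -> O -> Type) x y (p : chain H x y) :
  cmap H id (fun x y f => f) p = p.
Proof. by elim: p => //= *; congr ccons. Qed.

Lemma cmap_comp (O O' O'' : Type) (H : O -> O -> Type) (H' : O' -> O' -> Type)
    (H'' : O'' -> O'' -> Type) (F0 : O -> O') (G0 : O' -> O'')
    (F1 : forall x y, H x y -> H' (F0 x) (F0 y))
    (G1 : forall x y, H' x y -> H'' (G0 x) (G0 y)) x y (p : chain H x y) :
  cmap H'' (fun z => G0 (F0 z)) (fun x y f => G1 _ _ (F1 _ _ f)) p
  = cmap H'' G0 G1 (cmap H' F0 F1 p).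
Proof. by elim: p => //= *; congr ccons. Qed.

Section Modules.
Variable R : comPzRingType.

(* A graded module M = (+)_i M^i, given by its total module together with the
   projections [gpr i] onto the homogeneous components M^i.  Working inside the
   total module avoids transports along equalities between degrees. *)
Record gmod := GMod {
  gcar :> lmodType R;
  gpr : int -> gcar -> gcar;
  gpr_linear : forall i, linear (gpr i);
  gprK : forall i j m, gpr i (gpr j m) = if i == j then gpr j m else 0;
  gpr_sum : forall m, exists2 s : seq int, uniq s & m = \sum_(i <- s) gpr i m }.

Definition homog (M : gmod) (i : int) (m : M) : Prop := gpr i m = m.

Record hmor (M : gmod) := HMor
  { hval :> M; hdeg : int; hvalP : homog hdeg hval }.

Record dgmod := DGMod {
  dgcar :> gmod;
  dif : dgcar -> dgcar;
  dif_linear : linear dif;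
  dif_homog : forall i m, homog i m -> homog (i + 1) (dif m);
  dif_dif : forall m, dif (dif m) = 0 }.

Definition is_gmap (M N : gmod) (f : M -> N) : Prop :=
  linear f /\ forall i m, homog i m -> homog i (f m).

Definition is_dgmap (M N : dgmod) (f : M -> N) : Prop :=
  is_gmap f /\ forall m, f (dif m) = dif (f m).

Definition surj (S T : Type) (f : S -> T) : Prop := forall t, exists s, f s = t.

(* Bijectivity of H(f); since H(M) = (+)_i H^i(M), it may be tested on
   not necessarily homogeneous cycles. *)
Definition quasi_iso (M N : dgmod) (f : M -> N) : Prop :=
  (forall m, dif m = 0 -> (exists n, f m = dif n) -> exists m', m = dif m') /\
  (forall n, dif n = 0 ->
     exists m, dif m = 0 /\ exists n', n - f m = dif n').

(* 0 -> M has the left lifting property against the surjective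
   quasi-isomorphisms, i.e. the trivial fibrations of the projective model
   structure. *)
Definition cofibrant (M : dgmod) : Prop :=
  forall (N P : dgmod) (p : N -> P) (g : M -> P),
    is_dgmap p -> surj p -> quasi_iso p -> is_dgmap g ->
    exists h : M -> N, is_dgmap h /\ forall m, p (h m) = g m.

(* Every M^i is free: M has a basis of homogeneous elements. *)
Definition graded_free (M : gmod) : Prop :=
  exists (I : choiceType) (b : I -> hmor M),
    (forall m : M, exists (s : seq I) (c : I -> R),
        m = \sum_(i <- s) c i *: (b i : M)) /\
    (forall (s : seq I) (c : I -> R), uniq s ->
        \sum_(i <- s) c i *: (b i : M) = 0 -> forall i, i \in s -> c i = 0).

End Modules.

Section Categories.
Variable R : comPzRingType.

Definition gquiver (O : Type) := O -> O -> gmod R.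
Definition dgquiver (O : Type) := O -> O -> dgmod R.

Definition gchain O (Q : gquiver O) (x y : O) := chain (fun a b => Q a b) x y.

Definition hchain O (Q : gquiver O) (x y : O) :=
  chain (fun a b => hmor (Q a b)) x y.

Fixpoint cdeg O (Q : gquiver O) x y (p : hchain Q x y) : int :=
  match p with
  | cnil _ => 0
  | ccons _ _ _ f p' => hdeg f + cdeg p'
  end.

Definition cval O (Q : gquiver O) x y (p : hchain Q x y) : gchain Q x y :=
  cmap (fun a b => Q a b) id (fun a b f => hval f) p.

Definition sgn (i : int) : R := (-1) ^+ absz i.

(* Non unital A_oo-categories with set of objects O.  The operation m^n is the
   restriction of [op] to chains of length n >= 1; [op_nil] makes the value on
   empty chains, which is not part of the structure, irrelevant.  In [op_rel]
   the outer sum is over p = a ++ r (with clen a = d), the inner one over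
   r = b ++ c with b non empty (clen b = m). *)
Record ainf (O : Type) := AInf {
  hom :> O -> O -> gmod R;
  op : forall x y, gchain hom x y -> hom x y;
  op_nil : forall x, op (cnil x) = 0;
  op_linear : forall x y z w (p : gchain hom x y) (q : gchain hom z w),
    linear (fun f : hom y z => op (ccat p (ccons f q)));
  op_homog : forall x y (p : hchain hom x y),
    homog (cdeg p + 2 - (clen p)%:Z) (op (cval p));
  op_rel : forall x y (p : hchain hom x y),
    \sum_(s <- csplits p)
      \sum_(t <- csplits (cpost s) | (0 < clen (cpre t))%N)
        sgn (cdeg (cpre s) - (clen (cpre s))%:Z) *:
          op (ccat (cval (cpre s))
                (ccons (op (cval (cpre t))) (cval (cpost t)))) = 0 }.

Arguments op {O} A {x y} p : rename.

Section Underlying.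
Variables (O : Type) (A : ainf O).

Lemma m1_linear x y : linear (fun f : A x y => op A (csing f)).
Proof. exact: (op_linear (cnil x) (cnil y)). Qed.

Lemma m1_homog x y i (f : A x y) : homog i f -> homog (i + 1) (op A (csing f)).
Proof.
move=> hf; have := op_homog (ccons (HMor hf) (cnil y)).
by rewrite /= addr0 -addrA.
Qed.

Lemma m1_m1 x y (f : A x y) : op A (csing (op A (csing f))) = 0.
Proof.
pose g (h : A x y) := op A (csing (op A (csing h))).
have gl : linear g by move=> a u v; rewrite /g !m1_linear.
have gh i h : homog i h -> g h = 0.
  move=> hi; have := op_rel (ccons (HMor hi) (cnil y)).
  rewrite /= !big_cons !big_nil /= !addr0.
  by rewrite /sgn /= expr0 scale1r.
have [s _ ->] := gpr_sum f.
rewrite -[LHS]/(g _).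
have gD u v : g (u + v) = g u + g v by have := gl 1 u v; rewrite !scale1r.
have g0 : g 0 = 0 by have := gl (-1) 0 0; rewrite scaler0 add0r scaleN1r addNr.
elim: s => [|i s IHs]; first by rewrite big_nil.
rewrite big_cons gD IHs addr0; apply: (gh i).
by rewrite /homog gprK eqxx.
Qed.

(* The underlying DG quiver (A, m^1). *)
Definition und : dgquiver O := fun x y =>
  DGMod (@m1_linear x y) (@m1_homog x y) (@m1_m1 x y).

End Underlying.

Definition is_gqmap O O' (F0 : O -> O') (Q : gquiver O) (Q' : gquiver O')
    (F1 : forall x y, Q x y -> Q' (F0 x) (F0 y)) : Prop :=
  forall x y, is_gmap (F1 x y).

Definition is_dgqmap O O' (F0 : O -> O') (Q : dgquiver O) (Q' : dgquiver O')
    (F1 : forall x y, Q x y -> Q' (F0 x) (F0 y)) : Prop :=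
  forall x y, is_dgmap (F1 x y).

Arguments is_gqmap {O O'} F0 Q Q' F1.
Arguments is_dgqmap {O O'} F0 Q Q' F1.

Definition is_strict O O' (F0 : O -> O') (A : ainf O) (B : ainf O')
    (F1 : forall x y, A x y -> B (F0 x) (F0 y)) : Prop :=
  (forall x y, is_gmap (F1 x y)) /\
  (forall x y (p : gchain (hom A) x y),
     F1 x y (op A p) = op B (cmap (fun a b => B a b) F0 F1 p)).

Arguments is_strict {O O'} F0 A B F1.

(* Strictly unital A_oo-categories with set of objects O. *)
Record uainf (O : Type) := UAInf {
  ucat :> ainf O;
  idm : forall x, ucat x x;
  idm_homog : forall x, homog 0 (idm x);
  idm_closed : forall x, op ucat (csing (idm x)) = 0;
  op_idr : forall x y (f : ucat x y), op ucat (ccons (idm x) (csing f)) = f;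
  op_idl : forall x y i (f : ucat x y), homog i f ->
    f = sgn i *: op ucat (ccons f (csing (idm y)));
  op_idn : forall x y z (p : gchain (hom ucat) x y) (q : gchain (hom ucat) y z),
    (2 <= clen p + clen q)%N -> op ucat (ccat p (ccons (idm y) q)) = 0 }.

Definition is_ustrict O O' (F0 : O -> O') (A : uainf O) (B : uainf O')
    (F1 : forall x y, A x y -> B (F0 x) (F0 y)) : Prop :=
  is_strict F0 A B F1 /\ forall x, F1 x x (idm A x) = idm B (F0 x).

Arguments is_ustrict {O O'} F0 A B F1.

Record ainfCat := AInfCat { ob : Type; cat :> uainf ob }.

Record functor (A B : ainfCat) := Functor {
  fob : ob A -> ob B;
  fmor : forall x y, A x y -> B (fob x) (fob y);
  functorP : is_ustrict fob A B fmor }.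

Lemma idF_proof (A : ainfCat) :
  is_ustrict id A A (fun x y (f : A x y) => f).
Proof.
split; last by [].
by split=> [x y|x y p]; [split | rewrite cmap_id].
Qed.

Definition idF (A : ainfCat) : functor A A := Functor (@idF_proof A).

Lemma compF_proof (A B C : ainfCat) (G : functor B C) (F : functor A B) :
  is_ustrict (fun x => fob G (fob F x)) A C
    (fun x y f => fmor G (fmor F f)).
Proof.
have [[Fg Fop] Fid] := functorP F; have [[Gg Gop] Gid] := functorP G.
split; last by move=> x; rewrite Fid Gid.
split=> [x y|x y p]; last first.
  by rewrite Fop Gop; congr op; symmetry; apply: cmap_comp.
have [Fl Fh] := Fg x y; have [Gl Gh] := Gg (fob F x) (fob F y).
split=> [a u v|i m hm]; first by rewrite Fl Gl.
by apply: Gh; apply: Fh.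
Qed.

Definition compF (A B C : ainfCat) (G : functor B C) (F : functor A B) :
  functor A C := Functor (compF_proof G F).

(* x and y become isomorphic in H^0(A). *)
Definition H0_iso O (A : uainf O) (x y : O) : Prop :=
  exists (f : A x y) (g : A y x),
    [/\ homog 0 f, homog 0 g,
        op A (csing f) = 0 & op A (csing g) = 0] /\
    (exists h : A x x, homog (-1) h /\
       op A (ccons f (csing g)) - idm A x = op A (csing h)) /\
    (exists h : A y y, homog (-1) h /\
       op A (ccons g (csing f)) - idm A y = op A (csing h)).

Definition quasi_equivalence (A B : ainfCat) (F : functor A B) : Prop :=
  (forall x y, @quasi_iso R (und A x y) (und B (fob F x) (fob F y))
                 (@fmor A B F x y)) /\
  (forall y : ob B, exists x : ob A, H0_iso B (fob F x) y).

Definition surjective_on_morphisms (A B : ainfCat) (F : functor A B) : Prop :=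
  forall x y, surj (@fmor A B F x y).

Definition has_cofibrant_morphisms (A : ainfCat) : Prop :=
  forall x y, cofibrant (und A x y).

(* [F] together with [eta : Q -> |F|] is the free A_oo-category on Q: the value
   at Q of the left adjoint to A |-> |A|, with its unit, which is the identity
   on objects. *)
Definition is_free O (Q : dgquiver O) (F : ainf O)
    (eta : forall x y, Q x y -> F x y) : Prop :=
  is_dgqmap id Q (und F) eta /\
  forall (O' : Type) (B : ainf O') (g0 : O -> O')
         (g : forall x y, Q x y -> B (g0 x) (g0 y)),
    is_dgqmap g0 Q (und B) g ->
    (exists G : forall x y, F x y -> B (g0 x) (g0 y),
        is_strict g0 F B G /\
        forall x y (q : Q x y), G x y (eta x y q) = g x y q) /\
    (forall G G' : forall x y, F x y -> B (g0 x) (g0 y),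
        is_strict g0 F B G -> is_strict g0 F B G' ->
        (forall x y (q : Q x y), G x y (eta x y q) = G' x y (eta x y q)) ->
        forall x y (f : F x y), G x y f = G' x y f).

(* The case p = q = nil of the last clause says that I is stable under m^1. *)
Definition is_ideal O (A : ainf O) (I : forall x y, A x y -> Prop) : Prop :=
  (forall x y, I x y 0) /\
  (forall x y (a : R) (f g : A x y), I x y f -> I x y g -> I x y (a *: f + g)) /\
  (forall x y i (f : A x y), I x y f -> I x y (gpr i f)) /\
  (forall x y z w (p : gchain (hom A) x y) (f : A y z) (q : gchain (hom A) z w),
      I y z f -> I x w (op A (ccat p (ccons f q)))).

Definition gen_ideal O (A : ainf O) (G : forall x y, A x y -> Prop)
    (x y : O) (f : A x y) : Prop :=
  forall I : (forall x y, A x y -> Prop), is_ideal I ->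
    (forall x y (g : A x y), G x y g -> I x y g) -> I x y f.

(* [pi] exhibits B as the quotient A / I. *)
Definition is_quotient O (A B : ainf O) (I : forall x y, A x y -> Prop)
    (pi : forall x y, A x y -> B x y) : Prop :=
  [/\ is_strict id A B pi, is_ideal I,
      forall x y, surj (pi x y) &
      forall x y (f : A x y), pi x y f = 0 <-> I x y f].

Definition is_disc O (D : uainf O) : Prop :=
  (forall x, bijective (fun r : R => r *: idm D x)) /\
  (forall x y, x <> y -> forall f : D x y, f = 0) /\
  (forall x y (f : D x y), op D (csing f) = 0).

(* Generators of the ideal I_n, for F = F(Q_n), A' = A_{n-1} and
   j : |A_{n-1}| -> Q_n -> |F(Q_n)|. *)
Inductive attach_rel O (A' : uainf O) (F : ainf O)
    (j : forall x y, A' x y -> F x y) : forall x y, F x y -> Prop :=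
| attach_op x y (p : gchain (hom A') x y) : (2 <= clen p)%N ->
    attach_rel j (op F (cmap (fun a b => F a b) id j p) - j x y (op A' p))
| attach_idr x y (f : F x y) :
    attach_rel j (op F (ccons (j x x (idm A' x)) (csing f)) - f)
| attach_idl x y i (f : F x y) : homog i f ->
    attach_rel j (sgn i *: op F (ccons f (csing (j y y (idm A' y)))) - f)
| attach_idn x y z (p : gchain (hom F) x y) (q : gchain (hom F) y z) :
    (2 <= clen p + clen q)%N ->
    attach_rel j (op F (ccat p (ccons (j y y (idm A' y)) q))).

(* |A'| -> Q -> |A''| is one step |A_{n-1}| < Q_n < |A_n| of a semi-free
   filtration. *)
Definition semi_free_step O (A' : uainf O) (Q : dgquiver O) (A'' : uainf O)
    (u : forall x y, A' x y -> Q x y) (v : forall x y, Q x y -> A'' x y)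
    : Prop :=
  (exists (B : gquiver O) (w : forall x y, B x y -> Q x y),
     is_gqmap id B Q w /\
     forall x y, bijective (fun ab : A' x y * B x y => u x y ab.1 + w x y ab.2))
  /\
  (exists (F : ainf O) (eta : forall x y, Q x y -> F x y)
          (pi : forall x y, F x y -> A'' x y),
     [/\ is_free eta,
         is_quotient
           (gen_ideal (attach_rel (fun x y f => eta x y (u x y f)))) pi &
         forall x y (q : Q x y), pi x y (eta x y q) = v x y q])
  /\
  (* C is the quotient DG quiver Q / |A'| *)
  (exists (C : dgquiver O) (p : forall x y, Q x y -> C x y),
     [/\ is_dgqmap id Q C p,
         forall x y, surj (p x y),
         forall x y (q : Q x y), p x y q = 0 <-> exists f, q = u x y f,
         forall x y (c : C x y), dif c = 0 &
         forall x y, graded_free (C x y)]).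

(* Subcategories and subquivers with the same objects are given by injective
   maps that are the identity on objects; [Q_ n] stands for Q_{n+1}, [u n] for
   |A_n| < Q_{n+1}, [v n] for Q_{n+1} < |A_{n+1}| and [i n] for A_n < A. *)
Definition semi_free (A : ainfCat) : Prop :=
  exists (A_ : nat -> uainf (ob A)) (Q_ : nat -> dgquiver (ob A))
    (u : forall n x y, A_ n x y -> Q_ n x y)
    (v : forall n x y, Q_ n x y -> A_ n.+1 x y)
    (i : forall n x y, A_ n x y -> A x y),
    (forall n,
       [/\ is_dgqmap id (und (A_ n)) (Q_ n) (u n),
           is_dgqmap id (Q_ n) (und (A_ n.+1)) (v n),
           is_ustrict id (A_ n) (A_ n.+1)
             (fun x y f => v n x y (u n x y f)) &
           is_ustrict id (A_ n) A (i n)]) /\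
    (forall n x y,
       [/\ injective (u n x y), injective (v n x y) & injective (i n x y)]) /\
    (forall n x y (f : A_ n x y), i n.+1 x y (v n x y (u n x y f)) = i n x y f) /\
    (forall x y (f : A x y), exists n, exists g : A_ n x y, i n x y g = f) /\
    is_disc (A_ 0%N) /\
    (forall n, semi_free_step (u n) (v n)).

Definition is_semi_free_resolution (A B : ainfCat) (Psi : functor B A) : Prop :=
  semi_free B /\ quasi_equivalence Psi.

End Categories.

Arguments idF {R} A.

(* Main.v *)
Require Import Defs.
From HB Require Import structures.
From mathcomp Require Import all_boot all_order all_algebra.
From mathcomp Require Import boolp zify.

(* The free strictly unital A_oo-category on graded generators has a basis made
   of the units and of the planar trees with leaves labelled by generators; the
   A_oo-relations force the differential of a tree as soon as it is known on the
   generators, and d^2 vanishes because the square of an odd coderivation of the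
   bar construction is a coderivation.  Starting from the discrete category,
   stage n + 1 attaches one generator e, with d e = z and image b in A, for every
   homogeneous cycle z of stage n and every homogeneous b in A bounding the image
   of z.  The union of the stages maps to A by a quasi-isomorphism which is
   surjective on morphisms, and as no choice is involved it is functorial in A.
   The weight of a tree (the sum of the weights of its leaves minus the number of
   its inner vertices) is lowered by d once a generator e weighs more than the
   trees occurring in d e; lifts against trivial fibrations can then be
   constructed by induction on the weight. *)
Set Implicit Arguments.
Unset Strict Implicit.
Unset Printing Implicit Defensive.
Import GRing.Theory.
Local Open Scope ring_scope.

(** * Free graded modules *)

(** Semi-freeness presents A_n as a quotient of the free A_oo-category on all of |A_(n-1)| together
    with new generators, whereas injectivity, freeness and cofibrancy are read off a basis. Each
    stage is therefore built from normal forms, and its presentation is recovered afterwards: the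
    free A_oo-category on Q_n is the same tree construction without units, and its quotient is
    compared with A_n by means of a linear section. Strict units are what complicates the trees:
    they are basis elements of their own, absorbed by m^2, and identities have to be checked
    separately on chains that contain one. The differential is kept apart from the higher operations
    because it is the only unknown: the relations of arity at least 2 serve to define it, and they
    are available while d^2 = 0 is still open. Tensor powers enter only through multilinear
    functions of chains, and a coderivation only through precomposition with it, so that neither
    tensor products nor desuspensions are formed; degrees are shifted by one in the statements
    instead. *)

Section LinearMaps.
Variables (R : pzRingType) (U V W : lmodType R).
Implicit Types f g : U -> V.

Lemma linP0 f : linear f -> f 0 = 0.
Proof. by move=> lf; have := lf (-1) 0 0; rewrite scaler0 add0r scaleN1r addNr. Qed.

Lemma linPD f : linear f -> {morph f : u v / u + v}.
Proof. by move=> lf u v; have := lf 1 u v; rewrite !scale1r. Qed.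

Lemma linPZ f : linear f -> forall a, {morph f : u / a *: u}.
Proof. by move=> lf a u; have := lf a u 0; rewrite !addr0 linP0 // addr0. Qed.

Lemma linPN f : linear f -> {morph f : u / - u}.
Proof. by move=> lf u; rewrite -scaleN1r linPZ // scaleN1r. Qed.

Lemma linPB f : linear f -> {morph f : u v / u - v}.
Proof. by move=> lf u v; rewrite linPD // linPN. Qed.

Lemma linP_sum f : linear f -> forall (I : Type) (s : seq I) (P : pred I) (F : I -> U),
  f (\sum_(i <- s | P i) F i) = \sum_(i <- s | P i) f (F i).
Proof. by move=> lf I s P F; exact: (big_morph f (linPD lf) (linP0 lf)). Qed.

Lemma linear_comp f (g : V -> W) : linear f -> linear g -> linear (g \o f).
Proof. by move=> lf lg a u v /=; rewrite lf lg. Qed.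

Lemma linear_add f g : linear f -> linear g -> linear (fun u => f u + g u).
Proof. by move=> lf lg a u v; rewrite lf lg scalerDr addrACA. Qed.

Lemma linear_opp f : linear f -> linear (fun u => - f u).
Proof. by move=> lf a u v; rewrite lf opprD scalerN. Qed.

Lemma linear_zero : linear (fun _ : U => 0 : V).
Proof. by move=> a u v; rewrite scaler0 addr0. Qed.

End LinearMaps.

Section FreeModule.
Variables (R : comPzRingType) (I : Type).

(** [I] is an arbitrary type; [{classic I}] equips it with the decidable equality that membership in
    a list requires. With functions of finite support equality is extensional, so the free module is
    not a quotient. *)
Definition finsupp (f : I -> R) : Prop :=
  exists s : seq {classic I}, forall i : {classic I}, f i <> 0 -> i \in s.

Record freemod := FreeMod { fcoef :> I -> R; fcoefP : finsupp fcoef }.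

Lemma freemodP (f g : freemod) : (forall i, f i = g i) -> f = g.
Proof.
case: f g => f fP [g gP] /= /funext fg; subst g.
by congr FreeMod; exact: Prop_irrelevance.
Qed.

HB.instance Definition _ := gen_eqMixin freemod.
HB.instance Definition _ := gen_choiceMixin freemod.

Fact free0_subproof : finsupp (fun=> 0).
Proof. by exists [::] => i. Qed.

Fact freeD_subproof (f g : freemod) : finsupp (fun i => f i + g i).
Proof.
have [s sP] := fcoefP f; have [t tP] := fcoefP g; exists (s ++ t) => i; rewrite mem_cat.
have [/sP -> //|/contrapT f0] := pselect (f i <> 0).
by rewrite f0 add0r => /tP ->; rewrite orbT.
Qed.

Fact freeZ_subproof (a : R) (f : freemod) : finsupp (fun i => a * f i).
Proof.
have [s sP] := fcoefP f; exists s => i; apply: contra_notT => /negP nis.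
have -> : f i = 0 by apply: contrapT => /sP.
by rewrite mulr0.
Qed.

Fact freeN_subproof (f : freemod) : finsupp (fun i => - f i).
Proof.
have [s sP] := fcoefP f; exists s => i fi; apply: sP => f0.
by apply: fi; rewrite f0 oppr0.
Qed.

Definition free_zero := FreeMod free0_subproof.
Definition free_add f g := FreeMod (freeD_subproof f g).
Definition free_opp f := FreeMod (freeN_subproof f).
Definition free_scale a f := FreeMod (freeZ_subproof a f).

Fact free_addA : associative free_add.
Proof. by move=> f g h; apply: freemodP => i /=; rewrite addrA. Qed.
Fact free_addC : commutative free_add.
Proof. by move=> f g; apply: freemodP => i /=; rewrite addrC. Qed.
Fact free_add0 : left_id free_zero free_add.
Proof. by move=> f; apply: freemodP => i /=; rewrite add0r. Qed.
Fact free_addN : left_inverse free_zero free_opp free_add.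
Proof. by move=> f; apply: freemodP => i /=; rewrite addNr. Qed.

HB.instance Definition _ :=
  GRing.isZmodule.Build freemod free_addA free_addC free_add0 free_addN.

Fact free_scaleA a b f : free_scale a (free_scale b f) = free_scale (a * b) f.
Proof. by apply: freemodP => i /=; rewrite mulrA. Qed.
Fact free_scale1 : left_id 1 free_scale.
Proof. by move=> f; apply: freemodP => i /=; rewrite mul1r. Qed.
Fact free_scaleDr : right_distributive free_scale +%R.
Proof. by move=> a f g; apply: freemodP => i /=; rewrite mulrDr. Qed.
Fact free_scaleDl f : {morph free_scale^~ f : a b / a + b}.
Proof. by move=> a b; apply: freemodP => i /=; rewrite mulrDl. Qed.

HB.instance Definition _ :=
  GRing.Zmodule_isLmodule.Build R freemod free_scaleA free_scale1 free_scaleDr free_scaleDl.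

Lemma fcoef0 i : (0 : freemod) i = 0. Proof. by []. Qed.
Lemma fcoefD (f g : freemod) i : (f + g) i = f i + g i. Proof. by []. Qed.
Lemma fcoefZ a (f : freemod) i : (a *: f) i = a * f i. Proof. by []. Qed.
Lemma fcoef_sum (J : Type) (s : seq J) (P : pred J) (F : J -> freemod) i :
  (\sum_(j <- s | P j) F j) i = \sum_(j <- s | P j) F j i.
Proof. exact: (big_morph (fun f : freemod => f i) (fun f g => fcoefD f g i) (fcoef0 i)). Qed.

Fact delta_subproof (i : {classic I}) : finsupp (fun j : {classic I} => (j == i)%:R).
Proof.
exists [:: i] => j; rewrite inE; apply: contra_notT => /negP.
by case: eqP.
Qed.

Definition delta (i : I) : freemod := FreeMod (delta_subproof i).

Lemma delta_coef (i j : {classic I}) : delta i j = (j == i)%:R. Proof. by []. Qed.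

Lemma delta_neq i j : i <> j -> delta i j = 0.
Proof. by move=> ij; rewrite delta_coef; case: eqP => // /esym. Qed.

Lemma delta_eq i : delta i i = 1.
Proof. by rewrite delta_coef eqxx. Qed.

Definition supp (f : freemod) : seq {classic I} := undup (sval (cid (fcoefP f))).

Lemma supp_uniq f : uniq (supp f). Proof. exact: undup_uniq. Qed.

Lemma suppP (f : freemod) (i : {classic I}) : f i <> 0 -> i \in supp f.
Proof. by rewrite mem_undup; case: cid => s /= sP /sP. Qed.

Lemma free_delta_sum (f : freemod) (s : seq {classic I}) : uniq s -> (forall i : {classic I}, f i <> 0 -> i \in s) ->
  f = \sum_(i <- s) f i *: delta i.
Proof.
move=> us sP; apply: freemodP => i; rewrite fcoef_sum.
have E (j : {classic I}) : (f j *: delta j) i = if j == i :> {classic I} then f j else 0.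
  by rewrite fcoefZ delta_coef eq_sym; case: eqP; rewrite ?mulr1 ?mulr0.
rewrite (eq_bigr _ (fun j _ => E j)) -big_mkcond /=.
have [/sP is_|/contrapT fi0] := pselect (f i <> 0).
  by rewrite (big_rem _ is_) /= eqxx big1_seq ?addr0 // => j /andP[/eqP ->]; rewrite rem_filter // mem_filter /= eqxx.
by rewrite fi0 big1 // => j /eqP ->.
Qed.

Section Extension.
Variables (V : lmodType R) (phi : I -> V).

Definition lin (f : freemod) : V := \sum_(i <- supp f) f i *: phi i.

(** The list [supp f] is an arbitrary choice, whereas linearity compares several elements over one
    common list. *)
Lemma linE (f : freemod) (s : seq {classic I}) : uniq s -> (forall i : {classic I}, f i <> 0 -> i \in s) ->
  lin f = \sum_(i <- s) f i *: phi i.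
Proof.
move=> us sP; rewrite /lin.
have H (t : seq {classic I}) : \sum_(i <- t) f i *: phi i = \sum_(i <- t | `[< f i <> 0 >]) f i *: phi i.
  rewrite [RHS]big_mkcond; apply: eq_bigr => i _; case: asboolP => // /contrapT ->.
  by rewrite scale0r.
rewrite H [RHS]H -big_filter -[RHS]big_filter; apply: perm_big.
apply: uniq_perm; rewrite ?filter_uniq ?supp_uniq // => i.
by rewrite !mem_filter; case: asboolP => // fi; rewrite suppP // sP.
Qed.

Lemma lin_linear : linear lin.
Proof.
move=> a f g; pose s := undup (supp f ++ supp g ++ supp (a *: f + g)).
have us : uniq s by exact: undup_uniq.
have sP h : h \in [:: f; g; a *: f + g] -> forall i : {classic I}, h i <> 0 -> i \in s.
  by rewrite !inE => /or3P[] /eqP -> i /suppP is_; rewrite mem_undup !mem_cat is_ ?orbT.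
rewrite !(linE us) //; try by apply: sP; rewrite !inE eqxx ?orbT.
rewrite scaler_sumr -big_split; apply: eq_bigr => i _ /=.
by rewrite scalerDl scalerA.
Qed.

Lemma lin_delta i : lin (delta i) = phi i.
Proof.
rewrite (@linE _ [:: i]) // ?big_seq1 ?delta_eq ?scale1r // => j.
by rewrite inE delta_coef; case: eqP.
Qed.

End Extension.

Lemma lin_id f : lin delta f = f.
Proof. by rewrite /lin -free_delta_sum ?supp_uniq //; exact: suppP. Qed.

(** The restriction to basis elements satisfying [P] serves lifts that are so far correct only up to
    some rank. *)
Lemma linear_ext_on (V : lmodType R) (P : I -> Prop) (phi psi : freemod -> V) :
  linear phi -> linear psi -> (forall i, P i -> phi (delta i) = psi (delta i)) ->
  forall f : freemod, (forall i, f i <> 0 -> P i) -> phi f = psi f.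
Proof.
move=> lphi lpsi E f fP.
rewrite -{1 2}[f]lin_id /lin (linP_sum lphi) (linP_sum lpsi).
apply: eq_bigr => i _; rewrite linPZ // [RHS]linPZ //.
have [/fP /E -> //|/contrapT ->] := pselect (f i <> 0).
by rewrite !scale0r.
Qed.

Lemma linear_ext (V : lmodType R) (phi psi : freemod -> V) :
  linear phi -> linear psi -> (forall i, phi (delta i) = psi (delta i)) -> phi =1 psi.
Proof. by move=> lphi lpsi E f; apply: (@linear_ext_on _ (fun=> True)). Qed.

Lemma lin_comp (V W : lmodType R) (phi : I -> V) (g : V -> W) : linear g ->
  forall f, g (lin phi f) = lin (g \o phi) f.
Proof.
move=> lg; apply: linear_ext => [||i]; last by rewrite !lin_delta.
  by apply: (linear_comp (lin_linear phi)).
exact: lin_linear.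
Qed.

End FreeModule.

Definition submod (R : comPzRingType) (V : lmodType R) (P : V -> Prop) : Prop :=
  P 0 /\ forall a u v, P u -> P v -> P (a *: u + v).

Section Submodules.
Variables (R : comPzRingType) (V : lmodType R) (P : V -> Prop).
Hypothesis sP : submod P.

Lemma submodD u v : P u -> P v -> P (u + v).
Proof. by move=> Pu Pv; have := sP.2 1 u v Pu Pv; rewrite scale1r. Qed.

Lemma submodZ a u : P u -> P (a *: u).
Proof. by move=> Pu; have := sP.2 a u 0 Pu sP.1; rewrite addr0. Qed.

Lemma submodN u : P u -> P (- u).
Proof. by move=> Pu; rewrite -scaleN1r; exact: submodZ. Qed.

Lemma submod_sum (I : eqType) (s : seq I) (F : I -> V) :
  (forall i, i \in s -> P (F i)) -> P (\sum_(i <- s) F i).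
Proof.
elim: s => [|i s IH] H; first by rewrite big_nil; exact: sP.1.
rewrite big_cons; apply: submodD; first by apply: H; rewrite inE eqxx.
by apply: IH => j js; apply: H; rewrite inE js orbT.
Qed.

(** Reduces a linear condition on an element to the basis elements occurring in it; homogeneity,
    bounds on weights and membership in an ideal are proved in this way. *)
Lemma submod_lin (I : Type) (phi : I -> V) (f : freemod R I) :
  (forall i, f i <> 0 -> P (phi i)) -> P (lin phi f).
Proof.
move=> H; apply: submod_sum => i _.
have [/H /submodZ //|/contrapT ->] := pselect (f i <> 0).
by rewrite scale0r; exact: sP.1.
Qed.

End Submodules.

Section GradedFree.
Variables (R : comPzRingType) (I : Type) (deg : I -> int).

Fact fpr_subproof k (f : freemod R I) : finsupp (fun i => if deg i == k then f i else 0).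
Proof. by have [s sP] := fcoefP f; exists s => i; case: eqP => // _; exact: sP. Qed.

Definition fpr k (f : freemod R I) : freemod R I := FreeMod (fpr_subproof k f).

Fact fpr_linear k : linear (fpr k).
Proof.
by move=> a f g; apply: freemodP => i /=; case: eqP => // _; rewrite mulr0 addr0.
Qed.

Fact fprK j k f : fpr j (fpr k f) = if j == k then fpr k f else 0.
Proof.
apply: freemodP => i /=; case: (eqVneq j k) => [->|jk] /=; first by case: (_ == _).
by case: eqP => // ->; rewrite (negbTE jk).
Qed.

Fact fpr_sum f : exists2 s : seq int, uniq s & f = \sum_(k <- s) fpr k f.
Proof.
pose s := undup (map (deg : {classic I} -> int) (supp f)); exists s; first exact: undup_uniq.
apply: freemodP => i; rewrite fcoef_sum /=.
under eq_bigr do rewrite eq_sym.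
rewrite -big_mkcond /=.
have [fi|/contrapT fi0] := pselect (f i <> 0); last by rewrite fi0 big1.
have ks : deg i \in s by rewrite mem_undup; apply: (@map_f {classic I}); exact: suppP.
rewrite (big_rem _ ks) /= eqxx big1_seq ?addr0 // => j /andP[/eqP ->].
by rewrite rem_filter ?undup_uniq // mem_filter /= eqxx.
Qed.

Definition fgmod : gmod R := GMod fpr_linear fprK fpr_sum.

Lemma homog_free k (f : fgmod) : homog k f <-> forall i, f i <> 0 -> deg i = k.
Proof.
split=> [H i|H].
  by apply: contra_notP => ik; rewrite -H /=; case: eqP.
apply: freemodP => i /=; case: eqP => // ik; apply: contrapT => fi.
by apply: ik; apply: H => fi0; apply: fi; rewrite fi0.
Qed.

Lemma homog_delta i : @homog _ fgmod (deg i) (delta R i).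
Proof.
apply/homog_free => j; rewrite delta_coef; by case: eqP => // ->.
Qed.

End GradedFree.

(** * The bar construction *)

Arguments op {R O} A {x y} p : rename.

(** * Koszul signs *)

Section Signs.
Variable R : comPzRingType.

Lemma sgn_parity (i : int) : sgn R i = (-1) ^+ odd `|i|.
Proof. by rewrite /sgn signr_odd. Qed.

Lemma sgnD (i j : int) : sgn R (i + j) = sgn R i * sgn R j.
Proof. by rewrite !sgn_parity -signr_addb; congr (_ ^+ _); lia. Qed.

Lemma sgn0 : sgn R 0 = 1. Proof. by rewrite /sgn expr0. Qed.

Lemma sgn1 : sgn R 1 = -1. Proof. by rewrite /sgn expr1. Qed.

Lemma sgnN1 : sgn R (-1) = -1. Proof. by rewrite /sgn expr1. Qed.

Lemma sgn_sq (i : int) : sgn R i * sgn R i = 1.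
Proof. by rewrite -sgnD sgn_parity (_ : odd _ = false) //; lia. Qed.

Lemma sgnS (i : int) : sgn R (i + 1) = - sgn R i.
Proof. by rewrite sgnD sgn1 mulrN1. Qed.

Lemma sgnB1 (i : int) : sgn R (i - 1) = - sgn R i.
Proof. by rewrite sgnD sgnN1 mulrN1. Qed.

End Signs.

Section Twist.
Variables (R : comPzRingType) (M : gmod R).
Implicit Types m : M.

Lemma gpr_eq0 (s : seq int) m i :
  m = \sum_(i <- s) gpr i m -> i \notin s -> gpr i m = 0.
Proof.
move=> E si; rewrite E (linP_sum (gpr_linear i)) big1_seq // => j /andP[_ js].
by rewrite gprK; case: eqP => // ij; rewrite ij js in si.
Qed.

Definition gsupp m : seq int := s2val (cid2 (gpr_sum m)).

Lemma gsupp_uniq m : uniq (gsupp m).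
Proof. by rewrite /gsupp; case: cid2. Qed.

Lemma gsupp_sum m : m = \sum_(i <- gsupp m) gpr i m.
Proof. by rewrite /gsupp; case: cid2. Qed.

Lemma gsuppP m i : gpr i m <> 0 -> i \in gsupp m.
Proof. by apply: contra_notT => /(gpr_eq0 (gsupp_sum m)). Qed.

Lemma homog_gpr i m : homog i (gpr i m).
Proof. by rewrite /homog gprK eqxx. Qed.

Lemma homog_submod i : submod (@homog R M i).
Proof.
split; first exact: (linP0 (gpr_linear i)).
by move=> a u v hu hv; rewrite /homog gpr_linear hu hv.
Qed.

Lemma linear_homog_ext (V : lmodType R) (f g : M -> V) :
  linear f -> linear g -> (forall i m, homog i m -> f m = g m) -> f =1 g.
Proof.
move=> lf lg E m; rewrite (gsupp_sum m) (linP_sum lf) (linP_sum lg).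
by apply: eq_bigr => i _; apply: E (homog_gpr i m).
Qed.

(* Multiplication by (-1) ^ (deg m - 1), the Koszul sign of an odd operator
   passing the desuspension of m. *)
Definition tau m : M := \sum_(i <- gsupp m) sgn R (i - 1) *: gpr i m.

Lemma tauE m (s : seq int) : uniq s -> (forall i, gpr i m <> 0 -> i \in s) ->
  tau m = \sum_(i <- s) sgn R (i - 1) *: gpr i m.
Proof.
move=> us sP; rewrite /tau.
have H (t : seq int) : \sum_(i <- t) sgn R (i - 1) *: gpr i m
    = \sum_(i <- t | `[< gpr i m <> 0 >]) sgn R (i - 1) *: gpr i m.
  rewrite [RHS]big_mkcond; apply: eq_bigr => i _; case: asboolP => // /contrapT ->.
  by rewrite scaler0.
rewrite H [RHS]H -big_filter -[RHS]big_filter; apply: perm_big.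
apply: uniq_perm; rewrite ?filter_uniq ?gsupp_uniq // => i.
by rewrite !mem_filter; case: asboolP => // fi; rewrite gsuppP // sP.
Qed.

Lemma tau_linear : linear tau.
Proof.
move=> a f g; pose s := undup (gsupp f ++ gsupp g ++ gsupp (a *: f + g)).
have us : uniq s by exact: undup_uniq.
have sP h : h \in [:: f; g; a *: f + g] -> forall i, gpr i h <> 0 -> i \in s.
  by rewrite !inE => /or3P[] /eqP -> i /gsuppP is_; rewrite mem_undup !mem_cat is_ ?orbT.
rewrite !(tauE us) //; try by apply: sP; rewrite !inE eqxx ?orbT.
rewrite scaler_sumr -big_split; apply: eq_bigr => i _ /=.
by rewrite gpr_linear scalerDr !scalerA mulrC.
Qed.

Lemma tau_homogE i m : homog i m -> tau m = sgn R (i - 1) *: m.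
Proof.
move=> hm; rewrite (@tauE _ [:: i]) ?big_seq1 ?hm // => j.
by rewrite -hm gprK inE; case: eqP.
Qed.

Lemma tauK : involutive tau.
Proof.
apply: linear_homog_ext; [exact: (linear_comp tau_linear tau_linear)|by []|].
move=> i m hm; rewrite [in LHS](tau_homogE hm) (linPZ tau_linear) (tau_homogE hm).
by rewrite scalerA sgn_sq scale1r.
Qed.

End Twist.

Section GradedMaps.
Variables (R : comPzRingType) (M N : gmod R) (f : M -> N).
Hypothesis gf : is_gmap f.

Lemma gmap_gpr i m : f (gpr i m) = gpr i (f m).
Proof.
have [lf hf] := gf; move: m; apply: linear_homog_ext.
- exact: (linear_comp (gpr_linear i) lf).
- exact: (linear_comp lf (gpr_linear i)).
move=> j m hm; have E : gpr j (f m) = f m := hf _ _ hm.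
rewrite -{1}hm gprK -E gprK; case: eqP => _; last exact: linP0.
by rewrite hm E.
Qed.

Lemma gmap_tau m : f (tau m) = tau (f m).
Proof.
have [lf hf] := gf; move: m; apply: linear_homog_ext.
- exact: (linear_comp (@tau_linear _ _) lf).
- exact: (linear_comp lf (@tau_linear _ _)).
by move=> i m hm; rewrite (tau_homogE hm) (tau_homogE (hf _ _ hm)) linPZ.
Qed.

End GradedMaps.

(** * Chains and sums over their cuts *)

Section Chains.
Variables (O : Type) (H : O -> O -> Type).

Lemma ccatA x y z w (p : chain H x y) (q : chain H y z) (r : chain H z w) :
  ccat (ccat p q) r = ccat p (ccat q r).
Proof. by elim: p q r => //= a b c f p IH q r; rewrite IH. Qed.

Lemma clen_ccat x y z (p : chain H x y) (q : chain H y z) :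
  clen (ccat p q) = (clen p + clen q)%N.
Proof. by elim: p q => //= a b c f p IH q; rewrite IH. Qed.

Lemma clen_cmap (O' : Type) (H' : O' -> O' -> Type) (F0 : O -> O')
    (F1 : forall x y, H x y -> H' (F0 x) (F0 y)) x y (p : chain H x y) :
  clen (cmap H' F0 F1 p) = clen p.
Proof. by elim: p => //= a b c f p ->. Qed.

Fixpoint allc (P : forall x y, H x y -> Prop) x y (p : chain H x y) : Prop :=
  match p with
  | cnil _ => True
  | ccons _ _ _ f p' => P _ _ f /\ allc P p'
  end.

Lemma allc_impl (P Q : forall x y, H x y -> Prop) x y (p : chain H x y) :
  (forall a b f, P a b f -> Q a b f) -> allc P p -> allc Q p.
Proof. by move=> PQ; elim: p => //= a b c f p IH [/PQ ? /IH]. Qed.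

Lemma allc_true (P : forall x y, H x y -> Prop) x y (p : chain H x y) :
  (forall a b f, P a b f) -> allc P p.
Proof. by move=> PT; elim: p => //= a b c f p IH. Qed.

End Chains.

Section MapChains.
Variables (O : Type) (H H' : O -> O -> Type) (f : forall x y, H x y -> H' x y).

(** The case of [cmap] in which the objects are fixed; its type mentions the endpoints themselves
    instead of their images under [id]. *)
Fixpoint cmapi x y (p : chain H x y) : chain H' x y :=
  match p with
  | cnil x => cnil x
  | ccons _ _ _ h p' => ccons (f h) (cmapi p')
  end.

Lemma cmap_idE x y (p : chain H x y) : cmap H' id f p = cmapi p.
Proof. by elim: p => //= a b c h p ->. Qed.

Lemma cmapi_ccat x y z (p : chain H x y) (q : chain H y z) :
  cmapi (ccat p q) = ccat (cmapi p) (cmapi q).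
Proof. by elim: p q => //= a b c h p IH q; rewrite IH. Qed.

Lemma clen_cmapi x y (p : chain H x y) : clen (cmapi p) = clen p.
Proof. by elim: p => //= a b c h p ->. Qed.

Lemma allc_cmapi (P : forall x y, H' x y -> Prop) x y (p : chain H x y) :
  allc P (cmapi p) <-> allc (fun a b h => P a b (f h)) p.
Proof. by elim: p => //= a b c h p ->. Qed.

End MapChains.

Lemma cmap_ext_in (O O' : Type) (H : O -> O -> Type) (H' : O' -> O' -> Type)
    (F0 : O -> O') (F1 G1 : forall x y, H x y -> H' (F0 x) (F0 y)) x y
    (p : chain H x y) :
  allc (fun a b f => F1 a b f = G1 a b f) p -> cmap H' F0 F1 p = cmap H' F0 G1 p.
Proof. by elim: p => //= a b c f p IH [-> /IH ->]. Qed.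

Section SplitSums.
Variables (R : comPzRingType) (O : Type) (H : O -> O -> Type).

(** Deconcatenation in recursive form: the summand is a function of the two pieces, so that sums
    over cuts simplify along the chain. *)
Fixpoint splitsum (V : lmodType R) x y (p : chain H x y) :
    (forall m, chain H x m -> chain H m y -> V) -> V :=
  match p in chain _ x y return (forall m, chain H x m -> chain H m y -> V) -> V with
  | cnil x => fun F => F x (cnil x) (cnil x)
  | ccons x _ _ f p' => fun F =>
      F x (cnil x) (ccons f p') + splitsum p' (fun m a b => F m (ccons f a) b)
  end.

Variable V : lmodType R.

Lemma eq_splitsum x y (p : chain H x y) (F G : forall m, chain H x m -> chain H m y -> V) :
  (forall m a b, F m a b = G m a b) -> splitsum p F = splitsum p G.
Proof. by elim: p F G => //= a b c f p IH F G E; rewrite E (IH _ _ (fun m u v => E _ _ _)). Qed.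

Lemma splitsumD x y (p : chain H x y) (F G : forall m, chain H x m -> chain H m y -> V) :
  splitsum p (fun m a b => F m a b + G m a b) = splitsum p F + splitsum p G.
Proof. by elim: p F G => //= a b c f p IH F G; rewrite IH addrACA. Qed.

Lemma splitsum_map (W : lmodType R) (g : V -> W) x y (p : chain H x y)
    (F : forall m, chain H x m -> chain H m y -> V) :
  linear g -> g (splitsum p F) = splitsum p (fun m a b => g (F m a b)).
Proof. by move=> lg; elim: p F => //= a b c f p IH F; rewrite linPD // IH. Qed.

Lemma splitsumN x y (p : chain H x y) (F : forall m, chain H x m -> chain H m y -> V) :
  splitsum p (fun m a b => - F m a b) = - splitsum p F.
Proof. by elim: p F => //= a b c f p IH F; rewrite IH opprD. Qed.

Lemma splitsum_linear (U : lmodType R) x y (p : chain H x y)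
    (F : U -> forall m, chain H x m -> chain H m y -> V) :
  (forall m a b, linear (fun u => F u m a b)) -> linear (fun u => splitsum p (F u)).
Proof.
elim: p F => //= a b c f p IH F lF.
by apply: linear_add => //; apply: IH.
Qed.

Lemma splitsum0 x y (p : chain H x y) (F : forall m, chain H x m -> chain H m y -> V) :
  (forall m a b, F m a b = 0) -> splitsum p F = 0.
Proof. by elim: p F => //= a b c f p IH F E; rewrite E IH ?addr0. Qed.

Lemma splitsum_ccat x y z w (p : chain H x y) (e : H y z) (q : chain H z w)
    (F : forall m, chain H x m -> chain H m w -> V) :
  splitsum (ccat p (ccons e q)) F =
    splitsum p (fun m a b => F m a (ccat b (ccons e q)))
    + splitsum q (fun m a b => F m (ccat p (ccons e a)) b).
Proof. by elim: p e F => //= a b c f p IH e F; rewrite IH addrA. Qed.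

(** Coassociativity of deconcatenation: both sides run over the ways of cutting [p] into three
    pieces. *)
Lemma splitsumA x y (p : chain H x y)
    (F : forall m n, chain H x m -> chain H m n -> chain H n y -> V) :
  splitsum p (fun m a q => splitsum q (fun n b c => F m n a b c)) =
  splitsum p (fun n q c => splitsum q (fun m a b => F m n a b c)).
Proof.
elim: p F => //= a b c f p IH F.
by rewrite splitsumD IH !addrA.
Qed.

Lemma sum_csplits x y (p : chain H x y) (F : forall m, chain H x m -> chain H m y -> V) :
  \sum_(s <- csplits p) F _ (cpre s) (cpost s) = splitsum p F.
Proof.
elim: p F => /= [a F|a b c f p IH F]; first by rewrite big_seq1.
by rewrite big_cons big_map /= -IH.
Qed.

End SplitSums.

(** * Coderivations of the bar construction *)

Section Bar.
Variables (R : comPzRingType) (O : Type) (N : gquiver R O).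
Notation ch := (gchain N).

(** A multilinear function of chains stands for a linear map out of a tensor product of Hom
    modules. *)
Definition mult (V : lmodType R) x y (phi : ch x y -> V) : Prop :=
  forall z w (a : ch x z) (c : ch w y), linear (fun f : N z w => phi (ccat a (ccons f c))).

Section MultLemmas.
Variable V : lmodType R.

Lemma mult_head x y z (phi : ch x y -> V) (c : ch z y) :
  mult phi -> linear (fun f : N x z => phi (ccons f c)).
Proof. by move=> mphi; exact: (mphi _ _ (cnil x) c). Qed.

Lemma mult_tail x y z (phi : ch x y -> V) (f : N x z) :
  mult phi -> mult (fun q : ch z y => phi (ccons f q)).
Proof. by move=> mphi u v a c; exact: (mphi _ _ (ccons f a) c). Qed.

Lemma mult_ccatl x y z (phi : ch x y -> V) (a : ch x z) :
  mult phi -> mult (fun q : ch z y => phi (ccat a q)).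
Proof. by elim: a phi => //= u v w f a IH phi /(mult_tail f) /IH. Qed.

Lemma mult_ccatr x y z (phi : ch x y -> V) (c : ch z y) :
  mult phi -> mult (fun q : ch x z => phi (ccat q c)).
Proof.
move=> mphi u v a b k f g; rewrite !ccatA /=; exact: mphi.
Qed.

Lemma mult_map (W : lmodType R) (g : V -> W) x y (phi : ch x y -> V) :
  linear g -> mult phi -> mult (fun p => g (phi p)).
Proof. by move=> lg mphi u v a c; apply: (linear_comp (mphi _ _ a c) lg). Qed.

Lemma mult_add x y (phi psi : ch x y -> V) :
  mult phi -> mult psi -> mult (fun p => phi p + psi p).
Proof. by move=> mphi mpsi u v a c; apply: linear_add; [exact: mphi|exact: mpsi]. Qed.

Lemma mult_zero x y : mult (fun _ : ch x y => 0 : V).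
Proof. by move=> u v a c; exact: linear_zero. Qed.

Definition spans (P : forall x y, N x y -> Prop) : Prop :=
  forall x y (W : lmodType R) (f g : N x y -> W),
    linear f -> linear g -> (forall m, P x y m -> f m = g m) -> f =1 g.

(** The arrows are moved into the spanning set one head at a time. The two uses are homogeneous
    arrows, on which signs are explicit, and basis elements. *)
Lemma mult_ext (P : forall x y, N x y -> Prop) : spans P ->
  forall x y (phi psi : ch x y -> V) (p : ch x y), mult phi -> mult psi ->
  (forall q, clen q = clen p -> allc P q -> phi q = psi q) -> phi p = psi p.
Proof.
move=> sP x y phi psi p; elim: p phi psi => [z|a b c f p IH] phi psi mphi mpsi E.
  exact: E.
have {}E q : clen q = (clen p).+1 -> allc P q -> phi q = psi q by apply: E.
move: f; apply: (sP _ _ _ (fun f => phi (ccons f p)) (fun f => psi (ccons f p))).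
- exact: mult_head.
- exact: mult_head.
move=> f Pf; apply: (IH (fun q => phi (ccons f q)) (fun q => psi (ccons f q))).
- exact: mult_tail.
- exact: mult_tail.
by move=> q qp Pq; apply: E => //=; rewrite qp.
Qed.

End MultLemmas.

Definition ctau x y (p : ch x y) : ch x y := cmapi (fun a b => @tau R (N a b)) p.

Lemma ctau_ccat x y z (p : ch x y) (q : ch y z) : ctau (ccat p q) = ccat (ctau p) (ctau q).
Proof. exact: cmapi_ccat. Qed.

Lemma mult_tau (V : lmodType R) x y (phi : ch x y -> V) :
  mult phi -> mult (fun q => phi (ctau q)).
Proof.
move=> mphi u v a c k f g; rewrite !ctau_ccat /= tau_linear; exact: mphi.
Qed.

Section OneOperation.
Variable kappa : forall x y, ch x y -> N x y.

(* Precomposition of phi with the coderivation of the bar construction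
   cogenerated by kappa. *)
Fixpoint bar (V : lmodType R) x y (p : ch x y) : (ch x y -> V) -> V :=
  match p in chain _ x y return (ch x y -> V) -> V with
  | cnil x => fun _ => 0
  | ccons _ _ _ f p' => fun phi =>
      splitsum p' (fun m a b => phi (ccons (kappa (ccons f a)) b))
      + bar p' (fun q => phi (ccons (tau f) q))
  end.

Lemma eq_bar (V : lmodType R) x y (p : ch x y) (phi psi : ch x y -> V) :
  (forall q, (0 < clen q)%N -> phi q = psi q) -> bar p phi = bar p psi.
Proof.
elim: p phi psi => //= a b c f p IH phi psi E.
rewrite (IH _ (fun q => psi (ccons (tau f) q))); last by move=> q _; exact: E.
by congr (_ + _); apply: eq_splitsum => m u v; exact: E.
Qed.

Lemma barD (V : lmodType R) x y (p : ch x y) (phi psi : ch x y -> V) :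
  bar p (fun q => phi q + psi q) = bar p phi + bar p psi.
Proof.
elim: p phi psi => /= [a phi psi|a b c f p IH phi psi]; first by rewrite addr0.
by rewrite splitsumD IH addrACA.
Qed.

Lemma bar_map (V W : lmodType R) (g : V -> W) x y (p : ch x y) (phi : ch x y -> V) :
  linear g -> g (bar p phi) = bar p (fun q => g (phi q)).
Proof.
move=> lg; elim: p phi => /= [a phi|a b c f p IH phi]; first exact: linP0.
by rewrite linPD // IH splitsum_map.
Qed.

Lemma barN (V : lmodType R) x y (p : ch x y) (phi : ch x y -> V) :
  bar p (fun q => - phi q) = - bar p phi.
Proof.
elim: p phi => /= [a phi|a b c f p IH phi]; first by rewrite oppr0.
by rewrite splitsumN IH opprD.
Qed.

Lemma bar0 (V : lmodType R) x y (p : ch x y) (phi : ch x y -> V) :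
  (forall q, (0 < clen q)%N -> phi q = 0) -> bar p phi = 0.
Proof.
move=> E; rewrite (@eq_bar _ _ _ _ _ (fun=> 0)) //.
by rewrite -(@bar_map V V (fun=> 0) _ _ p phi) //; exact: linear_zero.
Qed.

Lemma bar_linear (U V : lmodType R) x y (p : ch x y) (phi : U -> ch x y -> V) :
  (forall q, linear (fun u => phi u q)) -> linear (fun u => bar p (phi u)).
Proof.
elim: p phi => /= [a phi _|a b c f p IH phi lphi]; first exact: linear_zero.
by apply: linear_add; [apply: splitsum_linear|apply: IH].
Qed.

(** The inserted operation lies within [p], or within [q] behind the signs of [p] and [e], or has
    [e] among its inputs. *)
Lemma bar_ccat (V : lmodType R) x y z w (p : ch x y) (e : N y z) (q : ch z w)
    (phi : ch x w -> V) :
  bar (ccat p (ccons e q)) phi =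
    bar p (fun u => phi (ccat u (ccons e q)))
    + bar q (fun v => phi (ccat (ctau p) (ccons (tau e) v)))
    + splitsum p (fun _ u v => splitsum q (fun _ m r =>
        phi (ccat (ctau u) (ccons (kappa (ccat v (ccons e m))) r)))).
Proof.
elim: p e phi => /= [a e phi|a b c g p IH e phi]; first by rewrite add0r addrC.
rewrite IH splitsum_ccat /= !addrA; congr (_ + _).
rewrite -!addrA; congr (_ + _).
by rewrite addrC !addrA.
Qed.

Hypothesis mkappa : forall x y, mult (@kappa x y).

Lemma bar_mult (V : lmodType R) x y (phi : ch x y -> V) :
  mult phi -> mult (fun p => bar p phi).
Proof.
move=> mphi z w a c.
under [X in linear X]eq_fun do rewrite bar_ccat.
apply: linear_add; first apply: linear_add.
- by apply: bar_linear => q; exact: mphi.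
- apply: bar_linear => q.
  apply: (linear_comp (@tau_linear _ _) (mphi _ _ (ctau a) q)).
- apply: splitsum_linear => m u v; apply: splitsum_linear => n s t.
  exact: (linear_comp (mkappa v s) (mphi _ _ (ctau u) t)).
Qed.

(** The co-Leibniz rule: cutting after the coderivation amounts to applying it to one of the two
    pieces, with [ctau a] the sign for passing the left one. *)
Lemma bar_split (V : lmodType R) x y (p : ch x y)
    (psi : forall m, ch x m -> ch m y -> V) :
  bar p (fun q => splitsum q psi) =
    splitsum p (fun m a b => bar a (fun u => psi m u b) + bar b (fun v => psi m (ctau a) v)).
Proof.
elim: p psi => /= [a psi|a b c f p IH psi]; first by rewrite addr0.
rewrite splitsumD barD IH add0r !splitsumD.
rewrite (splitsumA p (fun m n u v w => psi n (ccons (kappa (ccons f u)) v) w)).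
rewrite -!addrA; congr (_ + _); rewrite !addrA; congr (_ + _); congr (_ + _).
by rewrite addrC.
Qed.

End OneOperation.

(** The coderivation cogenerated by an even operation: unlike in [bar], no sign arises from passing
    [f]. *)
Fixpoint coder (E : forall x y, ch x y -> N x y) (V : lmodType R) x y (p : ch x y) :
    (ch x y -> V) -> V :=
  match p in chain _ x y return (ch x y -> V) -> V with
  | cnil x => fun _ => 0
  | ccons _ _ _ f p' => fun phi =>
      splitsum p' (fun m a b => phi (ccons (E _ _ (ccons f a)) b))
      + coder E p' (fun q => phi (ccons f q))
  end.

(* The square of an odd coderivation is a coderivation: the insertions at
   disjoint places cancel because kappa anticommutes with tau. *)
Lemma bar_bar (kappa : forall x y, ch x y -> N x y)
    (kappa_tau : forall x y (p : ch x y), kappa _ _ (ctau p) = - tau (kappa _ _ p))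
    (V : lmodType R) x y (p : ch x y) (phi : ch x y -> V) : mult phi ->
  bar kappa p (fun q => bar kappa q phi)
  = coder (fun a b q => bar kappa q (@kappa a b)) p phi.
Proof.
elim: p phi => //= a b c f p IH phi mphi.
rewrite barD tauK IH; last exact: mult_tail.
rewrite addrA; congr (_ + _).
rewrite bar_split !splitsumD /=.
have cancel m (u : ch b m) (v : ch m c) :
    bar kappa v (fun q => phi (ccons (kappa _ _ (ccons (tau f) (ctau u))) q))
    = - bar kappa v (fun q => phi (ccons (tau (kappa _ _ (ccons f u))) q)).
  rewrite -barN; apply: eq_bar => q _.
  rewrite -[ccons (tau f) (ctau u)]/(ctau (ccons f u)) kappa_tau.
  exact: (linPN (mult_head q mphi)).
rewrite (eq_splitsum p cancel) splitsumN.
rewrite [_ + - _]addrC addrA addrK.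
rewrite (splitsumA p (fun m n u v w => phi (ccons (kappa _ _ (ccons (kappa _ _ (ccons f u)) v)) w))).
rewrite -splitsumD; apply: eq_splitsum => m u v.
have lh := mult_head v mphi.
by rewrite (linPD lh) (splitsum_map _ _ lh) (bar_map _ _ _ lh).
Qed.

End Bar.

Section Weight.
Variables (O : Type) (H : O -> O -> Type) (P : forall x y, int -> H x y -> Prop).

(** [P i f] may hold for several [i]. With an equality of degrees this is a grading, with an upper
    bound it is a filtration, and the estimates for degrees and for weights are both instances. *)
Fixpoint wt x y (p : chain H x y) (k : int) : Prop :=
  match p with
  | cnil _ => k = 0
  | ccons _ _ _ f p' => exists2 i, P i f & wt p' (k - i)
  end.

End Weight.

Section SplitSumEnds.
Variables (R : comPzRingType) (O : Type) (H : O -> O -> Type) (V : lmodType R).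

Lemma splitsum_nill x y (p : chain H x y) (F : forall m, chain H x m -> chain H m y -> V) :
  (forall m a b, (0 < clen a)%N -> F m a b = 0) -> splitsum p F = F x (cnil x) p.
Proof.
case: p F => //= a b c f p F E.
by rewrite splitsum0 ?addr0 // => m u v; exact: E.
Qed.

Lemma splitsum_nilr x y (p : chain H x y) (F : forall m, chain H x m -> chain H m y -> V) :
  (forall m a b, (0 < clen b)%N -> F m a b = 0) -> splitsum p F = F y p (cnil y).
Proof.
elim: p F => //= a b c f p IH F E.
by rewrite E // add0r IH // => m u v; exact: E.
Qed.

Lemma ccat_nil x y (p : chain H x y) : ccat p (cnil y) = p.
Proof. by elim: p => //= a b c f p ->. Qed.

End SplitSumEnds.

(** * The differential separated from the higher operations *)

Section Operations.
Variables (R : comPzRingType) (O : Type) (N : gquiver R O).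
Notation ch := (gchain N).

(** The projection of the bar construction onto its cogenerators. *)
Definition pi1 x y (p : ch x y) : N x y :=
  match p in chain _ x y return N x y with
  | cnil x => 0
  | ccons x _ _ f q =>
      match q in chain _ y z return N x y -> N x z with
      | cnil _ => fun f => f
      | ccons _ _ _ _ _ => fun _ => 0
      end f
  end.

Arguments pi1 [x y] p : simpl never.

Lemma pi1_long x y (p : ch x y) : (1 < clen p)%N -> pi1 p = 0.
Proof. by case: p => // a b c f p; case: p f. Qed.

Lemma mult_pi1 x y : mult (@pi1 x y).
Proof.
move=> z w a c; case: a y c => [u y c|u v w' g a y c].
  by case: c => [t|*]; [move=> k f f'|exact: linear_zero].
have E (f : N w' w) : pi1 (ccat (ccons g a) (ccons f c)) = 0.
  by rewrite pi1_long //= clen_ccat /= addnS.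
by move=> k f f'; rewrite !E scaler0 addr0.
Qed.

(** The corestriction of the coderivation is [kappa] again, so a composite ending in [pi1] becomes a
    plain operation. *)
Lemma bar_pi1 (kappa : forall x y, ch x y -> N x y) x y (p : ch x y) :
  (0 < clen p)%N -> bar kappa p (@pi1 x y) = kappa _ _ p.
Proof.
case: p => // a b c f p _ /=.
rewrite bar0 ?addr0; last by move=> q q0; rewrite pi1_long.
by rewrite splitsum_nilr // => m u v v0; rewrite pi1_long.
Qed.

(** The coderivation of an operation supported in arity one sees only the single arrows of the
    chain. *)
Lemma coder0 (E : forall x y, ch x y -> N x y) (V : lmodType R) x y (p : ch x y)
    (phi : ch x y -> V) :
  (forall x y (q : ch x y), (1 < clen q)%N -> E _ _ q = 0) ->
  allc (fun _ _ f => E _ _ (csing f) = 0) p -> mult phi -> coder E p phi = 0.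
Proof.
move=> E0; elim: p phi => //= a b c f p IH phi [Ef Ep] mphi.
rewrite IH //; last exact: mult_tail.
have lh m (v : ch m c) := mult_head v mphi.
rewrite splitsum_nill => [|m u v u0]; first by rewrite Ef (linP0 (lh _ _)) addr0.
by rewrite E0 // (linP0 (lh _ _)).
Qed.

Section Differential.
Variable d : forall x y, N x y -> N x y.
Hypothesis dl : forall x y, linear (@d x y).

Fixpoint bard (V : lmodType R) x y (p : ch x y) : (ch x y -> V) -> V :=
  match p in chain _ x y return (ch x y -> V) -> V with
  | cnil x => fun _ => 0
  | ccons _ _ _ f p' => fun phi =>
      phi (ccons (d f) p') + bard p' (fun q => phi (ccons (tau f) q))
  end.

Lemma eq_bard (V : lmodType R) x y (p : ch x y) (phi psi : ch x y -> V) :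
  (forall q, (0 < clen q)%N -> phi q = psi q) -> bard p phi = bard p psi.
Proof.
elim: p phi psi => //= a b c f p IH phi psi E.
by rewrite E // (IH _ (fun q => psi (ccons (tau f) q))) // => q _; exact: E.
Qed.

Lemma bard_map (V W : lmodType R) (g : V -> W) x y (p : ch x y) (phi : ch x y -> V) :
  linear g -> g (bard p phi) = bard p (fun q => g (phi q)).
Proof.
move=> lg; elim: p phi => /= [a phi|a b c f p IH phi]; first exact: linP0.
by rewrite linPD // IH.
Qed.

Lemma bard0 (V : lmodType R) x y (p : ch x y) (phi : ch x y -> V) :
  (forall q, (0 < clen q)%N -> phi q = 0) -> bard p phi = 0.
Proof.
by move=> E; elim: p phi E => //= a b c f p IH phi E; rewrite E // IH ?addr0 // => q _; exact: E.
Qed.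

Lemma bard_pi1 x y (p : ch x y) : bard p (@pi1 x y) = d (pi1 p).
Proof.
case: p => [a|a b c f p]; first by rewrite (linP0 (@dl _ _)).
rewrite /= bard0 ?addr0; last by move=> q q0; rewrite pi1_long.
by case: p f => // u v w g p f; rewrite !pi1_long // (linP0 (@dl _ _)).
Qed.

Lemma bardD (V : lmodType R) x y (p : ch x y) (phi psi : ch x y -> V) :
  bard p (fun q => phi q + psi q) = bard p phi + bard p psi.
Proof.
elim: p phi psi => /= [a phi psi|a b c f p IH phi psi]; first by rewrite addr0.
by rewrite IH addrACA.
Qed.

Variable nu : forall x y, ch x y -> N x y.
Hypothesis nu_short : forall x y (p : ch x y), (clen p <= 1)%N -> nu p = 0.

Definition mu x y (p : ch x y) : N x y := nu p + d (pi1 p).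

Lemma mu_long x y (p : ch x y) : (1 < clen p)%N -> mu p = nu p.
Proof. by move=> p1; rewrite /mu pi1_long // (linP0 (@dl _ _)) addr0. Qed.

Lemma mu_sing x y (f : N x y) : mu (csing f) = d f.
Proof. by rewrite /mu nu_short // add0r. Qed.

Lemma mu_nil x : mu (cnil x) = 0.
Proof. by rewrite /mu nu_short // (linP0 (@dl _ _)) addr0. Qed.

Lemma bar_mu (V : lmodType R) x y (p : ch x y) (phi : ch x y -> V) :
  mult phi -> bar mu p phi = bar nu p phi + bard p phi.
Proof.
elim: p phi => /= [a phi _|a b c f p IH phi mphi]; first by rewrite addr0.
rewrite IH; last exact: mult_tail.
have lh m (v : ch m c) := mult_head v mphi.
rewrite (eq_splitsum p (fun m u v => linPD (lh m v) _ _)) splitsumD.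
rewrite [X in (_ + X) + _](_ : _ = phi (ccons (d f) p)); first by rewrite addrACA.
rewrite splitsum_nill //= => m u v u0.
by rewrite pi1_long // (linP0 (@dl _ _)) (linP0 (lh _ _)).
Qed.

Hypothesis nu_mult : forall x y, mult (@nu x y).

Lemma mu_mult x y : mult (@mu x y).
Proof. apply: mult_add => //; apply: mult_map => //; exact: mult_pi1. Qed.

(** Splits the A_oo-relation into the part of arity at least 2, which can be solved for [d (nu p)],
    and the part d^2, present in arity 1 only. The former can thus be established before the
    latter. *)
Lemma bar_mu_mu x y (p : ch x y) : (0 < clen p)%N ->
  bar mu p (@mu x y) =
    d (nu p) + bard p (@nu x y) + bar nu p (@nu x y) + d (d (pi1 p)).
Proof.
move=> p0; rewrite bar_mu; last exact: mu_mult.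
rewrite (@barD _ _ _ _ _ _ _ _ (@nu x y)) bardD -bar_map // -bard_map // bar_pi1 // bard_pi1.
by rewrite [bar _ _ _ + d _]addrC -!addrA; congr (_ + _); rewrite addrCA.
Qed.

(** Let b be the coderivation of [mu], and compute [pi1] b^3 in both groupings. As [pi1] b^2 is d^2
    on chains of length one and 0 on longer ones, one grouping is d^2 of [nu p], and the other
    inserts d^2 into the single arrows of [p], where it vanishes. *)
Lemma d_d_nu x y (p : ch x y) :
  (forall x y (p : ch x y), mu (ctau p) = - tau (mu p)) ->
  (forall x y (q : ch x y), (1 < clen q)%N ->
     d (nu q) + bard q (@nu x y) + bar nu q (@nu x y) = 0) ->
  (1 < clen p)%N -> allc (fun a b f => d (d f) = 0) p -> d (d (nu p)) = 0.
Proof.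
move=> mu_tau rel p1 dp.
have E a b (q : ch a b) : (0 < clen q)%N -> bar mu q (@mu a b) = d (d (pi1 q)).
  move=> q0; rewrite bar_mu_mu //; case: (ltnP 1 (clen q)) => q1.
    by rewrite rel // add0r.
  rewrite -[RHS]add0r; congr (_ + _).
  case: q q0 q1 => // s t u f q; case: q f => //= w f _ _.
  by rewrite !nu_short // (linP0 (@dl _ _)) !addr0.
have dd_lin a b : linear (fun f : N a b => d (d f)) by apply: (linear_comp (@dl _ _) (@dl _ _)).
have := bar_bar mu_tau p (@mu_mult x y).
rewrite (eq_bar _ _ (fun q q0 => E _ _ q q0)) -(bar_map _ _ _ (dd_lin _ _)) bar_pi1; last exact: ltnW.
rewrite mu_long // => ->.
apply: coder0; first by move=> a b q q1; rewrite E ?pi1_long ?(linP0 (dd_lin _ _)) //; exact: ltnW.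
  by apply: allc_impl dp => a b f df; rewrite E.
exact: mu_mult.
Qed.

End Differential.

Section Weights.
Variable P : forall x y, int -> N x y -> Prop.

Hypothesis P_tau : forall x y i (f : N x y), P i f -> P i (tau f).

Section OneFunctional.
Variables (V : lmodType R) (S : int -> V -> Prop).
Hypothesis Ssub : forall k, submod (S k).

Lemma splitsum_wt x y (p : ch x y) k (F : forall m, ch x m -> ch m y -> V) l :
  wt P p k -> (forall m a b i j, wt P a i -> wt P b j -> i + j = k -> S l (F m a b)) ->
  S l (splitsum p F).
Proof.
elim: p k F => /= [a k F -> E|a b c f p IH k F [i Pi wp] E].
  by apply: (E _ _ _ 0 0) => //=; rewrite addr0.
apply: (submodD (Ssub l)).
  by apply: (E _ _ _ 0 k) => //=; [exists i|rewrite add0r].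
apply: (IH (k - i)) => // m u v r s wu wv rs.
apply: (E _ _ _ (i + r) s) => //=; last by lia.
by exists i => //; have -> : i + r - i = r by lia.
Qed.

Lemma bar_wt (kappa : forall x y, ch x y -> N x y) (c c' : int) x y (p : ch x y) k
    (phi : ch x y -> V) :
  (forall x y (q : ch x y) k, (0 < clen q)%N -> wt P q k -> P (k + c) (kappa _ _ q)) ->
  (forall q k, (0 < clen q)%N -> wt P q k -> S (k + c') (phi q)) ->
  wt P p k -> S (k + c + c') (bar kappa p phi).
Proof.
move=> kP; elim: p k c' phi => /= [a k c' phi _ _|a b z f p IH k c' phi phiP [i Pi wp]].
  exact: (Ssub _).1.
apply: (submodD (Ssub _)).
  apply: (splitsum_wt wp) => m u v r s wu wv rs.
  apply: phiP => //=; exists (i + r + c); last by have -> : k + c - (i + r + c) = s by lia.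
  by apply: kP => //=; exists i => //; have -> : i + r - i = r by lia.
(* The head, once passed, becomes part of the functional, so its weight [i] moves from the chain to
   the shift. *)
have -> : k + c + c' = (k - i) + c + (i + c') by lia.
apply: (IH (k - i) (i + c')) => // q l q0 wq.
rewrite addrA; apply: phiP => //=; exists i; first exact: P_tau.
by rewrite addrK.
Qed.

Lemma bard_wt (d : forall x y, N x y -> N x y) (c c' : int) x y (p : ch x y) k
    (phi : ch x y -> V) :
  (forall q k, (0 < clen q)%N -> wt P q k -> S (k + c') (phi q)) ->
  wt P p k -> allc (fun x y f => forall k, P k f -> P (k + c) (d x y f)) p ->
  S (k + c + c') (bard d p phi).
Proof.
elim: p k c' phi => /= [a k c' phi _ _ _|a b z f p IH k c' phi phiP [i Pi wp] [dP dp]].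
  exact: (Ssub _).1.
apply: (submodD (Ssub _)).
  apply: phiP => //=; exists (i + c); first exact: dP.
  by have -> : k + c - (i + c) = k - i by lia.
have -> : k + c + c' = (k - i) + c + (i + c') by lia.
apply: (IH (k - i) (i + c')) => // q l q0 wq.
rewrite addrA; apply: phiP => //=; exists i; first exact: P_tau.
by rewrite addrK.
Qed.

End OneFunctional.
End Weights.

(** * Strict units and the relations *)

Section Units.
Variables (mu : forall x y, ch x y -> N x y) (e : forall x, N x x).
Hypothesis mmult : forall x y, mult (@mu x y).
Hypothesis mu_tau : forall x y (p : ch x y), mu (ctau p) = - tau (mu p).
Hypothesis tau_e : forall x, tau (e x) = - e x.
Hypothesis mu_e : forall x, mu (csing (e x)) = 0.
Hypothesis mu_idr : forall x y (f : N x y), mu (ccons (e x) (csing f)) = f.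
Hypothesis mu_idl : forall x y (f : N x y), mu (ccons f (csing (e y))) = - tau f.
Hypothesis mu_idn : forall x y z (p : ch x y) (q : ch y z),
  (2 <= clen p + clen q)%N -> mu (ccat p (ccons (e y) q)) = 0.

(** Only the products of [e y] with a neighbour survive. Both return the chain without the unit,
    with opposite signs, so a term is left over only when the unit stands at an end. *)
Lemma splitsum_unit (V : lmodType R) x y z (a : ch x y) (c : ch y z) (phi : ch x z -> V) :
  mult phi ->
  splitsum a (fun _ u v => splitsum c (fun _ m r =>
        phi (ccat (ctau u) (ccons (mu (ccat v (ccons (e y) m))) r))))
  = (if (0 < clen c)%N then phi (ccat (ctau a) c) else 0)
    - (if (0 < clen a)%N then phi (ccat (ctau a) c) else 0).
Proof.
elim: a c phi => /= [s c phi mphi|s t w g a IH c phi mphi].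
  rewrite subr0; case: c phi mphi => /= [u|u v w f c] phi mphi.
    by rewrite mu_e (linP0 (mult_head _ mphi)).
  rewrite mu_e (linP0 (mult_head _ mphi)) add0r splitsum_nill /= ?mu_idr // => m p q p0.
  by rewrite (mu_idn (p := cnil _) (q := ccons f p)) ?(linP0 (mult_head _ mphi)).
rewrite (IH c (fun q => phi (ccons (tau g) q))); last exact: mult_tail.
case: a g c phi mphi {IH} => /= [u|u v w' h a] g c phi mphi.
  rewrite subr0 splitsum_nill => [|m p q p0].
    by rewrite mu_idl (linPN (mult_head _ mphi)) addrC.
  by rewrite (mu_idn (p := csing g)) // (linP0 (mult_head _ mphi)).
rewrite splitsum0 ?add0r // => m p q.
by rewrite (mu_idn (p := ccons g (ccons h a))) // (linP0 (mult_head _ mphi)).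
Qed.

(** In the interior of the chain the two products with the unit cancel. At an end the product left
    over cancels against the unit multiplied by the operation on the remaining arrows. *)
Lemma bar_unit x y z (a : ch x y) (c : ch y z) : (0 < clen a + clen c)%N ->
  bar mu (ccat a (ccons (e y) c)) (@mu x z) = 0.
Proof.
move=> ac; rewrite bar_ccat splitsum_unit //.
have [a0|a0] := posnP (clen a); have [c0|c0] := posnP (clen c).
- by rewrite a0 c0 in ac.
- case: a a0 {ac} c c0 => // s _ c c0 /=; rewrite subr0 add0r.
  rewrite (@eq_bar _ _ _ _ _ _ _ _ _ (fun v => - pi1 v)) ?barN ?bar_pi1 ?addNr // => v v0.
  rewrite tau_e (linPN (mult_head _ (@mmult _ _))); congr (- _).
  case: v v0 {c c0} => // p q r f v _; case: v f => [u|u v w g l] f; first exact: mu_idr.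
  by rewrite pi1_long // (mu_idn (p := cnil _)).
- case: c c0 a a0 {ac} => // s _ a a0; rewrite sub0r /= addr0 ccat_nil mu_tau opprK.
  rewrite (@eq_bar _ _ _ _ _ _ _ _ _ (fun v => - tau (pi1 v))) => [|v v0].
    by rewrite barN -bar_map ?bar_pi1 ?addNr //; exact: tau_linear.
  case: v v0 {a a0} => // p q r f v _; case: v f => [u|u v w g l] f /=; first exact: mu_idl.
  by rewrite pi1_long // (linP0 (@tau_linear _ _)) oppr0 (mu_idn (p := ccons f (ccons g l))).
rewrite subrr addr0 !bar0 ?addr0 // => q q0.
  by rewrite tau_e (linPN (@mmult _ _ _ _ _ _)) mu_idn ?oppr0 // clen_cmapi; lia.
by rewrite mu_idn //; lia.
Qed.

End Units.
End Operations.

(** * Comparison with the signed relations on homogeneous chains *)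

Section HomogeneousChains.
Variables (R : comPzRingType) (O : Type) (N : gquiver R O).
Notation ch := (gchain N).

Definition shomog x y (i : int) (f : N x y) : Prop := homog (i + 1) f.

Lemma spans_homog : spans (fun x y (f : N x y) => exists i, homog i f).
Proof.
by move=> x y W f g lf lg E; apply: linear_homog_ext => // i m hm; apply: E; exists i.
Qed.

Lemma hchain_of_allc x y (p : ch x y) :
  allc (fun x y (f : N x y) => exists i, homog i f) p -> exists h : hchain N x y, cval h = p.
Proof.
elim: p => [z _|a b c f p IH [[i hf] /IH[h <-]]]; first by exists (cnil z).
by exists (ccons (HMor hf) h).
Qed.

Lemma hchain_of_wt x y (p : ch x y) k : wt shomog p k ->
  exists2 h : hchain N x y, cval h = p & k = cdeg h - (clen h)%:Z.
Proof.
elim: p k => [z k /= ->|a b c f p IH k [i hf /IH[h <- E]]]; first by exists (cnil z).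
by exists (ccons (HMor hf) h) => //=; lia.
Qed.

Lemma wt_hchain x y (h : hchain N x y) : wt shomog (cval h) (cdeg h - (clen h)%:Z).
Proof.
elim: h => //= a b c f p IH; exists (hdeg f - 1); first by rewrite /shomog subrK; exact: hvalP.
by move: IH; congr (wt _ _ _); lia.
Qed.

Lemma mult_ctau_hchain (V : lmodType R) x y (h : hchain N x y) (phi : ch x y -> V) :
  mult phi -> phi (ctau (cval h)) = sgn R (cdeg h - (clen h)%:Z) *: phi (cval h).
Proof.
elim: h phi => [z|a b c f h IH] phi mphi /=; first by rewrite sgn0 scale1r.
rewrite (IH (fun q => phi (ccons _ q))); last exact: mult_tail.
rewrite (tau_homogE (hvalP f)) (linPZ (mult_head _ mphi)) scalerA mulrC -sgnD.
by congr (sgn R _ *: _); lia.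
Qed.

Lemma splitsum_cval (V : lmodType R) x y (p : hchain N x y)
    (F : forall m, ch x m -> ch m y -> V) :
  splitsum (cval p) F = splitsum p (fun m u v => F m (cval u) (cval v)).
Proof. by elim: p F => //= a b c f p IH F; rewrite IH. Qed.

(** The sign in [op_rel] is the product of the signs that [tau] gives to the arrows in front of the
    inserted operation. *)
Lemma bar_hchain (kappa : forall x y, ch x y -> N x y) (V : lmodType R) x y
    (p : hchain N x y) (phi : ch x y -> V) : mult phi ->
  \sum_(s <- csplits p)
      \sum_(t <- csplits (cpost s) | (0 < clen (cpre t))%N)
        sgn R (cdeg (cpre s) - (clen (cpre s))%:Z) *:
          phi (ccat (cval (cpre s))
                (ccons (kappa _ _ (cval (cpre t))) (cval (cpost t))))
  = bar kappa (cval p) phi.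
Proof.
elim: p phi => [z|a b c f p IH] phi mphi.
  by rewrite /= big_seq1 /= big_cons big_nil.
rewrite /= big_cons big_cons /= big_map; congr (_ + _).
  rewrite splitsum_cval.
  rewrite -sum_csplits; apply: eq_bigr => t _ /=.
  by rewrite subr0 sgn0 scale1r.
rewrite big_map -IH; last exact: mult_tail.
apply: eq_bigr => s _; apply: eq_bigr => t _ /=.
rewrite (tau_homogE (hvalP f)) (linPZ (mult_head _ mphi)) scalerA -sgnD.
by congr (sgn R _ *: _); lia.
Qed.

End HomogeneousChains.

Section AInfBar.
Variables (R : comPzRingType) (O : Type).

Lemma op_mult (A : ainf R O) x y : mult (@op R O A x y).
Proof. by move=> z w a c; exact: op_linear. Qed.

Lemma op_bar (A : ainf R O) x y (p : gchain A x y) : bar (@op R O A) p (@op R O A x y) = 0.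
Proof.
apply: (@mult_ext R O A (A x y) _ (@spans_homog _ _ A) x y
  (fun p => bar (@op R O A) p (@op R O A x y)) (fun=> 0)).
- exact: (bar_mult (@op_mult A) (@op_mult A x y)).
- exact: mult_zero.
move=> q _ hq; have [h <-] := hchain_of_allc hq.
by rewrite -bar_hchain; [exact: op_rel|exact: op_mult].
Qed.

Lemma op_wt (A : ainf R O) x y (p : gchain A x y) k : wt (@shomog _ _ A) p k ->
  homog (k + 2) (op A p).
Proof.
by move=> wp; have [h <- ->] := hchain_of_wt wp; have := op_homog h; rewrite addrAC.
Qed.

(** The operation is odd for shifted degrees: twisting all inputs produces the sign (-1)^k, while
    the output has shifted degree k + 1 and is twisted by the opposite sign. *)
Lemma tau_anti (N : gquiver R O) (kappa : forall x y, gchain N x y -> N x y) :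
  (forall x y, mult (@kappa x y)) ->
  (forall x y (p : gchain N x y) k, wt (@shomog _ _ N) p k -> homog (k + 2) (kappa _ _ p)) ->
  forall x y (p : gchain N x y), kappa _ _ (ctau p) = - tau (kappa _ _ p).
Proof.
move=> mk hk x y p.
apply: (@mult_ext R O N (N x y) _ (@spans_homog _ _ N) x y
  (fun p => kappa _ _ (ctau p)) (fun p => - tau (kappa _ _ p))).
- exact: mult_tau.
- apply: (mult_map (g := fun f => - tau f)) => //.
  by apply: linear_opp; exact: tau_linear.
move=> q _ hq; have [h <-] := hchain_of_allc hq.
have wh := wt_hchain h.
rewrite (tau_homogE (hk _ _ _ _ wh)) -scaleNr -sgnS.
rewrite [sgn R _](_ : _ = sgn R (cdeg h - (clen h)%:Z)); last first.
  rewrite (_ : _ + 1 = (cdeg h - (clen h)%:Z) + 2); last by lia.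
  by rewrite sgnD [sgn R 2]sqrrN expr1n mulr1.
exact: mult_ctau_hchain.
Qed.

Section Build.
Variables (N : gquiver R O) (mu : forall x y, gchain N x y -> N x y).
Hypothesis mu_nil : forall x, mu (cnil x) = 0.
Hypothesis mmult : forall x y, mult (@mu x y).
Hypothesis mwt : forall x y (p : gchain N x y) k,
  wt (@shomog _ _ N) p k -> homog (k + 2) (mu p).
Hypothesis mrel : forall x y (p : gchain N x y), bar mu p (@mu x y) = 0.

Fact build_homog x y (p : hchain N x y) : homog (cdeg p + 2 - (clen p)%:Z) (mu (cval p)).
Proof. by have := mwt (wt_hchain p); rewrite addrAC. Qed.

Fact build_rel x y (p : hchain N x y) :
  \sum_(s <- csplits p)
      \sum_(t <- csplits (cpost s) | (0 < clen (cpre t))%N)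
        sgn R (cdeg (cpre s) - (clen (cpre s))%:Z) *:
          mu (ccat (cval (cpre s))
                (ccons (mu (cval (cpre t))) (cval (cpost t)))) = 0.
Proof. exact: (etrans (@bar_hchain _ _ N mu (N x y) x y p (@mu x y) (@mmult x y)) (mrel _)). Qed.

Definition ainf_of_bar : ainf R O :=
  @AInf R O N mu mu_nil (fun x y z w p q => @mmult x w y z p q) build_homog build_rel.

End Build.
End AInfBar.

(** * Free A_oo-categories on graded generators *)

Section BasisChains.
Variables (R : comPzRingType) (O : Type) (I : O -> O -> Type).
Variable deg : forall x y, I x y -> int.

Definition famod : gquiver R O := fun x y => fgmod R (@deg x y).
Notation N := famod.

Definition cdelta x y (p : chain I x y) : gchain N x y :=
  cmapi (fun a b (i : I a b) => delta R i : N a b) p.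

Lemma spans_delta : spans (fun x y (f : N x y) => exists i : I x y, f = delta R i).
Proof. by move=> x y W f g lf lg E; apply: linear_ext => // i; apply: E; exists i. Qed.

Lemma cdelta_of_allc x y (p : gchain N x y) :
  allc (fun x y (f : N x y) => exists i : I x y, f = delta R i) p ->
  exists q : chain I x y, p = cdelta q.
Proof.
elim: p => [z _|a b c f p IH [[i ->] /IH[q ->]]]; first by exists (cnil z).
by exists (ccons i q).
Qed.

Lemma mult_delta_ext (V : lmodType R) x y (phi psi : gchain N x y -> V) (p : gchain N x y) :
  mult phi -> mult psi ->
  (forall q, clen q = clen p -> phi (cdelta q) = psi (cdelta q)) -> phi p = psi p.
Proof.
move=> mphi mpsi E; apply: (@mult_ext R O N V _ spans_delta) => // q qp aq.
have [r rE] := cdelta_of_allc aq; rewrite rE; apply: E.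
by rewrite -qp rE clen_cmapi.
Qed.

Fixpoint mlext (V : lmodType R) x y (p : gchain N x y) : (chain I x y -> V) -> V :=
  match p in chain _ x y return (chain I x y -> V) -> V with
  | cnil x => fun phi => phi (cnil x)
  | ccons _ _ _ f p' => fun phi => lin (fun i => mlext p' (fun q => phi (ccons i q))) f
  end.

Lemma mlext_delta (V : lmodType R) x y (p : chain I x y) (phi : chain I x y -> V) :
  mlext (cdelta p) phi = phi p.
Proof. by elim: p phi => //= a b c i p IH phi; rewrite lin_delta IH. Qed.

Lemma mult_mlext (V : lmodType R) x y (phi : chain I x y -> V) :
  mult (fun p : gchain N x y => mlext p phi).
Proof.
move=> z w a c; elim: a phi => /= [u|u v t f a IH] phi; first exact: lin_linear.
move=> k f1 f2; rewrite /lin scaler_sumr -big_split; apply: eq_bigr => i _ /=.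
by rewrite IH scalerDr !scalerA mulrC.
Qed.

Section WeightedBasis.
Variables (Q : forall x y, int -> I x y -> Prop).

Definition onb x y (k : int) (f : N x y) : Prop := forall i, (f : freemod R _) i <> 0 -> Q k i.

Lemma onb_submod x y k : submod (@onb x y k).
Proof.
split=> [i //|a u v Pu Pv i].
have [vi _|/contrapT vi] := pselect ((v : freemod R _) i <> 0); first exact: Pv.
rewrite fcoefD fcoefZ vi addr0 => ui; apply: Pu => ui0.
by apply: ui; rewrite ui0 mulr0.
Qed.

Lemma onb0 x y k : onb k (0 : N x y).
Proof. by []. Qed.

Lemma onb_delta x y k (i : I x y) : Q k i -> onb k (delta R i : N x y).
Proof.
move=> Qi j; have [<- //|ij] := pselect (i = j).
by rewrite delta_neq.
Qed.

Lemma tau_delta x y (i : I x y) :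
  tau (delta R i : N x y) = sgn R (deg i - 1) *: (delta R i : N x y).
Proof. by apply: tau_homogE; exact: homog_delta. Qed.

Lemma onb_lin (V : lmodType R) (S : V -> Prop) x y (phi : I x y -> V) k (f : N x y) :
  submod S -> onb k f -> (forall i, Q k i -> S (phi i)) -> S (lin phi f).
Proof. by move=> sS Pf E; apply: submod_lin => // i /Pf; exact: E. Qed.

Lemma onb_tau x y k (f : N x y) : onb k f -> onb k (tau f).
Proof.
move=> Pf; rewrite -[f]lin_id (lin_comp _ (@tau_linear _ _)).
apply: (onb_lin (@onb_submod x y k) Pf) => i Qi /=.
by rewrite tau_delta; apply: (submodZ (@onb_submod x y k)); apply: onb_delta.
Qed.

Lemma mlext_wt (V : lmodType R) (S : int -> V -> Prop) x y (phi : chain I x y -> V) k c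
    (p : gchain N x y) :
  (forall k, submod (S k)) ->
  (forall q k, clen q = clen p -> wt Q q k -> S (k + c) (phi q)) ->
  wt onb p k -> S (k + c) (mlext p phi).
Proof.
move=> sS; elim: p phi k c => [z|a b w f p IH] phi k c E /=; first by move=> k0; apply: E.
case=> i Pf wp; apply: (onb_lin (sS _) Pf) => j Qj.
have -> : k + c = (k - i) + (i + c) by lia.
apply: IH => // q l qp wq.
have -> : l + (i + c) = (i + l) + c by lia.
by apply: E => /=; [rewrite qp|exists i => //; have -> : i + l - i = l by lia].
Qed.

End WeightedBasis.

Lemma shomog_onb x y k (f : N x y) : shomog k f <-> onb (fun x y k i => deg i = k + 1) k f.
Proof. exact: homog_free. Qed.

Lemma wt_shomog x y (p : gchain N x y) k :
  wt (@shomog _ _ N) p k -> wt (onb (fun x y k i => deg i = k + 1)) p k.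
Proof.
elim: p k => //= a b c f p IH k [i hf /IH wp].
by exists i => //; apply/shomog_onb.
Qed.

End BasisChains.

Section Trees.
Variables (O : Type) (G : O -> O -> Type).

(** Splitting off the first two children builds into the type that an inner vertex has at least two
    inputs. *)
Inductive tree : O -> O -> Type :=
| leaf x y (g : G x y) : tree x y
| node x y z w (s : tree x y) (t : tree y z) (p : chain tree z w) : tree x w.

Section TreeInd.
Variable P : forall x y, tree x y -> Prop.
Hypothesis Pleaf : forall x y (g : G x y), P (leaf g).
Hypothesis Pnode : forall x y z w (s : tree x y) (t : tree y z) (p : chain tree z w),
  P s -> P t -> allc P p -> P (node s t p).

Fixpoint tree_ind' x y (t : tree x y) : P t :=
  match t in tree x y return P t with
  | leaf x y g => Pleaf g
  | node _ _ z w s t p =>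
      Pnode (tree_ind' s) (tree_ind' t)
        ((fix aux z w (p : chain tree z w) : allc P p :=
           match p in chain _ z w return allc P p with
           | cnil _ => I
           | ccons _ _ _ u q => conj (tree_ind' u) (aux _ _ q)
           end) _ _ p)
  end.

End TreeInd.

(* A basis of the free A_oo-category on G when U is false, and of the free
   strictly unital one when U is true. *)
Inductive bas (U : bool) : O -> O -> Type :=
| bt x y (t : tree x y) : bas U x y
| bu x (hU : U) : bas U x x.

End Trees.

Arguments leaf {O G x y} g.
Arguments node {O G x y z w} s t p.
Arguments bt {O G} U {x y} t.
Arguments bu {O G U} x hU.

(** Here and in [cmapf] the function stays outside the fixpoint, so that recursive calls on trees
    can go through chains of children. *)
Definition csum (T : nmodType) (O : Type) (H : O -> O -> Type)
    (f : forall x y, H x y -> T) :=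
  fix csum x y (p : chain H x y) : T :=
    match p with
    | cnil _ => 0
    | ccons _ _ _ h p' => f _ _ h + csum _ _ p'
    end.

Section Grafting.
Variables (R : comPzRingType) (O : Type) (U : bool) (G : O -> O -> Type).
Variable gdeg : forall x y, G x y -> int.

Notation Tr := (tree G).
Notation Bs := (bas G U).

(* The degree in the bar construction: deg t - 1. *)
Fixpoint sdeg x y (t : Tr x y) : int :=
  match t with
  | leaf _ _ g => gdeg g - 1
  | node _ _ _ _ s t p => sdeg s + sdeg t + csum sdeg p + 1
  end.

Definition bdeg x y (b : Bs x y) : int :=
  match b with
  | bt _ _ t => sdeg t + 1
  | bu _ _ => 0
  end.

Definition tmod : gquiver R O := famod R bdeg.
Notation M := tmod.

Definition dl x y (t : Tr x y) : M x y := delta R (bt U t).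
Definition cdl x y (p : chain Tr x y) : gchain M x y := cmapi dl p.
Definition cbt x y (p : chain Tr x y) : chain Bs x y := cmapi (fun x y => @bt O G U x y) p.

Lemma cdelta_cbt x y (p : chain Tr x y) : cdelta R bdeg (cbt p) = cdl p.
Proof. by rewrite /cbt /cdl /cdelta; elim: p => //= a b c t p ->. Qed.

Definition tree_of x y (b : Bs x y) : option (Tr x y) :=
  match b with
  | bt _ _ t => Some t
  | bu _ _ => None
  end.

Fixpoint trees x y (p : chain Bs x y) : option (chain Tr x y) :=
  match p with
  | cnil x => Some (cnil x)
  | ccons _ _ _ b p' =>
      match tree_of b, trees p' with
      | Some t, Some q => Some (ccons t q)
      | _, _ => None
      end
  end.

Lemma trees_cbt x y (p : chain Tr x y) : trees (cbt p) = Some p.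
Proof. by rewrite /cbt; elim: p => //= a b c t p ->. Qed.

Lemma trees_unit x y z (p : chain Bs x y) hU (q : chain Bs y z) :
  trees (ccat p (ccons (bu y hU) q)) = None.
Proof. by elim: p q => //= a b c f p IH q; rewrite IH; case: tree_of. Qed.

Lemma basP x y (b : Bs x y) :
  (exists t, b = bt U t) \/ (exists (e : x = y) (hU : U), b = match e with erefl => bu x hU end).
Proof. by case: b => [a c t|a hU]; [left; exists t|right; exists erefl, hU]. Qed.

(** The two cases in which relations, maps and sections are checked on basis chains: with trees only
    the operations graft, and with a unit present the unit axioms decide. *)
Lemma chain_basP x y (p : chain Bs x y) :
  (exists q, p = cbt q) \/
  (exists z (hU : U) (a : chain Bs x z) (c : chain Bs z y), p = ccat a (ccons (bu z hU) c)).
Proof.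
elim: p => [z|a b c f p [[q ->]|[z [hU [u [v ->]]]]]]; first by left; exists (cnil z).
  case: f q => [s t g|s hU] q; first by left; exists (ccons g q).
  by right; exists s, hU, (cnil s), (cbt q).
by right; exists z, hU, (ccons f u), v.
Qed.

Definition graft x y (p : chain Tr x y) : M x y :=
  match p in chain _ x y return M x y with
  | cnil x => 0
  | ccons x _ _ s p' =>
      match p' in chain _ b y return Tr x b -> M x y with
      | cnil _ => fun _ => 0
      | ccons _ _ _ t q => fun s => dl (node s t q)
      end s
  end.

(** Besides grafting, m^2 absorbs units. As [sdeg] is the degree minus one, the sign is (-1)^(deg
    s), which is the one in the axiom f = (-1)^(deg f) m^2(1_y, f). *)
Definition graft2 x y z (b : Bs x y) (c : Bs y z) : M x z :=
  match b in bas _ _ x y return Bs y z -> M x z with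
  | bu _ _ => fun c => delta R c
  | bt _ _ s => fun c =>
      match c in bas _ _ y z return Tr _ y -> M _ z with
      | bu _ _ => fun s => - sgn R (sdeg s) *: dl s
      | bt _ _ t => fun s => dl (node s t (cnil _))
      end s
  end c.

(* The operations m^n, n >= 2, on basis elements. *)
Definition nub x y (p : chain Bs x y) : M x y :=
  match p in chain _ x y return M x y with
  | ccons x _ _ b p' =>
      match p' in chain _ s y return Bs x s -> M x y with
      | ccons _ s _ c q =>
          match q in chain _ s y return Bs _ s -> Bs x _ -> M x y with
          | cnil _ => fun c b => graft2 b c
          | ccons _ _ _ c' q' => fun c b =>
              if trees (ccons b (ccons c (ccons c' q'))) is Some r then graft r else 0
          end c
      | cnil _ => fun _ => 0
      end b
  | cnil _ => 0
  end.

Lemma nub_short x y (p : chain Bs x y) : (clen p <= 1)%N -> nub p = 0.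
Proof. by case: p => // a b c f p; case: p f. Qed.

Lemma nub_long x y (p : chain Bs x y) : (2 < clen p)%N ->
  nub p = if trees p is Some r then graft r else 0.
Proof.
case: p => // a b c f p; case: p f => // u v w g p f; case: p g f => //.
Qed.

Lemma nub_trees x y z w (s : Tr x y) (t : Tr y z) (p : chain Tr z w) :
  nub (cbt (ccons s (ccons t p))) = dl (node s t p).
Proof.
case: p t s => // a b c u p t s.
by rewrite nub_long // trees_cbt.
Qed.

Definition nu x y (p : gchain M x y) : M x y := mlext p (@nub x y).

Lemma nu_mult x y : mult (@nu x y). Proof. exact: mult_mlext. Qed.

Lemma nu_delta x y (p : chain Bs x y) : nu (cdelta R bdeg p) = nub p.
Proof. exact: mlext_delta. Qed.

Lemma nu_trees x y z w (s : Tr x y) (t : Tr y z) (p : chain Tr z w) :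
  nu (cdl (ccons s (ccons t p))) = dl (node s t p).
Proof. by rewrite -cdelta_cbt nu_delta nub_trees. Qed.

Lemma nu_short x y (p : gchain M x y) : (clen p <= 1)%N -> nu p = 0.
Proof.
move=> p1; apply: (@mult_delta_ext R O _ _ (M x y) x y (@nu x y) (fun=> 0)).
- exact: nu_mult.
- exact: mult_zero.
by move=> q qp; rewrite nu_delta nub_short // qp.
Qed.

Variable dg : forall x y, G x y -> M x y.

Section ChildrenDifferential.
Variable w : forall x y, Tr x y -> M x y.

(** [bard] on a chain of trees, with the differential given on trees only: a recursion on trees
    cannot pass through the linear extension [dif_t]. *)
Fixpoint bardt (V : lmodType R) x y (p : chain Tr x y) : (gchain M x y -> V) -> V :=
  match p in chain _ x y return (gchain M x y -> V) -> V with
  | cnil _ => fun _ => 0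
  | ccons _ _ _ t p' => fun phi =>
      phi (ccons (w t) (cdl p')) + bardt p' (fun q => phi (ccons (tau (dl t)) q))
  end.

End ChildrenDifferential.

(* The differential of a corolla is dictated by the A_oo-relation whose other
   terms involve only smaller trees. *)
Fixpoint dtree x y (t : Tr x y) : M x y :=
  match t in tree _ x y return M x y with
  | leaf _ _ g => dg g
  | node _ _ _ _ s t p =>
      - (nu (ccons (dtree s) (ccons (dl t) (cdl p)))
         + (nu (ccons (tau (dl s)) (ccons (dtree t) (cdl p)))
            + bardt dtree p (fun q => nu (ccons (tau (dl s)) (ccons (tau (dl t)) q)))))
      - bar nu (cdl (ccons s (ccons t p))) (@nu _ _)
  end.

Definition dbas x y (b : Bs x y) : M x y :=
  match b with
  | bt _ _ t => dtree t
  | bu _ _ => 0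
  end.

Definition dif_t x y (f : M x y) : M x y := lin (@dbas x y) f.

Lemma dif_t_linear x y : linear (@dif_t x y). Proof. exact: lin_linear. Qed.

Lemma dif_dl x y (t : Tr x y) : dif_t (dl t) = dtree t.
Proof. exact: lin_delta. Qed.

Lemma dif_unit x hU : dif_t (delta R (bu x hU) : M x x) = 0.
Proof. exact: lin_delta. Qed.

Lemma bard_dl (V : lmodType R) x y (p : chain Tr x y) (phi : gchain M x y -> V) :
  bard dif_t (cdl p) phi = bardt dtree p phi.
Proof. by elim: p phi => //= a b c t p IH phi; rewrite dif_dl IH. Qed.

Lemma dif_node x y z w (s : Tr x y) (t : Tr y z) (p : chain Tr z w) :
  dif_t (dl (node s t p)) =
    - bard dif_t (cdl (ccons s (ccons t p))) (@nu x w)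
    - bar nu (cdl (ccons s (ccons t p))) (@nu x w).
Proof. by rewrite dif_dl /= !dif_dl bard_dl. Qed.

Section UnitOperations.
Hypothesis hU : U.

Definition eu x : M x x := delta R (bu x hU).

Lemma tau_eu x : tau (eu x) = - eu x.
Proof. by rewrite tau_delta /= sgnB1 sgn0 scaleN1r. Qed.

Lemma nu_idr x y (f : M x y) : nu (ccons (eu x) (csing f)) = f.
Proof.
move: f; apply: linear_ext => // [|b].
  exact: (@nu_mult x y _ _ (ccons (eu x) (cnil x)) (cnil y)).
exact: (nu_delta (ccons (bu x hU) (csing b))).
Qed.

Lemma nu_idl x y (f : M x y) : nu (ccons f (csing (eu y))) = - tau f.
Proof.
move: f; apply: linear_ext => [||b].
- exact: (@nu_mult x y _ _ (cnil x) (csing (eu y))).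
- exact: (linear_opp (@tau_linear R (M x y))).
rewrite (nu_delta (ccons b (csing (bu y hU)))) tau_delta /=.
case: b => [s t g|s hU'] /=; first by rewrite addrK scaleNr.
by rewrite sgnB1 sgn0 scaleN1r opprK (bool_irrelevance hU' hU).
Qed.

Lemma nu_idn x y z (p : gchain M x y) (q : gchain M y z) :
  (2 <= clen p + clen q)%N -> nu (ccat p (ccons (eu y) q)) = 0.
Proof.
move=> pq.
apply: (@mult_delta_ext R O _ _ (M x z) _ _ (fun p => nu (ccat p (ccons (eu y) q))) (fun=> 0)).
- by apply: mult_ccatr; exact: nu_mult.
- exact: mult_zero.
move=> p' p'p.
apply: (@mult_delta_ext R O _ _ (M x z) _ _ (fun q => nu (ccat (cdelta R bdeg p') (ccons (eu y) q))) (fun=> 0)).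
- apply: (@mult_tail _ _ M _ _ _ _ (fun q => nu (ccat (cdelta R bdeg p') q))).
  by apply: mult_ccatl; exact: nu_mult.
- exact: mult_zero.
move=> q' q'q.
have -> : ccat (cdelta R bdeg p') (ccons (eu y) (cdelta R bdeg q')) = cdelta R bdeg (ccat p' (ccons (bu y hU) q')).
  by rewrite /cdelta cmapi_ccat.
by rewrite nu_delta nub_long ?trees_unit // clen_ccat /= p'p q'q addnS ltnS.
Qed.

End UnitOperations.
End Grafting.

Record gsys (R : comPzRingType) (U : bool) (O : Type) := GSys {
  gen : O -> O -> Type;
  gdeg : forall x y, gen x y -> int;
  gdif : forall x y, gen x y -> tmod R U gdeg x y }.

(** * The category of trees *)

Section TreeCategory.
Variables (R : comPzRingType) (U : bool) (O : Type) (S : gsys R U O).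

Notation Tr := (tree (gen S)).
Notation Bs := (bas (gen S) U).
Definition tq : gquiver R O := tmod R U (@gdeg _ _ _ S).
Notation M := tq.

Definition dl' x y (t : Tr x y) : M x y := dl R U (@gdeg _ _ _ S) t.
Definition td x y (f : M x y) : M x y := dif_t (@gdif _ _ _ S) f.
Definition tnu x y (p : gchain M x y) : M x y := @nu R O U (gen S) (@gdeg _ _ _ S) x y p.
Definition tmu x y (p : gchain M x y) : M x y := mu td tnu p.
Notation dS := (dl').
Definition cS x y (p : chain Tr x y) : gchain M x y := cmapi dl' p.

Lemma td_linear x y : linear (@td x y). Proof. exact: dif_t_linear. Qed.
Lemma tnu_mult x y : mult (@tnu x y). Proof. exact: nu_mult. Qed.
Lemma tnu_short x y (p : gchain M x y) : (clen p <= 1)%N -> tnu p = 0.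
Proof. exact: nu_short. Qed.
Lemma tmu_mult x y : mult (@tmu x y).
Proof. exact: (mu_mult td_linear tnu_mult). Qed.

Lemma td_leaf x y (g : gen S x y) : td (dS (leaf g)) = gdif g.
Proof. exact: lin_delta. Qed.

Lemma tnu_node x y z w (s : Tr x y) (t : Tr y z) (p : chain Tr z w) :
  tnu (cS (ccons s (ccons t p))) = dS (node s t p).
Proof. exact: nu_trees. Qed.

Lemma td_node x y z w (s : Tr x y) (t : Tr y z) (p : chain Tr z w) :
  td (dS (node s t p)) =
    - bard td (cS (ccons s (ccons t p))) (@tnu x w)
    - bar tnu (cS (ccons s (ccons t p))) (@tnu x w).
Proof. exact: dif_node. Qed.

(** * Bounds on the operations: degrees ([c] = 1) and weights ([c] = -1) *)

Section Weighted.
Variables (Q : forall x y, int -> Bs x y -> Prop) (c : int).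
Arguments Q {x y}.
Hypothesis Qnode : forall x y z w (s : Tr x y) (t : Tr y z) (p : chain Tr z w) k,
  wt (@Q) (cbt U (ccons s (ccons t p))) k <-> Q (k + c) (bt U (node s t p)).
Hypothesis Qunit : forall x y (hU : U) (b : Bs x y) z i j,
  Q i (bu z hU) -> Q j b -> Q (i + j + c) b.
Notation P := (@onb R O _ (@bdeg O U _ (@gdeg _ _ _ S)) (@Q) _ _).

Lemma trees_some x y (p : chain Bs x y) q : trees p = Some q -> p = cbt U q.
Proof.
elim: p q => [z q [<-] //|a b e f p IH q].
case: f p q IH => [s t g|s hU] p q IH //=; case E: (trees p) => [r|] // [<-] /=.
by rewrite (IH _ E).
Qed.

Lemma nub_wt x y (p : chain Bs x y) k : (1 < clen p)%N -> wt (@Q) p k ->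
  P (k + c) (nub R (@gdeg _ _ _ S) p).
Proof.
have [p2 _|p2 p1] := ltnP 2 (clen p).
  rewrite nub_long //; case E: trees => [q|] wp; last exact: onb0.
  rewrite (trees_some E) in p2 wp; rewrite clen_cmapi in p2.
  case: q p2 wp {E} => // a b e s q; case: q s => // u v w t q s _ wp.
  by apply: onb_delta; apply/Qnode.
case: p p1 p2 => // a b e f p; case: p f => // u v w g p f; case: p g f => // z g f _ _ /=.
case=> i Qi [j Qj E]; have {E} -> : k = i + j by lia.
case: f g Qi Qj => [m n s|m hU] g Qi Qj; last by apply: onb_delta; exact: Qunit Qi Qj.
case: g s Qi Qj => [n' q t|n' hU] s Qi Qj /=.
  apply: onb_delta; apply/Qnode => /=; exists i => //; exists j => //.
  by lia.
apply: (submodZ (onb_submod _ _ _ _ _ _)); apply: onb_delta.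
by rewrite [i + j]addrC; exact: Qunit Qj Qi.
Qed.

Lemma tnu_wt x y (p : gchain M x y) k : wt (@onb R O _ (@bdeg O U _ (@gdeg _ _ _ S)) (@Q)) p k ->
  P (k + c) (tnu p).
Proof.
move=> wp; have [p1|p1] := leqP (clen p) 1.
  by rewrite tnu_short //; exact: onb0.
apply: (mlext_wt (S := fun k (f : M x y) => P k f)) wp => [l|q l qp wq].
  exact: onb_submod.
by apply: nub_wt => //; rewrite qp.
Qed.

Hypothesis Qgen : forall x y (g : gen S x y) k, Q k (bt U (leaf g)) -> P (k + c) (gdif g).

(** Over the zero ring [delta R b] is 0 and its support says nothing about [b], but then [v] is 0 as
    well. *)
Lemma onb_deltaE (V : lmodType R) (T : V -> Prop) x y (b : Bs x y) k (v : V) : submod T ->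
  P k (delta R b : M x y) -> (Q k b -> T v) -> T v.
Proof.
move=> sT Pb; have [R0 _|R1] := pselect (1 = 0 :> R).
  by rewrite -[v]scale1r R0 scale0r; exact: sT.1.
by apply; apply: Pb; rewrite delta_eq.
Qed.

Lemma td_tree_wt x y (t : Tr x y) k : Q k (bt U t) -> P (k + c) (td (dS t)).
Proof.
elim/tree_ind': t k => [a b g|a b e w s t p IHs IHt IHp] k Qk.
  by rewrite td_leaf; exact: Qgen.
have wc a' b' (p' : chain Tr a' b') l : wt (@Q) (cbt U p') l ->
    wt (@onb R O _ (@bdeg O U _ (@gdeg _ _ _ S)) (@Q)) (cS p') l.
  by elim: p' l => //= u v r h p' IH l [i Qi wp]; exists i; [exact: onb_delta|exact: IH].
have sP l a' b' : submod (@onb R O _ (@bdeg O U _ (@gdeg _ _ _ S)) (@Q) a' b' l).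
  exact: onb_submod.
have {Qk} wk : wt (@Q) (cbt U (ccons s (ccons t p))) (k - c).
  by apply/Qnode; rewrite subrK.
have := wc _ _ _ _ wk; have -> : k + c = k - c + c + c by rewrite subrK.
move: (k - c) => l wl; rewrite td_node.
have Pt u v m (f : M u v) : P m f -> P m (tau f) by exact: onb_tau.
apply: (submodD (sP _ _ _)); apply: (submodN (sP _ _ _)).
  apply: (bard_wt Pt (S := fun k (f : M a w) => P k f) _ _ wl) => //.
    by move=> q m _; exact: tnu_wt.
  have aux u v (h : Tr u v) : (forall k, Q k (bt U h) -> P (k + c) (td (dS h))) ->
      forall k, P k (dS h) -> P (k + c) (td (dS h)).
    by move=> H m /onb_deltaE; apply; [exact: sP|exact: H].
  split; [exact: aux|split; first exact: aux].
  by apply/allc_cmapi; apply: allc_impl IHp => u v h; exact: aux.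
apply: (bar_wt Pt (S := fun k (f : M a w) => P k f) _ _ _ wl) => //.
  by move=> u v q m _; exact: tnu_wt.
by move=> q m _; exact: tnu_wt.
Qed.

Lemma td_wt x y (f : M x y) k : P k f -> P (k + c) (td f).
Proof.
move=> Pf; apply: (onb_lin (onb_submod _ _ _ _ _ _) Pf) => b.
case: b {f Pf} => [a b t|a hU] Qb; last exact: onb0.
by rewrite -[dbas _ _]/(dtree _ t) -dif_dl; exact: td_tree_wt.
Qed.

End Weighted.

Definition bdeg_at x y (k : int) (b : Bs x y) : Prop := bdeg (@gdeg _ _ _ S) b = k + 1.

Lemma wt_sdeg x y (p : chain Tr x y) k :
  wt bdeg_at (cbt U p) k <-> csum (sdeg (@gdeg _ _ _ S)) p = k.
Proof.
elim: p k => /= [z k|a b c t p IH k]; first by split.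
rewrite /bdeg_at /=; split=> [[i ti /IH E]|E]; first by lia.
by exists (sdeg (@gdeg _ _ _ S) t) => //; apply/IH; lia.
Qed.

Lemma bdeg_at_node x y z w (s : Tr x y) (t : Tr y z) (p : chain Tr z w) k :
  wt bdeg_at (cbt U (ccons s (ccons t p))) k <-> bdeg_at (k + 1) (bt U (node s t p)).
Proof. by rewrite wt_sdeg /bdeg_at /=; split=> E; lia. Qed.

Lemma bdeg_at_unit x y (hU : U) (b : Bs x y) z i j :
  bdeg_at i (bu z hU) -> bdeg_at j b -> bdeg_at (i + j + 1) b.
Proof. by rewrite /bdeg_at /= => E ->; lia. Qed.

Lemma shomog_bdeg x y k (f : M x y) : shomog k f <-> onb bdeg_at k f.
Proof. exact: shomog_onb. Qed.

Lemma wt_shomog_bdeg x y (p : gchain M x y) k : wt (@shomog _ _ M) p k -> wt (onb bdeg_at) p k.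
Proof. exact: wt_shomog. Qed.

Lemma tnu_homog x y (p : gchain M x y) k : wt (@shomog _ _ M) p k -> shomog (k + 1) (tnu p).
Proof.
move/wt_shomog_bdeg => wp; apply/shomog_bdeg.
exact: (tnu_wt bdeg_at_node bdeg_at_unit wp).
Qed.

Definition gdif_homog : Prop := forall x y (g : gen S x y), homog (gdeg g + 1) (gdif g).

Definition gdif_cycle : Prop := forall x y (g : gen S x y), td (gdif g) = 0.

Section Graded.
Hypothesis hg : gdif_homog.

Lemma td_homog x y k (f : M x y) : homog k f -> homog (k + 1) (td f).
Proof.
rewrite -{1}[k](subrK 1) => /shomog_bdeg Pf.
rewrite -[k in k + 1](subrK 1); apply/shomog_bdeg.
apply: (td_wt bdeg_at_node bdeg_at_unit) Pf => u v g m.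
rewrite /bdeg_at /= subrK => E; apply/shomog_bdeg.
by rewrite /shomog -E; exact: hg.
Qed.

Lemma pi1_shomog x y (p : gchain M x y) k : wt (@shomog _ _ M) p k -> shomog k (pi1 p).
Proof.
case: p k => [a k _|a b c f p]; first exact: (homog_submod _ _).1.
case: p f => [u f k [i hf /= E]|u v w g p f k _].
  by have <- : i = k by lia.
by rewrite pi1_long //; exact: (homog_submod _ _).1.
Qed.

Lemma tmu_homog x y (p : gchain M x y) k : wt (@shomog _ _ M) p k -> homog (k + 2) (tmu p).
Proof.
move=> wp; apply: (submodD (homog_submod _ _)).
  by have := tnu_homog wp; rewrite /shomog -addrA.
by have := td_homog (pi1_shomog wp); rewrite -addrA.
Qed.

Lemma tmu_tau x y (p : gchain M x y) : tmu (ctau p) = - tau (tmu p).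
Proof. by apply: tau_anti => [u v|u v q k]; [exact: tmu_mult|exact: tmu_homog]. Qed.

Section Units.
Hypothesis hU : U.

Definition te x : M x x := delta R (bu x hU).

Lemma tmu_te x : tmu (csing (te x)) = 0.
Proof. by rewrite /tmu (mu_sing td tnu_short) /td dif_unit. Qed.

Lemma tmu_idr x y (f : M x y) : tmu (ccons (te x) (csing f)) = f.
Proof. by rewrite /tmu (mu_long td_linear) //; exact: nu_idr. Qed.

Lemma tmu_idl x y (f : M x y) : tmu (ccons f (csing (te y))) = - tau f.
Proof. by rewrite /tmu (mu_long td_linear) //; exact: nu_idl. Qed.

Lemma tmu_idn x y z (p : gchain M x y) (q : gchain M y z) :
  (2 <= clen p + clen q)%N -> tmu (ccat p (ccons (te y) q)) = 0.
Proof.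
move=> pq; rewrite /tmu (mu_long td_linear); first exact: nu_idn.
by rewrite clen_ccat /= addnS ltnS ltnW.
Qed.

End Units.

(** On a chain of trees this is the definition of the differential of the grafted tree. On a chain
    containing a unit, where nothing was prescribed, it is [bar_unit]. *)
Lemma tree_rel x y (p : gchain M x y) : (1 < clen p)%N ->
  td (tnu p) + bard td p (@tnu x y) + bar tnu p (@tnu x y) = 0.
Proof.
move=> p1; have := bar_mu_mu td_linear tnu_mult (ltnW p1).
rewrite pi1_long // !(linP0 (@td_linear _ _)) addr0 => <-.
apply: (@mult_delta_ext R O _ _ (M x y) x y (fun p => bar tmu p (@tmu x y)) (fun=> 0)).
- exact: (bar_mult tmu_mult (@tmu_mult x y)).
- exact: mult_zero.
move=> q qp; have q1 : (1 < clen q)%N by rewrite qp.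
have [[r rE]|[z [hU [a [c qE]]]]] := chain_basP q.
  have cq : cdelta R (@bdeg O U _ (@gdeg _ _ _ S)) q = cS r by rewrite rE cdelta_cbt.
  rewrite cq; have r1 : (1 < clen r)%N by rewrite -(clen_cmapi dl') -/(cS r) -cq clen_cmapi.
  case: r r1 {q qp q1 rE cq} => // u v w s r; case: r s => // u' v' w' t r s _.
  rewrite (bar_mu_mu td_linear tnu_mult) //.
  rewrite tnu_node td_node [td (td _)](_ : _ = 0); last first.
    by rewrite pi1_long // !(linP0 (@td_linear _ _)).
  by rewrite addr0 addrAC subrK addNr.
rewrite qE /cdelta cmapi_ccat /=.
apply: (@bar_unit R O M tmu (te hU)).
- exact: tmu_mult.
- exact: tmu_tau.
- by move=> u; exact: tau_eu.
- exact: tmu_te.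
- exact: tmu_idr.
- exact: tmu_idl.
- exact: tmu_idn.
by move: q1; rewrite qE clen_ccat /= !clen_cmapi addnS ltnS.
Qed.

Hypothesis hc : gdif_cycle.

(** [d_d_nu] carries d^2 = 0 from the children to a node, and the cycle condition provides it at the
    leaves. *)
Lemma td_td x y (f : M x y) : td (td f) = 0.
Proof.
move: f; apply: linear_ext => [||b].
- exact: (linear_comp (@td_linear x y) (@td_linear x y)).
- exact: linear_zero.
case: b => {x y} [x y t|x hU]; last first.
  by rewrite -[td (delta _ _)]/(dif_t _ _) dif_unit (linP0 (@td_linear _ _)).
rewrite -[delta R _]/(dS t); elim/tree_ind': t => {x y} [x y g|x y z w s t p IHs IHt IHp].
  by rewrite td_leaf hc.
rewrite -tnu_node; apply: (d_d_nu td_linear tnu_short tnu_mult tmu_tau tree_rel) => //.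
split=> //; split=> //.
by apply/allc_cmapi.
Qed.

Lemma tmu_rel x y (p : gchain M x y) : bar tmu p (@tmu x y) = 0.
Proof.
case: (posnP (clen p)) => [|p0]; first by case: p.
rewrite (bar_mu_mu td_linear tnu_mult) // td_td addr0.
case: (ltnP 1 (clen p)) => [|p1]; first exact: tree_rel.
case: p p0 p1 => // a b c f p; case: p f => // u f _ _.
by rewrite /= !tnu_short // (linP0 (@td_linear _ _)) !addr0.
Qed.

Lemma tmu_nil x : tmu (cnil x) = 0.
Proof. exact: (mu_nil td_linear tnu_short). Qed.

Definition tainf : ainf R O := ainf_of_bar tmu_nil tmu_mult tmu_homog tmu_rel.

Section Unital.
Hypothesis hU : U.

Fact te_homog x : homog 0 (te hU x).
Proof. exact: (@homog_delta R _ (@bdeg O U _ (@gdeg _ _ _ S) x x) (bu x hU)). Qed.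

Fact tainf_idl x y i (f : tainf x y) : homog i f ->
  f = sgn R i *: op tainf (ccons f (csing (te hU y))).
Proof.
move=> hf; rewrite -[op _ _]/(tmu _) tmu_idl (tau_homogE hf) sgnB1.
by rewrite -scaleNr opprK scalerA sgn_sq scale1r.
Qed.

Definition tuainf : uainf R O :=
  @UAInf R O tainf (te hU) te_homog (tmu_te hU) (tmu_idr hU) tainf_idl (tmu_idn hU).

End Unital.
End Graded.
End TreeCategory.

(** * Maps out of free A_oo-categories *)

(* Operations d = m^1 and nu = (m^n), n >= 2, subject to all the A_oo-relations
   except d^2 = 0. *)
Record preainf (R : comPzRingType) (O : Type) := PreAInf {
  phom :> O -> O -> gmod R;
  pnu : forall x y, gchain phom x y -> phom x y;
  pd : forall x y, phom x y -> phom x y;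
  pd_linear : forall x y, linear (@pd x y);
  pnu_mult : forall x y, mult (@pnu x y);
  pnu_short : forall x y (p : gchain phom x y), (clen p <= 1)%N -> pnu p = 0;
  pnu_homog : forall x y (p : gchain phom x y) k,
    wt (@shomog _ _ phom) p k -> shomog (k + 1) (pnu p);
  pnu_rel : forall x y (p : gchain phom x y), (1 < clen p)%N ->
    pd (pnu p) + bard pd p (@pnu x y) + bar pnu p (@pnu x y) = 0 }.

Arguments pnu {R O} B {x y} p : rename.
Arguments pd {R O} B {x y} f : rename.

Definition punit (R : comPzRingType) (O : Type) (B : preainf R O) (x : O) (e : B x x) : Prop :=
  [/\ homog 0 e, pd B e = 0,
      forall y (f : B x y), pnu B (ccons e (csing f)) = f,
      forall y (f : B y x), pnu B (ccons f (csing e)) = - tau f &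
      forall y z (p : gchain B y x) (q : gchain B x z), (2 <= clen p + clen q)%N ->
        pnu B (ccat p (ccons e q)) = 0].

(** A target for maps before d^2 = 0 is known: that a new generator has a cycle as boundary is
    itself seen by mapping the previous stage into such a structure. *)
Definition pre_of_tree (R : comPzRingType) (U : bool) (O : Type) (S : gsys R U O)
    (hg : gdif_homog S) : preainf R O :=
  PreAInf (@td_linear _ _ _ S) (@tnu_mult _ _ _ S) (@tnu_short _ _ _ S)
    (@tnu_homog _ _ _ S) (tree_rel hg).

Lemma punit_tree (R : comPzRingType) (U : bool) (O : Type) (S : gsys R U O)
    (hg : gdif_homog S) (hU : U) x : punit (B := pre_of_tree hg) (te S hU x).
Proof.
split.
- exact: te_homog.
- exact: dif_unit.
- exact: nu_idr.
- move=> y f; exact: (nu_idl hU f).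
- move=> y z p q; exact: nu_idn.
Qed.

Section PreOfAInf.
Variables (R : comPzRingType) (O : Type) (A : ainf R O).

Definition opd x y (f : A x y) : A x y := op A (csing f).
Definition opnu x y (p : gchain A x y) : A x y := if (1 < clen p)%N then op A p else 0.

Lemma opd_linear x y : linear (@opd x y).
Proof. exact: m1_linear. Qed.

Lemma opnu_mult x y : mult (@opnu x y).
Proof.
move=> z w a c; rewrite /opnu => k f g; rewrite !clen_ccat /=.
by case: ifP => _; [exact: op_mult|rewrite scaler0 addr0].
Qed.

Lemma opnu_short x y (p : gchain A x y) : (clen p <= 1)%N -> opnu p = 0.
Proof. by rewrite leqNgt /opnu => /negbTE ->. Qed.

Lemma op_mu x y (p : gchain A x y) : op A p = mu opd opnu p.
Proof.
case: p => [a|a b c f p]; first by rewrite (mu_nil opd_linear opnu_short) op_nil.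
case: p f => [u f|u v w g p f]; first by rewrite (mu_sing opd opnu_short).
by rewrite (mu_long opd_linear).
Qed.

Lemma opnu_homog x y (p : gchain A x y) k :
  wt (@shomog _ _ A) p k -> shomog (k + 1) (opnu p).
Proof.
move=> wp; rewrite /opnu; case: ifP => _; last exact: (homog_submod _ _).1.
by rewrite /shomog -addrA; exact: op_wt.
Qed.

Lemma opnu_rel x y (p : gchain A x y) : (1 < clen p)%N ->
  opd (opnu p) + bard opd p (@opnu x y) + bar opnu p (@opnu x y) = 0.
Proof.
move=> p1; have := op_bar p.
have E : @op R O A = fun x y => @mu R O A opd opnu x y.
  apply: functional_extensionality_dep => a; apply: functional_extensionality_dep => b.
  by apply: functional_extensionality_dep => q; exact: op_mu.
rewrite E (bar_mu_mu opd_linear opnu_mult (ltnW p1)).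
by rewrite pi1_long // !(linP0 (@opd_linear _ _)) addr0.
Qed.

Definition pre_of_ainf : preainf R O :=
  PreAInf opd_linear opnu_mult opnu_short opnu_homog opnu_rel.

End PreOfAInf.

Lemma punit_uainf (R : comPzRingType) (O : Type) (A : uainf R O) x :
  punit (B := pre_of_ainf A) (idm A x).
Proof.
split.
- exact: idm_homog.
- exact: idm_closed.
- exact: op_idr.
- move=> y f; move: f; apply: linear_homog_ext.
  + exact: (@opnu_mult _ _ A _ _ _ _ (cnil y) (csing (idm A x))).
  + by apply: linear_opp; exact: tau_linear.
  move=> i f hf; rewrite (tau_homogE hf) sgnB1 scaleNr opprK.
  by rewrite {2}(op_idl hf) scalerA sgn_sq scale1r.
- move=> y z p q pq; rewrite -[pnu _ _]/(opnu _) /opnu clen_ccat /= addnS ltnS ltnW //.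
  exact: op_idn.
Qed.

(** * Compatibility of coderivations with maps of quivers *)

Section Naturality.
Variables (R : comPzRingType) (O O' : Type) (N : gquiver R O) (N' : gquiver R O').
Variables (F0 : O -> O') (F : forall x y, N x y -> N' (F0 x) (F0 y)).
Notation cF := (cmap (fun a b => N' a b) F0 F).

Lemma splitsum_cmap (V : lmodType R) x y (p : gchain N x y)
    (psi : forall m, gchain N' (F0 x) m -> gchain N' m (F0 y) -> V) :
  splitsum (cF p) psi = splitsum p (fun m a b => psi (F0 m) (cF a) (cF b)).
Proof. by elim: p psi => //= a b c f p IH psi; rewrite IH. Qed.

Hypothesis Fl : forall x y, linear (@F x y).

Lemma mult_cmap (V : lmodType R) x y (phi : gchain N' (F0 x) (F0 y) -> V) :
  mult phi -> mult (fun p : gchain N x y => phi (cF p)).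
Proof.
move=> mphi z w a c k f g; rewrite !cmap_ccat /= Fl; exact: mphi.
Qed.

Lemma pi1_cmap x y (p : gchain N x y) : pi1 (cF p) = F (pi1 p).
Proof.
case: p => [a|a b c f p]; first by rewrite (linP0 (@Fl _ _)).
by case: p f => // u v w g p f; rewrite !pi1_long //= (linP0 (@Fl _ _)).
Qed.

Hypothesis Ftau : forall x y (f : N x y), F (tau f) = tau (F f).

Lemma bar_cmap (kappa : forall x y, gchain N x y -> N x y)
    (kappa' : forall x y, gchain N' x y -> N' x y) (V : lmodType R) x y
    (p : gchain N x y) (phi : gchain N' (F0 x) (F0 y) -> V) :
  (forall x y (q : gchain N x y), F (kappa _ _ q) = kappa' _ _ (cF q)) ->
  bar kappa' (cF p) phi = bar kappa p (fun q => phi (cF q)).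
Proof.
move=> E; elim: p phi => //= a b c f p IH phi.
rewrite splitsum_cmap IH; congr (_ + _).
  by apply: eq_splitsum => m u v; rewrite E.
by apply: eq_bar => q _; rewrite Ftau.
Qed.

Lemma bard_cmap (d : forall x y, N x y -> N x y) (d' : forall x y, N' x y -> N' x y)
    (V : lmodType R) x y (p : gchain N x y) (phi : gchain N' (F0 x) (F0 y) -> V) :
  allc (fun x y f => F (d x y f) = d' _ _ (F f)) p ->
  bard d' (cF p) phi = bard d p (fun q => phi (cF q)).
Proof.
elim: p phi => //= a b c f p IH phi [E /IH Ep].
by rewrite E Ep; congr (_ + _); apply: eq_bard => q _; rewrite Ftau.
Qed.

End Naturality.

Section ChainMap.
Variables (O O' : Type) (H : O -> O -> Type) (H' : O' -> O' -> Type) (F0 : O -> O').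
Variable F1 : forall x y, H x y -> H' (F0 x) (F0 y).

Fixpoint cmapf x y (p : chain H x y) : chain H' (F0 x) (F0 y) :=
  match p with
  | cnil x => cnil (F0 x)
  | ccons _ _ _ f p' => ccons (F1 f) (cmapf p')
  end.

End ChainMap.

Section TreeExtension.
Variables (R : comPzRingType) (U : bool) (O : Type) (S : gsys R U O).
Variables (O' : Type) (B : preainf R O') (F0 : O -> O').
Variable u : forall x, U -> B (F0 x) (F0 x).
Hypothesis hu : forall x hU, punit (@u x hU).

Notation Tr := (tree (gen S)).
Notation M := (tq S).

Section Extension.
Variable phi : forall x y, gen S x y -> B (F0 x) (F0 y).

Fixpoint etree x y (t : Tr x y) : B (F0 x) (F0 y) :=
  match t in tree _ x y return B (F0 x) (F0 y) with
  | leaf _ _ g => phi g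
  | node _ _ _ _ s t p =>
      pnu B (ccons (etree s) (ccons (etree t) (cmapf (H' := fun a b => B a b) etree p)))
  end.

Definition ebas x y (b : bas (gen S) U x y) : B (F0 x) (F0 y) :=
  match b in bas _ _ x y return B (F0 x) (F0 y) with
  | bt _ _ t => etree t
  | bu x hU => u x hU
  end.

(** When [U] is false, [u] is a function on an empty type, so the strictly unital and the non unital
    universal properties come from one construction. *)
Definition ext x y (f : M x y) : B (F0 x) (F0 y) := lin (@ebas x y) f.
Notation cE := (cmap (fun a b => B a b) F0 ext).

Lemma ext_linear x y : linear (@ext x y). Proof. exact: lin_linear. Qed.

Lemma ext_tree x y (t : Tr x y) : ext (dl' t) = etree t.
Proof. exact: lin_delta. Qed.

Lemma ext_leaf x y (g : gen S x y) : ext (dl' (leaf g)) = phi g.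
Proof. exact: ext_tree. Qed.

Lemma ext_unit x hU : ext (te S hU x) = u x hU.
Proof. exact: lin_delta. Qed.

Lemma cE_cS x y (p : chain Tr x y) : cE (cS p) = cmapf (H' := fun a b => B a b) etree p.
Proof. by rewrite /cS; elim: p => //= a b c t p ->; rewrite ext_tree. Qed.

Hypothesis hphi : forall x y (g : gen S x y), homog (gdeg g) (phi g).

Lemma etree_homog x y (t : Tr x y) : shomog (sdeg (@gdeg _ _ _ S) t) (etree t).
Proof.
elim/tree_ind': t => {x y} [x y g|x y z w s t p IHs IHt IHp] /=.
  by rewrite /shomog subrK.
apply: pnu_homog; exists (sdeg (@gdeg _ _ _ S) s) => //.
exists (sdeg (@gdeg _ _ _ S) t) => //.
rewrite [_ - _](_ : _ = csum (sdeg (@gdeg _ _ _ S)) p); last by lia.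
elim: p IHp {s t IHs IHt} => //= a b c h p IH [hh /IH hp].
by exists (sdeg (@gdeg _ _ _ S) h) => //; rewrite addrAC subrr add0r.
Qed.

Lemma ext_gmap x y : is_gmap (@ext x y).
Proof.
split; first exact: ext_linear.
move=> i f /homog_free hf; apply: (submod_lin (homog_submod (B (F0 x) (F0 y)) i)) => b /hf <-.
case: b {f hf} => [a c t|a hU] /=; first exact: etree_homog.
by have [] := hu a hU.
Qed.

Lemma ext_tau x y (f : M x y) : ext (tau f) = tau (ext f).
Proof. exact: gmap_tau (ext_gmap x y) f. Qed.

Lemma ext_nu x y (p : gchain M x y) : ext (tnu p) = pnu B (cE p).
Proof.
apply: (@mult_delta_ext R O _ _ (B (F0 x) (F0 y)) x y (fun p => ext (tnu p)) (fun p => pnu B (cE p))).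
- exact: (mult_map (@ext_linear x y) (@tnu_mult _ _ _ S x y)).
- exact: (mult_cmap ext_linear (@pnu_mult _ _ B _ _)).
move=> q _; have [[r ->]|[z [hU [a [c ->]]]]] := chain_basP q.
  have -> : cdelta R (@bdeg O U _ (@gdeg _ _ _ S)) (cbt U r) = cS r by exact: cdelta_cbt.
  case: r => [v|v v' v'' s r].
    by rewrite tnu_short // pnu_short // (linP0 (@ext_linear _ _)).
  case: r s => [w s|w w' w'' t r s].
    by rewrite tnu_short // pnu_short // (linP0 (@ext_linear _ _)).
  by rewrite tnu_node ext_tree cE_cS.
have [_ _ uidr uidl uidn] := hu z hU.
rewrite /cdelta cmapi_ccat /= cmap_ccat /=.
rewrite -[delta R (bu z hU) : M z z]/(te S hU z) ext_unit.
move: (cmapi _ a) (cmapi _ c) => {q} {}a {}c.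
have [ac|ac] := leqP 2 (clen a + clen c).
  by rewrite uidn ?clen_cmap // [tnu _]nu_idn // (linP0 (@ext_linear _ _)).
case: a c uidr uidl uidn ac => [v|v v' v'' f a] c uidr uidl uidn ac.
  case: c uidr uidl uidn ac => [w|w w' w'' g c] uidr uidl uidn ac.
    by rewrite tnu_short // pnu_short // (linP0 (@ext_linear _ _)).
  case: c g ac => // w0 g _; rewrite [tnu _]nu_idr /=.
  by rewrite -[LHS](uidr _ (ext g)).
case: a f c uidr uidl uidn ac => // v0 f c uidr uidl uidn.
case: c f uidr uidl uidn => // w f uidr uidl uidn _; rewrite [tnu _]nu_idl /= (linPN (@ext_linear _ _)).
by rewrite ext_tau -uidl.
Qed.

Hypothesis hd : forall x y (g : gen S x y), ext (gdif g) = pd B (phi g).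

(** At a node both sides are solved from the same A_oo-relation, which holds on trees by the
    definition of [td] and in [B] by [pnu_rel]; the remaining terms agree by naturality and
    induction. *)
Lemma ext_d x y (f : M x y) : ext (td f) = pd B (ext f).
Proof.
move: f; apply: linear_ext => [||b].
- exact: (linear_comp (@td_linear _ _ _ S x y) (@ext_linear x y)).
- exact: (linear_comp (@ext_linear x y) (@pd_linear _ _ B _ _)).
case: b => {x y} [x y t|x hU]; last first.
  rewrite -[delta R _]/(te S hU x) ext_unit [td _]dif_unit (linP0 (@ext_linear _ _)).
  by have [] := hu x hU.
rewrite -[delta R _]/(dl' t); elim/tree_ind': t => {x y} [x y g|x y z w s t p IHs IHt IHp].
  by rewrite td_leaf ext_leaf hd.
rewrite td_node -tnu_node ext_nu.
have q1 : (1 < clen (cS (ccons s (ccons t p))))%N by [].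
have dq : allc (fun _ _ f => ext (td f) = pd B (ext f)) (cS (ccons s (ccons t p))).
  by do 2!split=> //; apply/allc_cmapi.
move: (cS _) q1 dq => c c1 dc.
rewrite (linPB (@ext_linear _ _)) (linPN (@ext_linear _ _)).
rewrite (bard_map _ _ _ (@ext_linear _ _)) (bar_map _ _ _ (@ext_linear _ _)).
have cE1 : (1 < clen (cE c))%N by rewrite clen_cmap.
have := pnu_rel cE1; rewrite -addrA => /eqP; rewrite addr_eq0 => /eqP ->.
rewrite opprD (bard_cmap ext_tau (d := @td _ _ _ S)) //.
rewrite (bar_cmap ext_tau (kappa := @tnu _ _ _ S)); last by move=> *; exact: ext_nu.
by congr (- _ - _); [apply: eq_bard|apply: eq_bar] => q _; rewrite ext_nu.
Qed.

Lemma ext_mu x y (p : gchain M x y) : ext (tmu p) = mu (@pd _ _ B) (@pnu _ _ B) (cE p).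
Proof.
by rewrite /tmu /mu (linPD (@ext_linear _ _)) ext_nu ext_d (pi1_cmap ext_linear).
Qed.

End Extension.

Lemma tree_map_ext (G G' : forall x y, M x y -> B (F0 x) (F0 y)) :
  (forall x y, linear (G x y)) -> (forall x y, linear (G' x y)) ->
  (forall x y (p : gchain M x y), (1 < clen p)%N ->
     G _ _ (tnu p) = pnu B (cmap (fun a b => B a b) F0 G p)) ->
  (forall x y (p : gchain M x y), (1 < clen p)%N ->
     G' _ _ (tnu p) = pnu B (cmap (fun a b => B a b) F0 G' p)) ->
  (forall x y (g : gen S x y), G _ _ (dl' (leaf g)) = G' _ _ (dl' (leaf g))) ->
  (forall x hU, G _ _ (te S hU x) = G' _ _ (te S hU x)) ->
  forall x y, G x y =1 G' x y.
Proof.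
move=> Gl Gl' Gn Gn' Eg Eu x y; apply: linear_ext => [||b]; [exact: Gl|exact: Gl'|].
case: b => {x y} [x y t|x hU]; last exact: Eu.
rewrite -[delta R _]/(dl' t); elim/tree_ind': t => {x y} [//|x y z w s t p IHs IHt IHp].
rewrite -tnu_node Gn // Gn' //; congr (pnu B _); apply: cmap_ext_in.
by do 2?split=> //; apply/allc_cmapi.
Qed.

End TreeExtension.

(** * Cofibrancy *)

Section DGModules.
Variable R : comPzRingType.

Lemma dif_gpr (M : dgmod R) i (m : M) : dif (gpr i m) = gpr (i + 1) (dif m).
Proof.
move: m; apply: linear_homog_ext.
- exact: (linear_comp (gpr_linear i) (@dif_linear _ M)).
- exact: (linear_comp (@dif_linear _ M) (gpr_linear (i + 1))).
move=> j m hm; rewrite -{1}hm gprK -(dif_homog hm) gprK.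
have -> : (i + 1 == j + 1) = (i == j) by lia.
case: eqP => _; last exact: (linP0 (@dif_linear _ M)).
by rewrite hm (dif_homog hm).
Qed.

(** A preimage [n0] of [y] has the wrong differential by a cycle in the kernel of [p], hence by a
    boundary d m'. Surjectivity of [p], on homology and on elements, allows m' to be replaced by an
    element of the kernel with the same differential. *)
Lemma lift_through_trivial_fibration (N P : dgmod R) (p : N -> P) k (y : P) (w : N) :
  is_dgmap p -> surj p -> quasi_iso p -> homog k y -> homog (k + 1) w ->
  dif w = 0 -> p w = dif y -> exists n, [/\ homog k n, p n = y & dif n = w].
Proof.
move=> [gp pd] sp [qi qs] hy hw dw pw.
have pl := gp.1; have dN := @dif_linear _ N; have dP := @dif_linear _ P.
have [n0 pn0] := sp y.
have dm : dif (w - dif n0) = 0 by rewrite (linPB dN) dw dif_dif subr0.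
have pm : p (w - dif n0) = 0 by rewrite (linPB pl) pd pn0 pw subrr.
have [m' m'E] : exists m', w - dif n0 = dif m'.
  by apply: qi => //; exists 0; rewrite pm (linP0 dP).
have [m2 [dm2 [n' n'E]]] : exists m, dif m = 0 /\ exists n', p m' - p m = dif n'.
  by apply: qs; rewrite -pd -m'E.
have [n'' pn''] := sp n'.
pose n1 := n0 + (m' - m2 - dif n'').
have pn1 : p n1 = y.
  rewrite (linPD pl) (linPB pl (m' - m2)) (linPB pl m') pd pn'' n'E subrr addr0.
  exact: pn0.
have dn1 : dif n1 = w.
  by rewrite (linPD dN) (linPB dN (m' - m2)) (linPB dN m') dm2 dif_dif !subr0 -m'E addrC subrK.
(* Taking a component restores homogeneity, which the choices above ignored. *)
exists (gpr k n1); split; first exact: homog_gpr.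
  by rewrite (gmap_gpr gp) pn1.
by rewrite dif_gpr dn1.
Qed.

(* Lifts are constructed by induction on the rank. *)
Section Ranked.
Variables (I : Type) (deg : I -> int).
Let M : gmod R := fgmod R deg.
Variable d : M -> M.
Hypothesis dl : linear d.
Hypothesis dh : forall i m, homog i m -> homog (i + 1) (d m).
Hypothesis dd : forall m, d (d m) = 0.
Variable r : I -> nat.
Hypothesis dr : forall i j, (d (delta R i) : freemod R I) j <> 0 -> (r j < r i)%N.

Lemma cofibrant_ranked : cofibrant (DGMod dl dh dd).
Proof.
move=> N P p g dp sp qp [[gl gh] gd].
pose good (h : I -> N) (i : I) (v : N) : Prop :=
  [/\ homog (deg i) v, p v = g (delta R i) & dif v = lin h (d (delta R i))].
pose pick (h : I -> N) (i : I) : N :=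
  if pselect (exists v, good h i v) is left e then sval (cid e) else 0.
(* [H n] is a correct lift on ranks below [n], where it is never changed again. Its other values are
   provisional, [pick] returning 0 if there is no lift. *)
pose fix H (n : nat) : I -> N :=
  if n is n'.+1 then fun i => if (r i < n')%N then H n' i else pick (H n') i else fun=> 0.
have lin_supp (h h' : I -> N) i : (forall j, (r j < r i)%N -> h j = h' j) ->
    lin h (d (delta R i)) = lin h' (d (delta R i)).
  move=> E; apply: (@linear_ext_on R I N (fun j => (r j < r i)%N) (lin h) (lin h')).
  - exact: lin_linear.
  - exact: lin_linear.
  - by move=> j ji; rewrite !lin_delta E.
  - by move=> j; exact: dr.
have pickP h i : (exists v, good h i v) -> good h i (pick h i).
  by rewrite /pick => e; case: pselect => // e'; case: cid.
have H_good n i : (r i < n)%N -> good (H n) i (H n i).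
  elim: n i => // n IH i; rewrite ltnS leq_eqVlt => /orP[/eqP rin|rin] /=; last first.
    rewrite rin; have [h1 h2 h3] := IH i rin; split=> //.
    by rewrite h3; apply: lin_supp => j /ltn_trans/(_ rin) ->.
  rewrite rin ltnn.
  suff [h1 h2 h3] : good (H n) i (pick (H n) i).
    by split=> //; rewrite h3; apply: lin_supp => j; rewrite rin => ->.
  apply: pickP; pose z := d (delta R i).
  have zr j : (z : freemod R I) j <> 0 -> (r j < n)%N by rewrite -rin; exact: dr.
  have hz : homog (deg i + 1) z by apply: dh; exact: homog_delta.
  have [] := @lift_through_trivial_fibration N P p (deg i) (g (delta R i)) (lin (H n) z) => //.
  - by apply: gh; exact: homog_delta.
  - apply: (submod_lin (homog_submod N _)) => j zj.
    have [h1 _ _] := IH _ (zr _ zj).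
    by move/homog_free: hz => /(_ j zj) <-.
  (* Below rank [n] the partial lift commutes with the differentials, so the image of [z] is a cycle
     because [z] is one. *)
  - rewrite (lin_comp _ (@dif_linear _ N)).
    rewrite (@linear_ext_on R I N (fun j => (r j < n)%N) (lin (@dif _ N \o H n)) (fun f => lin (H n) (d f))) //.
    + by rewrite dd (linP0 (lin_linear (H n))).
    + exact: lin_linear.
    + exact: (linear_comp dl (lin_linear (H n))).
    + by move=> j jn; rewrite lin_delta /=; have [_ _ ->] := IH _ jn.
  - rewrite (lin_comp _ dp.1.1) -gd /=.
    apply: (@linear_ext_on R I P (fun j => (r j < n)%N) (lin (p \o H n)) g) => //.
    + exact: lin_linear.
    + by move=> j jn; rewrite lin_delta /=; have [_ -> _] := IH _ jn.
  by move=> v [h1 h2 h3]; exists v; split.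
pose h i := H (r i).+1 i.
have H_stable n i : (r i < n)%N -> H n i = h i.
  elim: n => // n IH; rewrite ltnS leq_eqVlt => /orP[/eqP <- //|rin] /=.
  by rewrite rin IH.
have h_good i : good h i (h i).
  have [h1 h2 h3] := H_good (r i).+1 i (ltnSn _); split=> //.
  by rewrite [dif _]h3; apply: lin_supp => j ji; apply: H_stable; exact: ltnW.
exists (lin h); split; first split; first split.
- exact: lin_linear.
- move=> i m /homog_free hm; apply: (submod_lin (homog_submod N i)) => j /hm <-.
  by have [] := h_good j.
- apply: linear_ext => [||i].
  + exact: (linear_comp dl (lin_linear h)).
  + exact: (linear_comp (lin_linear h) (@dif_linear _ N)).
  by rewrite lin_delta; have [_ _ ->] := h_good i.
apply: linear_ext => // [|i].
  exact: (linear_comp (lin_linear h) dp.1.1).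
by rewrite lin_delta; have [_ ->] := h_good i.
Qed.

End Ranked.
End DGModules.

(** * Weights of trees *)

Section CofibrantTrees.
Variables (R : comPzRingType) (U : bool) (O : Type) (S : gsys R U O).
Hypotheses (hg : gdif_homog S) (hc : gdif_cycle S).
Variable W : forall x y, gen S x y -> nat.

Fixpoint tw x y (t : tree (gen S) x y) : int :=
  match t with
  | leaf _ _ g => (W g)%:Z
  | node _ _ _ _ s t p => tw s + tw t + csum tw p - 1
  end.

(** A unit weighs 1 so that m^2, which lowers the total by one, keeps the weight of the factor
    beside the unit. Generators of weight at least 2 then force every tree to weigh at least 2, and
    weights can serve as natural ranks. *)
Definition bw x y (b : bas (gen S) U x y) : int :=
  match b with
  | bt _ _ t => tw t
  | bu _ _ => 1
  end.

Hypothesis W_ge2 : forall x y (g : gen S x y), (2 <= W g)%N.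
Hypothesis W_dif : forall x y (g : gen S x y) b,
  (gdif g : freemod R _) b <> 0 -> bw b < (W g)%:Z.

Lemma tw_ge2 x y (t : tree (gen S) x y) : 2 <= tw t.
Proof.
elim/tree_ind': t => {x y} [x y g|x y z w s t p IHs IHt IHp] /=; first by have := W_ge2 g; lia.
have : 0 <= csum tw p.
  by elim: p IHp {s t IHs IHt} => //= a b c h p IH [hh /IH]; move: hh; lia.
by move: IHs IHt; lia.
Qed.

Lemma bw_ge1 x y (b : bas (gen S) U x y) : 1 <= bw b.
Proof. by case: b => // a c t; have := tw_ge2 t; rewrite /=; lia. Qed.

(** A bound rather than an equality, since the terms of a differential have various weights. *)
Definition bw_le x y (k : int) (b : bas (gen S) U x y) : Prop := bw b <= k.

Lemma wt_bw x y (p : chain (tree (gen S)) x y) k :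
  wt bw_le (cbt U p) k -> csum tw p <= k.
Proof.
elim: p k => /= [z k -> //|a b c t p IH k [i ti /IH]].
by rewrite /bw_le /= in ti; lia.
Qed.

Lemma wt_csum x y (p : chain (tree (gen S)) x y) : wt bw_le (cbt U p) (csum tw p).
Proof.
elim: p => //= a b c t p IH; exists (tw t); first by rewrite /bw_le.
by have -> : tw t + csum tw p - tw t = csum tw p by lia.
Qed.

Lemma bw_le_node x y z w (s : tree (gen S) x y) (t : tree (gen S) y z)
    (p : chain (tree (gen S)) z w) k :
  wt bw_le (cbt U (ccons s (ccons t p))) k <-> bw_le (k + -1) (bt U (node s t p)).
Proof.
split=> [/wt_bw /=|]; rewrite /bw_le /=; first by lia.
(* All the slack is given to the first child. *)
move=> E; exists (k - tw t - csum tw p); first by rewrite /bw_le /=; lia.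
exists (tw t) => //.
have -> : k - (k - tw t - csum tw p) - tw t = csum tw p by lia.
exact: wt_csum.
Qed.

Lemma bw_le_unit x y (hU : U) (b : bas (gen S) U x y) z i j :
  bw_le i (bu z hU) -> bw_le j b -> bw_le (i + j + -1) b.
Proof. by rewrite /bw_le /=; lia. Qed.

Lemma cofibrant_tainf x y : cofibrant (und (tainf hg hc) x y).
Proof.
apply: (@cofibrant_ranked R _ _ _ _ _ _ (fun b => absz (bw b))) => b b'.
rewrite -[op _ _]/(tmu (csing _)) /tmu (mu_sing (@td _ _ _ S) (@tnu_short _ _ _ S)).
move=> bb'; suff : bw_le (bw b + -1) b'.
  by rewrite /bw_le; have := bw_ge1 b; have := bw_ge1 b'; lia.
apply: (td_wt bw_le_node bw_le_unit _ (f := delta R b)) bb'; last first.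
  by apply: onb_delta; rewrite /bw_le.
move=> u v g k; rewrite /bw_le /= => Wk c /W_dif.
by rewrite /bw_le; lia.
Qed.

End CofibrantTrees.

(** * Relabelling of generators *)

Section TreeMaps.
Variables (U : bool) (O O' : Type) (G : O -> O -> Type) (G' : O' -> O' -> Type).
Variables (F0 : O -> O') (f : forall x y, G x y -> G' (F0 x) (F0 y)).

Fixpoint relabel x y (t : tree G x y) : tree G' (F0 x) (F0 y) :=
  match t in tree _ x y return tree G' (F0 x) (F0 y) with
  | leaf _ _ g => leaf (f g)
  | node _ _ _ _ s t p => node (relabel s) (relabel t) (cmapf relabel p)
  end.

Definition brelabel x y (b : bas G U x y) : bas G' U (F0 x) (F0 y) :=
  match b in bas _ _ x y return bas G' U (F0 x) (F0 y) with
  | bt _ _ t => bt U (relabel t)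
  | bu x hU => bu (F0 x) hU
  end.

Variables (R : comPzRingType) (gd : forall x y, G x y -> int) (gd' : forall x y, G' x y -> int).

Definition fmap x y (v : tmod R U gd x y) : tmod R U gd' (F0 x) (F0 y) :=
  lin (fun b => delta R (brelabel b)) v.

Lemma fmap_linear x y : linear (@fmap x y). Proof. exact: lin_linear. Qed.

Lemma fmap0 x y : fmap (0 : tmod R U gd x y) = 0.
Proof. exact: linP0 (@fmap_linear x y). Qed.

Lemma fmap_delta x y (b : bas G U x y) : fmap (delta R b) = delta R (brelabel b).
Proof. exact: lin_delta. Qed.

Hypothesis fdeg : forall x y (g : G x y), gd' (f g) = gd g.

Lemma sdeg_relabel x y (t : tree G x y) : sdeg gd' (relabel t) = sdeg gd t.
Proof.
elim/tree_ind': t => {x y} [x y g|x y z w s t p IHs IHt IHp] /=; first by rewrite fdeg.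
rewrite IHs IHt; congr (_ + _ + _ + _).
by elim: p IHp {s t IHs IHt} => //= a b c h p IH [-> /IH ->].
Qed.

Lemma fmap_homog x y i (v : tmod R U gd x y) : homog i v -> homog i (fmap v).
Proof.
move/homog_free => hv; apply: (submod_lin (homog_submod _ i)) => b /hv <-.
have <- : bdeg gd' (brelabel b) = bdeg gd b by case: b => //= a c t; rewrite sdeg_relabel.
exact: homog_delta.
Qed.

Lemma fmap_gmap x y : is_gmap (@fmap x y).
Proof. by split; [exact: fmap_linear|move=> i m; exact: fmap_homog]. Qed.

End TreeMaps.

Lemma relabel_id (O : Type) (G : O -> O -> Type) (f : forall x y, G x y -> G x y) x y (t : tree G x y) :
  (forall x y (g : G x y), f x y g = g) -> relabel (F0 := id) f t = t.
Proof.
move=> E; elim/tree_ind': t => {x y} [x y g|x y z w s t p IHs IHt IHp] /=; first by rewrite E.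
congr node => //; elim: p IHp {s t IHs IHt} => //= a b c h p IH [-> /IH ->].
by [].
Qed.

Lemma fmap_id (R : comPzRingType) (U : bool) (O : Type) (G : O -> O -> Type) gd
    (f : forall x y, G x y -> G x y) x y (v : tmod R U gd x y) :
  (forall x y (g : G x y), f x y g = g) -> fmap (F0 := id) f gd v = v.
Proof.
move=> E; rewrite -[RHS]lin_id /fmap; congr (lin _ v).
apply: functional_extensionality_dep => b; congr delta.
by case: b => //= a c t; rewrite relabel_id.
Qed.

Section Composition.
Variables (O O' O'' : Type) (G : O -> O -> Type) (G' : O' -> O' -> Type) (G'' : O'' -> O'' -> Type).
Variables (F0 : O -> O') (F0' : O' -> O'').
Variables (f : forall x y, G x y -> G' (F0 x) (F0 y)) (f' : forall x y, G' x y -> G'' (F0' x) (F0' y)).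

Lemma relabel_comp x y (t : tree G x y) :
  relabel f' (relabel f t) = relabel (F0 := fun x => F0' (F0 x)) (fun x y g => f' (f g)) t.
Proof.
elim/tree_ind': t => {x y} [//|x y z w s t p IHs IHt IHp] /=.
rewrite IHs IHt; congr node.
by elim: p IHp {s t IHs IHt} => //= a b c h p IH [-> /IH ->].
Qed.

Lemma fmap_comp (R : comPzRingType) (U : bool) gd gd' gd'' x y (v : tmod R U gd x y) :
  fmap f' gd'' (fmap f gd' v) = fmap (F0 := fun x => F0' (F0 x)) (fun x y g => f' (f g)) gd'' v.
Proof.
rewrite {2}/fmap (lin_comp _ (@fmap_linear U _ _ _ _ _ f' R gd' gd'' _ _)) /fmap; congr (lin _ v).
apply: functional_extensionality_dep => b; rewrite /= lin_delta; congr delta.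
by case: b => //= a c t; rewrite relabel_comp.
Qed.

End Composition.

Lemma ext_fmap (R : comPzRingType) (U : bool) (O O' O'' : Type) (S : gsys R U O) (S' : gsys R U O')
    (F0 : O -> O') (f : forall x y, gen S x y -> gen S' (F0 x) (F0 y))
    (B : preainf R O'') (F0' : O' -> O'') (u : forall x, U -> B (F0' x) (F0' x))
    (phi : forall x y, gen S' x y -> B (F0' x) (F0' y)) x y (v : tq S x y) :
  ext u phi (fmap f (@gdeg _ _ _ S') v)
  = ext (F0 := fun x => F0' (F0 x)) (fun x => u (F0 x)) (fun x y g => phi _ _ (f x y g)) v.
Proof.
rewrite /fmap (lin_comp _ (@ext_linear R U O' S' O'' B F0' u phi (F0 x) (F0 y))) /ext.
congr (lin _ v); apply: functional_extensionality_dep => b; rewrite /= lin_delta.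
case: b => //= {v}a c t; elim/tree_ind': t => {a c} [//|a b c d s t p IHs IHt IHp] /=.
rewrite IHs IHt; congr (pnu B (ccons _ (ccons _ _))).
by elim: p IHp {s t IHs IHt} => //= p q r h l IH [-> /IH ->].
Qed.

Section TreeFunctors.
Variables (R : comPzRingType) (U : bool) (O O' : Type) (S : gsys R U O) (S' : gsys R U O').
Hypothesis hg' : gdif_homog S'.
Variables (F0 : O -> O') (f : forall x y, gen S x y -> gen S' (F0 x) (F0 y)).
Hypothesis fdeg : forall x y (g : gen S x y), gdeg (f g) = gdeg g.

Notation fm := (fmap f (@gdeg _ _ _ S')).
Notation phi := (fun x y (g : gen S x y) => dl' (leaf (f g)) : pre_of_tree hg' (F0 x) (F0 y)).
Notation u := (fun x hU => te S' hU (F0 x) : pre_of_tree hg' (F0 x) (F0 x)).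

(** Relabelling is the map induced by its values on leaves, so its compatibility with differentials
    and operations comes from [ext_d] and [ext_mu]. *)
Lemma fmap_ext x y (v : tq S x y) : fm v = ext u phi v.
Proof.
rewrite /fmap /ext; congr (lin _ v); apply: functional_extensionality_dep => b.
case: b => //= {v}a c t; elim/tree_ind': t => {a c} [//|a b c d s t p IHs IHt IHp] /=.
rewrite -IHs -IHt -[LHS](tnu_node (relabel f s)); congr tnu.
rewrite /cS /=; do 2 congr ccons.
by elim: p IHp {s t IHs IHt} => //= p q r h l IH [<- /IH ->].
Qed.

Hypothesis fdif : forall x y (g : gen S x y), gdif (f g) = fm (gdif g).

Let phi_homog x y (g : gen S x y) : homog (gdeg g) (phi x y g).
Proof.
rewrite -fdeg -[gdeg _](subrK 1).
exact: (@homog_delta R _ (@bdeg O' U _ (@gdeg _ _ _ S') (F0 x) (F0 y)) (bt U (leaf (f g)))).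
Qed.

Let u_punit x hU : punit (u x hU).
Proof. exact: punit_tree. Qed.

Lemma fmap_d x y (v : tq S x y) : fm (td v) = td (fm v).
Proof.
rewrite !fmap_ext; apply: (ext_d u_punit phi_homog) => a b g.
by rewrite -fmap_ext -fdif; symmetry; exact: td_leaf.
Qed.

Lemma fmap_mu x y (p : gchain (tq S) x y) :
  fm (tmu p) = tmu (cmap (fun a b => tq S' a b) F0 (fun a b (v : tq S a b) => fm v) p).
Proof.
rewrite fmap_ext (ext_mu u_punit phi_homog); last first.
  by move=> a b g; rewrite -fmap_ext -fdif; symmetry; exact: td_leaf.
congr mu; apply: cmap_ext_in; apply: allc_true => a b v.
by rewrite fmap_ext.
Qed.

End TreeFunctors.

(** * The tower of stages *)

Section Stages.
Variables (R : comPzRingType) (O : Type) (A : uainf R O).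

Definition aug (S : gsys R true O) (phi : forall x y, gen S x y -> A x y) x y (v : tq S x y) :
    A x y :=
  ext (B := pre_of_ainf A) (F0 := fun x => x) (fun x _ => idm A x) phi v.

(** The augmentation is part of a stage because the generators attached next depend on it. *)
Record stage := Stage {
  ssys :> gsys R true O;
  shom : gdif_homog ssys;
  scyc : gdif_cycle ssys;
  sphi : forall x y, gen ssys x y -> A x y;
  sphi_homog : forall x y (g : gen ssys x y), homog (gdeg g) (sphi g);
  sphi_dif : forall x y (g : gen ssys x y), aug sphi (gdif g) = op A (csing (sphi g)) }.

Definition saug (S : stage) x y (v : tq S x y) : A x y := aug (@sphi S) v.

Section OneStage.
Variable S : stage.

Let u_punit x (hU : true) : punit (B := pre_of_ainf A) (idm A x).
Proof. exact: punit_uainf. Qed.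

Lemma saug_gmap x y : is_gmap (@saug S x y).
Proof. exact: (@ext_gmap _ _ _ _ _ (pre_of_ainf A) _ _ u_punit _ (@sphi_homog S)). Qed.

Lemma saug_op x y (p : gchain (tq S) x y) :
  saug (tmu p) = op A (cmap (fun a b => A a b) id (@saug S) p).
Proof.
rewrite op_mu.
exact: (@ext_mu _ _ _ _ _ (pre_of_ainf A) _ _ u_punit _ (@sphi_homog S) (@sphi_dif S)).
Qed.

Lemma saug_leaf x y (g : gen S x y) : saug (dl' (leaf g)) = sphi g.
Proof. exact: (ext_leaf (B := pre_of_ainf A)). Qed.

Lemma saug_unit x hU : saug (te S hU x) = idm A x.
Proof. exact: (ext_unit (B := pre_of_ainf A)). Qed.

(* A generator e attached to S, with d e = nz and image nb in A. *)
Record newgen x y := NewGen {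
  ndeg : int;
  nz : tq S x y;
  nb : A x y;
  nz_homog : homog (ndeg + 1) nz;
  nb_homog : homog ndeg nb;
  nz_cycle : td nz = 0;
  nz_nb : saug nz = op A (csing nb) }.

(** Reduces functoriality on generators to equalities between degrees and pairs (z, b). *)
Lemma newgenP x y (e e' : newgen x y) :
  ndeg e = ndeg e' -> nz e = nz e' -> nb e = nb e' -> e = e'.
Proof.
case: e e' => i z b h1 h2 h3 h4 [i' z' b' h1' h2' h3' h4'] /= E1 E2 E3; subst i' z' b'.
by congr NewGen; exact: Prop_irrelevance.
Qed.

Definition next_gen x y : Type := (gen S x y + newgen x y)%type.

Definition next_deg x y (g : next_gen x y) : int :=
  match g with inl g => gdeg g | inr e => ndeg e end.

Definition next_inl x y (g : gen S x y) : next_gen x y := inl g.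

Notation fi := (fmap (F0 := fun x => x) next_inl next_deg).

Definition next_sys : gsys R true O :=
  @GSys R true O next_gen next_deg
    (fun x y g => match g with inl g => fi (gdif g) | inr e => fi (nz e) end).

Lemma next_hom : gdif_homog next_sys.
Proof.
move=> x y [g|e] /=; apply: fmap_homog => //; [exact: shom|exact: nz_homog].
Qed.

Lemma fi_d x y (v : tq S x y) : fi (td v) = td (S := next_sys) (fi v).
Proof. exact: (fmap_d next_hom). Qed.

Lemma next_cyc : gdif_cycle next_sys.
Proof.
move=> x y [g|e] /=; rewrite -fi_d.
  by rewrite scyc fmap0.
by rewrite nz_cycle fmap0.
Qed.

Definition next_phi x y (g : gen next_sys x y) : A x y :=
  match g with inl g => sphi g | inr e => nb e end.

Lemma aug_fi x y (v : tq S x y) : aug next_phi (fi v) = saug v.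
Proof. by rewrite /aug ext_fmap. Qed.

Lemma next_phi_homog x y (g : gen next_sys x y) : homog (gdeg g) (next_phi g).
Proof. by case: g => [g|e]; [exact: sphi_homog|exact: nb_homog]. Qed.

Lemma next_phi_dif x y (g : gen next_sys x y) : aug next_phi (gdif g) = op A (csing (next_phi g)).
Proof. by case: g => [g|e] /=; rewrite aug_fi; [exact: sphi_dif|exact: nz_nb]. Qed.

Definition snext : stage := Stage next_hom next_cyc next_phi_homog next_phi_dif.

End OneStage.

Notation fnext S := (fmap (F0 := fun x => x) (@next_inl S) (@next_deg S)).

Definition stage0 : stage.
Proof.
by refine (@Stage (@GSys R true O (fun _ _ => Empty_set) (fun x y g => match g with end)
  (fun x y g => match g with end)) _ _ (fun x y g => match g with end) _ _) => x y [].
Defined.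

Fixpoint stg (n : nat) : stage := if n is n'.+1 then snext (stg n') else stage0.

(** Every generator of the union is new at exactly one stage. Recording that stage makes the union a
    tree category again, in place of a colimit. *)
Definition inf_gen x y : Type := {n : nat & newgen (stg n) x y}.

Definition inf_deg x y (g : inf_gen x y) : int := ndeg (projT2 g).

Fixpoint incl n : forall x y, gen (stg n) x y -> inf_gen x y :=
  match n return forall x y, gen (stg n) x y -> inf_gen x y with
  | 0%N => fun x y g => match g with end
  | n'.+1 => fun x y g =>
      match g with
      | inl g' => incl (n := n') g'
      | inr e => existT (fun n => newgen (stg n) x y) n' e
      end
  end.

Lemma incl_deg n x y (g : gen (stg n) x y) : inf_deg (incl g) = gdeg g.
Proof. by elim: n x y g => [x y []|n IH x y [g|e]] /=. Qed.

Notation fincl n := (fmap (F0 := fun x => x) (@incl n) inf_deg).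

Definition inf_sys : gsys R true O :=
  @GSys R true O inf_gen inf_deg (fun x y g => fincl _ (nz (projT2 g))).

Lemma inf_hom : gdif_homog inf_sys.
Proof.
by move=> x y [n e]; apply: fmap_homog; [exact: incl_deg|exact: nz_homog].
Qed.

Lemma incl_dif n x y (g : gen (stg n) x y) : gdif (g := inf_sys) (incl g) = fincl n (gdif g).
Proof.
elim: n x y g => [x y []|n IH x y [g|e]].
- rewrite -[RHS]/(fincl n.+1 (fnext (stg n) (gdif g))) fmap_comp; exact: IH.
- by rewrite -[RHS]/(fincl n.+1 (fnext (stg n) (nz e))) fmap_comp.
Qed.

Lemma fincl_d n x y (v : tq (stg n) x y) : fincl n (td v) = td (S := inf_sys) (fincl n v).
Proof. by apply: (fmap_d inf_hom) => *; [exact: incl_deg|exact: incl_dif]. Qed.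

Lemma inf_cyc : gdif_cycle inf_sys.
Proof.
by move=> x y [n e] /=; rewrite -fincl_d nz_cycle fmap0.
Qed.

Definition inf_phi x y (g : gen inf_sys x y) : A x y := nb (projT2 g).

Lemma inf_phi_incl n x y (g : gen (stg n) x y) : inf_phi (incl g) = sphi g.
Proof. by elim: n x y g => [x y []|n IH x y [g|e]] /=. Qed.

Lemma aug_fincl n x y (v : tq (stg n) x y) : aug inf_phi (fincl n v) = saug v.
Proof.
rewrite /aug ext_fmap /saug /aug; congr (ext (B := pre_of_ainf A) _ _ v).
apply: functional_extensionality_dep => a; apply: functional_extensionality_dep => b.
by apply: functional_extensionality_dep => g; exact: inf_phi_incl.
Qed.

Lemma inf_phi_homog x y (g : gen inf_sys x y) : homog (gdeg g) (inf_phi g).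
Proof. by case: g => n e; exact: nb_homog. Qed.

Lemma inf_phi_dif x y (g : gen inf_sys x y) : aug inf_phi (gdif g) = op A (csing (inf_phi g)).
Proof. by case: g => n e; rewrite [gdif _]/= aug_fincl; exact: nz_nb. Qed.

Definition sinf : stage := Stage inf_hom inf_cyc inf_phi_homog inf_phi_dif.

Definition scat (S : stage) : uainf R O := tuainf (@shom S) (@scyc S) isT.

End Stages.

(** * Functoriality *)

Section StageMaps.
Variables (R : comPzRingType) (A B : ainfCat R) (F : functor A B).

Lemma fmor_gmap x y : is_gmap (@fmor R A B F x y).
Proof. by have [[gF _] _] := functorP F; exact: gF. Qed.

Lemma fmor_op x y (p : gchain A x y) :
  fmor F (op A p) = op B (cmap (fun a b => B a b) (fob F) (@fmor R A B F) p).
Proof. by have [[_ oF] _] := functorP F; exact: oF. Qed.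

Lemma fmor_id x : fmor F (idm A x) = idm B (fob F x).
Proof. by have [_ uF] := functorP F; exact: uF. Qed.

Lemma fmor_aug (S : gsys R true (ob A)) (phi : forall x y, gen S x y -> A x y) x y (v : tq S x y) :
  fmor F (aug phi v) = ext (B := pre_of_ainf B) (F0 := fob F) (fun x _ => idm B (fob F x))
    (fun a b g => fmor F (phi a b g)) v.
Proof.
rewrite /aug /ext (lin_comp _ (fmor_gmap x y).1); congr (lin _ v).
apply: functional_extensionality_dep => b /=.
case: b => /= [a c t|a _]; last exact: fmor_id.
elim/tree_ind': t => {x y v a c} [//|x y z w s t p IHs IHt IHp] /=.
rewrite -IHs -IHt /opnu /= fmor_op /=; congr (op B (ccons _ (ccons _ _))).
by elim: p IHp {s t IHs IHt} => //= p q r h l IH [<- /IH ->].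
Qed.

Record smap (S : stage A) (S' : stage B) := SMap {
  mf : forall x y, gen S x y -> gen S' (fob F x) (fob F y);
  mf_deg : forall x y (g : gen S x y), gdeg (mf g) = gdeg g;
  mf_dif : forall x y (g : gen S x y), gdif (mf g) = fmap mf (@gdeg _ _ _ S') (gdif g);
  mf_phi : forall x y (g : gen S x y), sphi (mf g) = fmor F (sphi g) }.

Definition smap_mor (S : stage A) (S' : stage B) (m : smap S S') x y (v : tq S x y) :
  tq S' (fob F x) (fob F y) := fmap (@mf _ _ m) (@gdeg _ _ _ S') v.

Section NextMap.
Variables (S : stage A) (S' : stage B) (m : smap S S').

Lemma saug_smap x y (v : tq S x y) : saug (smap_mor m v) = fmor F (saug v).
Proof.
rewrite fmor_aug /saug /aug /smap_mor ext_fmap; congr (ext (B := pre_of_ainf B) _ _ v).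
apply: functional_extensionality_dep => a; apply: functional_extensionality_dep => b.
by apply: functional_extensionality_dep => g; exact: mf_phi.
Qed.

Lemma smap_mor_d x y (v : tq S x y) : smap_mor m (td v) = td (smap_mor m v).
Proof. exact: (fmap_d (@shom _ _ _ S') (@mf_deg _ _ m) (@mf_dif _ _ m)). Qed.

Lemma smap_mor_homog x y i (v : tq S x y) : homog i v -> homog i (smap_mor m v).
Proof. exact: (fmap_homog (@mf_deg _ _ m)). Qed.

Fact newmap_nb x y (e : newgen S x y) :
  saug (smap_mor m (nz e)) = op B (csing (fmor F (nb e))).
Proof. by rewrite saug_smap nz_nb fmor_op. Qed.

Fact newmap_cycle x y (e : newgen S x y) : td (smap_mor m (nz e)) = 0.
Proof. by rewrite -smap_mor_d nz_cycle; exact: fmap0. Qed.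

(** The stage map commutes with differentials and augmentations, so the image of an attaching pair
    under [m] and [F] is again an attaching pair. *)
Definition newmap x y (e : newgen S x y) : newgen S' (fob F x) (fob F y) :=
  NewGen (smap_mor_homog (nz_homog e)) ((fmor_gmap x y).2 _ _ (nb_homog e))
    (newmap_cycle e) (newmap_nb e).

Definition next_mf x y (g : gen (snext S) x y) : gen (snext S') (fob F x) (fob F y) :=
  match g with inl g => inl (mf m g) | inr e => inr (newmap e) end.

Lemma next_mf_deg x y (g : gen (snext S) x y) : gdeg (next_mf g) = gdeg g.
Proof. by case: g => [g|e] //=; exact: mf_deg. Qed.

Lemma next_mf_dif x y (g : gen (snext S) x y) :
  gdif (next_mf g) = fmap next_mf (@gdeg _ _ _ (snext S')) (gdif g).
Proof. by case: g => [g|e]; rewrite /= ?mf_dif !fmap_comp. Qed.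

Lemma next_mf_phi x y (g : gen (snext S) x y) : sphi (next_mf g) = fmor F (sphi g).
Proof. by case: g => [g|e] //=; exact: mf_phi. Qed.

Definition next_map : smap (snext S) (snext S') := SMap next_mf_deg next_mf_dif next_mf_phi.

End NextMap.

Definition smap0 : smap (stage0 A) (stage0 B).
Proof. by refine (@SMap (stage0 A) (stage0 B) (fun x y g => match g with end) _ _ _) => x y []. Defined.

Fixpoint smapn n : smap (stg A n) (stg B n) :=
  match n with
  | 0%N => smap0
  | n'.+1 => next_map (smapn n')
  end.

Definition inf_mf x y (g : gen (sinf A) x y) : gen (sinf B) (fob F x) (fob F y) :=
  existT (fun n => newgen (stg B n) (fob F x) (fob F y)) (projT1 g) (newmap (smapn _) (projT2 g)).

Lemma inf_mf_incl n x y (g : gen (stg A n) x y) : incl (mf (smapn n) g) = inf_mf (incl g).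
Proof. by elim: n x y g => [x y []|n IH x y [g|e]] //=; rewrite IH. Qed.

Lemma inf_mf_deg x y (g : gen (sinf A) x y) : gdeg (inf_mf g) = gdeg g.
Proof. by case: g. Qed.

Lemma inf_mf_dif x y (g : gen (sinf A) x y) :
  gdif (inf_mf g) = fmap inf_mf (@gdeg _ _ _ (sinf B)) (gdif g).
Proof.
case: g => n e; rewrite /= /smap_mor !fmap_comp; congr (fmap _ _ (nz e)).
apply: functional_extensionality_dep => a; apply: functional_extensionality_dep => b.
by apply: functional_extensionality_dep => g; exact: inf_mf_incl.
Qed.

Lemma inf_mf_phi x y (g : gen (sinf A) x y) : sphi (inf_mf g) = fmor F (sphi g).
Proof. by case: g. Qed.

Definition inf_map : smap (sinf A) (sinf B) := SMap inf_mf_deg inf_mf_dif inf_mf_phi.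

Lemma smap_functorP (S : stage A) (S' : stage B) (m : smap S S') :
  @is_ustrict R _ _ (fob F) (scat S) (scat S') (@smap_mor _ _ m).
Proof.
split; first split.
- by move=> x y; apply: fmap_gmap; exact: mf_deg.
- move=> x y p; exact: (fmap_mu (@shom _ _ _ S') (@mf_deg _ _ m) (@mf_dif _ _ m)).
- by move=> x; exact: fmap_delta.
Qed.

End StageMaps.

(** The two functors share their map on objects, so that comparing them on morphisms involves no
    transport. *)
Lemma functor_eq (R : comPzRingType) (A B : ainfCat R) (f : ob A -> ob B)
    (m m' : forall x y, A x y -> B (f x) (f y)) h h' :
  (forall x y (v : A x y), m x y v = m' x y v) -> Functor (fmor := m) h = Functor (fmor := m') h'.
Proof.
move=> E; have Em : m = m'.
  apply: functional_extensionality_dep => x; apply: functional_extensionality_dep => y.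
  by apply: functional_extensionality_dep => v; exact: E.
by subst m'; congr Functor; exact: Prop_irrelevance.
Qed.

Section Resolution.
Variable R : comPzRingType.

Definition sf (A : ainfCat R) : uainf R (ob A) := scat (sinf A).
Definition sfC (A : ainfCat R) : ainfCat R := AInfCat (sf A).

Definition sfF (A B : ainfCat R) (F : functor A B) : functor (sfC A) (sfC B) :=
  @Functor R (sfC A) (sfC B) (fob F) _ (smap_functorP (inf_map F)).

Lemma saug_ustrict (O : Type) (A : uainf R O) (S : stage A) :
  @is_ustrict R _ _ id (scat S) A (@saug _ _ _ S).
Proof.
split; first split.
- by move=> x y; exact: saug_gmap.
- by move=> x y p; exact: saug_op.
- by move=> x; exact: saug_unit.
Qed.

Definition Psi (A : ainfCat R) : functor (sfC A) A :=
  @Functor R (sfC A) A id _ (saug_ustrict (sinf A)).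

Lemma mf_smapn_id (A : ainfCat R) n x y (g : gen (stg A n) x y) : mf (smapn (idF A) n) g = g.
Proof.
elim: n x y g => [x y []|n IH x y [g|e]] /=; first by rewrite IH.
by congr inr; apply: newgenP => //=; apply: fmap_id.
Qed.

Lemma sfF_id (A : ainfCat R) : sfF (idF A) = idF (sfC A).
Proof.
apply: functor_eq => x y v; apply: fmap_id => a b [n e].
congr existT; apply: newgenP => //=; apply: fmap_id => *; exact: mf_smapn_id.
Qed.

Section FunctorComposition.
Variables (A B C : ainfCat R) (G : functor B C) (F : functor A B).

Lemma newmap_comp (S : stage A) (S' : stage B) (S'' : stage C) (m : smap F S S')
    (m' : smap G S' S'') (m'' : smap (compF G F) S S'') :
  (forall x y (g : gen S x y), mf m'' g = mf m' (mf m g)) ->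
  forall x y (e : newgen S x y), newmap m'' e = newmap m' (newmap m e).
Proof.
move=> E x y e; apply: newgenP => //=; rewrite /smap_mor fmap_comp.
congr (fmap _ _ (nz e)).
apply: functional_extensionality_dep => a; apply: functional_extensionality_dep => b.
by apply: functional_extensionality_dep => g; exact: E.
Qed.

Lemma mf_smapn_comp n x y (g : gen (stg A n) x y) :
  mf (smapn (compF G F) n) g = mf (smapn G n) (mf (smapn F n) g).
Proof.
elim: n x y g => [x y []|n IH x y [g|e]] /=; first by rewrite IH.
by rewrite (newmap_comp IH).
Qed.

Lemma sfF_comp : sfF (compF G F) = compF (sfF G) (sfF F).
Proof.
apply: functor_eq => x y v; rewrite /= /smap_mor fmap_comp; congr (fmap _ _ v).
apply: functional_extensionality_dep => a; apply: functional_extensionality_dep => b.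
apply: functional_extensionality_dep => -[n e]; congr existT.
by apply: newmap_comp => *; exact: mf_smapn_comp.
Qed.

End FunctorComposition.

Lemma Psi_natural (A B : ainfCat R) (F : functor A B) :
  compF (Psi B) (sfF F) = compF F (Psi A).
Proof. by apply: functor_eq => x y v; exact: (saug_smap (inf_map F) v). Qed.

End Resolution.

(** * The augmentation is a quasi-equivalence *)

(* Sending the generators outside the image of f to 0 extends to a retraction
   of fmap f that commutes with the operations m^n, n >= 2. *)
Lemma fmap_inj (R : comPzRingType) (U : bool) (O : Type) (S S' : gsys R U O)
    (f : forall x y, gen S x y -> gen S' x y) x y :
  gdif_homog S -> (forall x y, injective (@f x y)) ->
  injective (@fmap U O O _ _ (fun x => x) f R (@gdeg _ _ _ S) (@gdeg _ _ _ S') x y).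
Proof.
move=> hg finj; pose B := pre_of_tree hg.
pose u := fun x (hU : U) => te S hU x : B x x.
pose phi x y (g : gen S' x y) : B x y :=
  if pselect (exists g0, f x y g0 = g) is left e then dl' (leaf (sval (cid e))) else 0.
pose r := @ext R U O S' O B (fun x => x) u phi.
suff fK : cancel (@fmap U O O _ _ (fun x => x) f R (@gdeg _ _ _ S) (@gdeg _ _ _ S') x y) (r x y).
  exact: can_inj fK.
move=> v; rewrite /r ext_fmap -[RHS](@fmap_id R U O _ (@gdeg _ _ _ S) (fun x y g => g)) //.
rewrite (fmap_ext hg); congr (@ext R U O S O B (fun x => x) _ _ x y v).
apply: functional_extensionality_dep => a; apply: functional_extensionality_dep => b.
apply: functional_extensionality_dep => g; rewrite /phi.
case: pselect => [e|[]]; last by exists g.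
by case: cid => g' /= /finj ->.
Qed.

Section StageInclusions.
Variables (R : comPzRingType) (O : Type) (A : uainf R O).

Notation fincl n := (fmap (F0 := fun x => x) (@incl R O A n) (@inf_deg R O A)).
Notation fnext S := (fmap (F0 := fun x => x) (@next_inl R O A S) (@next_deg R O A S)).

Lemma incl_lt n x y (g : gen (stg A n) x y) : (projT1 (incl g) < n)%N.
Proof. by elim: n x y g => [x y []|n IH x y [g|e]] //=; exact: leqW. Qed.

Lemma incl_inj n x y : injective (@incl R O A n x y).
Proof.
elim: n x y => [x y []|n IH x y [g|e] [g'|e']] //=.
- by move/IH ->.
(* An old generator was attached to a stage below [n], the new one to stage [n] itself. *)
- by move=> E; have := incl_lt g; rewrite E /= ltnn.
- by move=> E; have := incl_lt g'; rewrite -E /= ltnn.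
- by move=> E; congr inr; exact: (existT_inj2 (T := nat) (P := fun n => newgen (stg A n) x y) E).
Qed.

Lemma fincl_inj n x y : injective (fun v : tq (stg A n) x y => fincl n v).
Proof.
apply: (@fmap_inj R true O (stg A n) (sinf A)); [exact: shom|exact: incl_inj].
Qed.

Lemma fincl_next n x y (v : tq (stg A n) x y) : fincl n.+1 (fnext (stg A n) v) = fincl n v.
Proof. exact: fmap_comp. Qed.

Lemma incl_surj n k x y (e : newgen (stg A k) x y) : (k < n)%N ->
  exists g : gen (stg A n) x y, incl g = existT _ k e.
Proof.
elim: n => // n IH; rewrite ltnS leq_eqVlt => /orP[/eqP E|/IH[g gE]].
  by subst k; exists (inr e).
by exists (inl g).
Qed.

(** All large [n] are covered, so that the children of a node, and afterwards the terms of a sum,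
    find a common stage. *)
Lemma relabel_incl_surj x y (t : tree (gen (sinf A)) x y) :
  exists N, forall n, (N <= n)%N -> exists t', relabel (F0 := fun x => x) (@incl R O A n) t' = t.
Proof.
elim/tree_ind': t => {x y} [x y [k e]|x y z w s t p [Ns IHs] [Nt IHt] IHp].
  by exists k.+1 => n /(incl_surj e)[g gE]; exists (leaf g); rewrite /= gE.
have [Np {}IHp] : exists N, forall n, (N <= n)%N ->
    exists p', cmapf (F0 := fun x => x) (relabel (@incl R O A n)) p' = p.
  elim: p IHp {s t IHs IHt} => /= [a _|a b c h p IH [[Nh IHh] /IH[Np {}IHp]]].
    by exists 0%N => n _; exists (cnil a).
  exists (maxn Nh Np) => n; rewrite geq_max => /andP[/IHh[h' <-] /IHp[p' <-]].
  by exists (ccons h' p').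
exists (maxn (maxn Ns Nt) Np) => n; rewrite !geq_max -andbA.
move=> /and3P[/IHs[s' <-] /IHt[t' <-] /IHp[p' <-]].
by exists (node s' t' p').
Qed.

Lemma fincl_surj x y (v : tq (sinf A) x y) : exists n (w : tq (stg A n) x y), fincl n w = v.
Proof.
pose P (v : tq (sinf A) x y) := exists N, forall n, (N <= n)%N -> exists w : tq (stg A n) x y, fincl n w = v.
suff [N /(_ N (leqnn N))[w wE]] : P v by exists N, w.
have sP : submod P.
  split; first by exists 0%N => n _; exists 0; exact: fmap0.
  move=> a u1 u2 [N1 h1] [N2 h2]; exists (maxn N1 N2) => n.
  rewrite geq_max => /andP[/h1[w1 <-] /h2[w2 <-]].
  by exists (a *: w1 + w2); exact: fmap_linear.
rewrite -[v]lin_id; apply: (submod_lin sP) => b _.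
rewrite /P {P sP v}; case: b => {x y} [x y t|x hU].
  have [N h] := relabel_incl_surj t; exists N => n /h[t' <-].
  by exists (delta R (bt true t')); exact: fmap_delta.
by exists 0%N => n _; exists (delta R (bu x hU)); exact: fmap_delta.
Qed.

Lemma tree_op_sing (S : stage A) x y (v : tq S x y) : op (scat S) (csing v) = td v.
Proof. exact: (mu_sing (@td _ _ _ S) (@tnu_short _ _ _ S)). Qed.

Lemma gpr_op_sing (B : ainf R O) x y i (v : B x y) :
  op B (csing (gpr i v)) = gpr (i + 1) (op B (csing v)).
Proof. exact: (dif_gpr (M := und B x y)). Qed.

Lemma saug_fincl n x y (v : tq (stg A n) x y) : saug (S := sinf A) (fincl n v) = saug v.
Proof. exact: aug_fincl. Qed.

Lemma saug_linear (S : stage A) x y : linear (@saug R O A S x y).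
Proof. exact: (saug_gmap S x y).1. Qed.

Definition new_leaf n x y (e : newgen (stg A n) x y) : tq (sinf A) x y :=
  dl' (S := sinf A) (leaf (existT (fun n => newgen (stg A n) x y) n e)).

Lemma td_new_leaf n x y (e : newgen (stg A n) x y) : td (new_leaf e) = fincl n (nz e).
Proof. exact: (@td_leaf _ _ _ (sinf A)). Qed.

Lemma saug_new_leaf n x y (e : newgen (stg A n) x y) : saug (new_leaf e) = nb e.
Proof. exact: (@saug_leaf _ _ _ (sinf A)). Qed.

Fact cycle_newgen_proof (n : nat) x y (b : A x y) : op A (csing b) = 0 ->
  td (0 : tq (stg A n) x y) = 0 /\ saug (0 : tq (stg A n) x y) = op A (csing b).
Proof.
by move=> ->; rewrite (linP0 (@td_linear _ _ _ _ _ _)) (linP0 (@saug_linear _ _ _)).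
Qed.

Definition cycle_newgen n x y i (b : A x y) (hb : homog i b) (db : op A (csing b) = 0) :
    newgen (stg A n) x y :=
  NewGen (homog_submod (tq (stg A n) x y) (i + 1)).1 hb
    (cycle_newgen_proof n db).1 (cycle_newgen_proof n db).2.

(** A generator with boundary 0 lies over each homogeneous component of [b]; those attached to the
    initial stage suffice. *)
Lemma saug_cycle_surj x y (b : A x y) : op A (csing b) = 0 ->
  exists v : tq (sinf A) x y, td v = 0 /\ saug v = b.
Proof.
move=> db; rewrite (gsupp_sum b).
apply: (submod_sum (P := fun b => exists v : tq (sinf A) x y, td v = 0 /\ saug v = b)).
  split; first by exists 0; rewrite (linP0 (@td_linear _ _ _ _ _ _)) (linP0 (@saug_linear _ _ _)).
  move=> a b1 b2 [v1 [dv1 <-]] [v2 [dv2 <-]]; exists (a *: v1 + v2).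
  by rewrite td_linear saug_linear dv1 dv2 scaler0 addr0.
move=> i _; have di : op A (csing (gpr i b)) = 0.
  by rewrite gpr_op_sing db (linP0 (gpr_linear _)).
exists (new_leaf (cycle_newgen 0 (homog_gpr i b) di)).
by rewrite td_new_leaf saug_new_leaf; split=> //; exact: fmap0.
Qed.

(** When [b] is not a cycle, two attachments are combined: a generator z with d z = 0 lies over d b,
    and at the next stage a generator with boundary z lies over [b]. *)
Lemma saug_surj x y (b : A x y) : exists v : tq (sinf A) x y, saug v = b.
Proof.
rewrite (gsupp_sum b).
apply: (submod_sum (P := fun b => exists v : tq (sinf A) x y, saug v = b)).
  split; first by exists 0; rewrite (linP0 (@saug_linear _ _ _)).
  move=> a b1 b2 [v1 <-] [v2 <-]; exists (a *: v1 + v2).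
  by rewrite saug_linear.
move=> i _; have hi := homog_gpr i b.
have dd : op A (csing (op A (csing (gpr i b)))) = 0 by exact: m1_m1.
pose e0 := cycle_newgen 0 (m1_homog hi) dd.
pose z : tq (stg A 1) x y := dl' (leaf (inr e0 : gen (stg A 1) x y)).
have hz : homog (i + 1) z.
  rewrite -[i + 1](subrK 1).
  exact: (@homog_delta R _ (@bdeg O true _ (@gdeg _ _ _ (stg A 1)) x y) (bt true (leaf (inr e0 : gen (stg A 1) x y)))).
have dz : td z = 0 by rewrite td_leaf; exact: fmap0.
have sz : saug z = op A (csing (gpr i b)) by rewrite saug_leaf.
by exists (new_leaf (NewGen hz hi dz sz)); rewrite saug_new_leaf.
Qed.

(** A cycle of the union already lies in some stage [n], where its component of degree [i] is paired
    with the component of [b] of degree [i - 1]; the generator attached to this pair bounds it. *)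
Lemma saug_boundary_inj x y (v : tq (sinf A) x y) (b : A x y) :
  td v = 0 -> saug v = op A (csing b) -> exists v', v = td v'.
Proof.
have [n [w <-]] := fincl_surj v; rewrite -fincl_d saug_fincl => dw sw.
have {}dw : td w = 0 by apply: (@fincl_inj n); rewrite dw fmap0.
rewrite (gsupp_sum w) (linP_sum (@fmap_linear _ _ _ _ _ _ _ _ _ _ _ _)).
apply: (submod_sum (P := fun v : tq (sinf A) x y => exists v', v = td v')).
  split; first by exists 0; rewrite (linP0 (@td_linear _ _ _ _ _ _)).
  by move=> a v1 v2 [v1' ->] [v2' ->]; exists (a *: v1' + v2'); rewrite td_linear.
move=> i _.
have hz : homog (i - 1 + 1) (gpr i w) by rewrite subrK; exact: homog_gpr.
have dz : td (gpr i w) = 0.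
  by rewrite -tree_op_sing (gpr_op_sing (B := scat (stg A n))) tree_op_sing dw (linP0 (gpr_linear _)).
have sz : saug (gpr i w) = op A (csing (gpr (i - 1) b)).
  by rewrite gpr_op_sing -sw subrK (gmap_gpr (saug_gmap _ _ _)).
by exists (new_leaf (NewGen hz (homog_gpr _ b) dz sz)); rewrite td_new_leaf.
Qed.

End StageInclusions.

(** * Weights of the attached generators *)

Section Weights.
Variables (R : comPzRingType) (O : Type) (A : uainf R O).

(** The sum bounds the weight of each basis element occurring in the boundary; adding 2 makes the
    bound strict and the weight at least 2. *)
Definition new_weight (S : stage A) (W : forall x y, gen S x y -> nat) x y (e : newgen S x y) : nat :=
  (\sum_(b <- supp (nz e)) `|bw W b|).+2.

Fixpoint stg_weight n : forall x y, gen (stg A n) x y -> nat :=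
  match n return forall x y, gen (stg A n) x y -> nat with
  | 0%N => fun x y g => 0%N
  | n'.+1 => fun x y g =>
      match g with
      | inl g' => stg_weight g'
      | inr e => new_weight (@stg_weight n') e
      end
  end.

Definition inf_weight x y (g : gen (sinf A) x y) : nat :=
  new_weight (@stg_weight (projT1 g)) (projT2 g).

Lemma inf_weight_incl n x y (g : gen (stg A n) x y) : inf_weight (incl g) = stg_weight g.
Proof. by elim: n x y g => [x y []|n IH x y [g|e]] /=. Qed.

Lemma bw_relabel n x y (b : bas (gen (stg A n)) true x y) :
  bw inf_weight (brelabel (F0 := fun x => x) (@incl R O A n) b) = bw (@stg_weight n) b.
Proof.
case: b => //= {x y} x y t; elim/tree_ind': t => {x y} [x y g|x y z w s t p IHs IHt IHp] /=.
  by rewrite inf_weight_incl.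
rewrite IHs IHt; congr (_ + _ + _ - _).
by elim: p IHp {s t IHs IHt} => //= a b c h p IH [-> /IH ->].
Qed.

Lemma inf_weight_dif x y (g : gen (sinf A) x y) b :
  (gdif g : freemod R _) b <> 0 -> bw inf_weight b < (inf_weight g)%:Z.
Proof.
case: g => n e; move: b.
pose P (v : freemod R (bas (gen (sinf A)) true x y)) :=
  forall b, v b <> 0 -> bw inf_weight b < (new_weight (@stg_weight n) e)%:Z.
suff : P (gdif (existT _ n e : gen (sinf A) x y)) by [].
have sP : submod P.
  split=> [b //|a v1 v2 h1 h2 b].
  have [v1b|/contrapT v1b] := pselect (v1 b <> 0); first by move=> _; exact: h1.
  by rewrite fcoefD fcoefZ v1b mulr0 add0r; exact: h2.
apply: (submod_lin sP) => b zb b'; rewrite delta_coef.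
case: eqP => [-> _|//]; rewrite bw_relabel /new_weight.
rewrite (perm_big _ (perm_to_rem (suppP zb))) big_cons /=.
by set m := (X in (_ + X)%N); lia.
Qed.

Lemma cofibrant_sinf x y : cofibrant (und (scat (sinf A)) x y).
Proof.
apply: (cofibrant_tainf (W := inf_weight)); last exact: inf_weight_dif.
by [].
Qed.

End Weights.

(** * One step of the semi-free filtration *)

Section Ideals.
Variables (R : comPzRingType) (O : Type) (A : ainf R O).
Variable G : forall x y, A x y -> Prop.

Lemma gen_ideal_ideal : is_ideal (gen_ideal G).
Proof.
split; first by move=> x y I [I0 _] _.
split; first by move=> x y a f g If Ig I hI GI; apply: hI.2.1; [exact: If|exact: Ig].
split; first by move=> x y i f If I hI GI; apply: hI.2.2.1; exact: If.
by move=> x y z w p f q If I hI GI; apply: hI.2.2.2; exact: If.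
Qed.

Lemma gen_ideal_sub x y (f : A x y) : G f -> gen_ideal G f.
Proof. by move=> Gf I hI; apply. Qed.

End Ideals.

Section IdealTheory.
Variables (R : comPzRingType) (O : Type) (A : ainf R O) (K : forall x y, A x y -> Prop).
Hypothesis hK : is_ideal K.

Lemma ideal_submod x y : submod (@K x y).
Proof. by case: hK => K0 [KD _]; split=> [|a u v]; [exact: K0|exact: KD]. Qed.

(** The inputs are exchanged one at a time, each exchange altering the value by an element of the
    ideal. *)
Lemma ideal_op_congr (H : O -> O -> Type) (a b : forall x y, H x y -> A x y) w x y
    (c : gchain A w x) (p : chain H x y) :
  allc (fun x y h => K (a x y h - b x y h)) p ->
  K (op A (ccat c (cmapi a p)) - op A (ccat c (cmapi b p))).
Proof.
elim: p c => /= [z c _|s t u h p IH c [Kh Kp]].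
  by rewrite subrr; exact: (ideal_submod _ _).1.
set f := op A _; set g := op A _; pose m := op A (ccat c (ccons (a _ _ h) (cmapi b p))).
have -> : f - g = (f - m) + (m - g) by rewrite addrA subrK.
apply: (submodD (ideal_submod _ _)).
  by have := IH (ccat c (csing (a _ _ h))) Kp; rewrite !ccatA.
rewrite -(linPB (@op_linear _ _ A _ _ _ _ c (cmapi b p))).
by have [_ [_ [_ Kop]]] := hK; exact: Kop.
Qed.

End IdealTheory.

Lemma mult_submod (R : comPzRingType) (O : Type) (I : O -> O -> Type)
    (deg : forall x y, I x y -> int) (V : lmodType R) (T : V -> Prop) x y
    (phi : gchain (famod R deg) x y -> V) (p : gchain (famod R deg) x y) :
  submod T -> mult phi ->
  (forall q, clen q = clen p -> T (phi (cdelta R deg q))) -> T (phi p).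
Proof.
move=> sT; elim: p phi => [z phi _ E|a b c f p IH phi mphi E]; first exact: (E (cnil z)).
rewrite -[f]lin_id (lin_comp _ (mult_head p mphi)).
apply: (submod_lin sT) => i _ /=.
apply: (IH (fun q => phi (ccons _ q))); first exact: mult_tail.
by move=> q qp; apply: (E (ccons i q)); rewrite /= qp.
Qed.

Section SumModules.
Variables (R : comPzRingType) (I J : Type).

Lemma sum_bijective :
  bijective (fun ab : freemod R I * freemod R J =>
    lin (fun i => delta R (inl i : I + J)) ab.1 + lin (fun j => delta R (inr j : I + J)) ab.2).
Proof.
pose p1 := lin (fun c : I + J => if c is inl i then delta R i else 0).
pose p2 := lin (fun c : I + J => if c is inr j then delta R j else 0).
have p1l : linear p1 by exact: lin_linear.
have p2l : linear p2 by exact: lin_linear.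
have E11 f : p1 (lin (fun i => delta R (inl i : I + J)) f) = f.
  rewrite (lin_comp _ p1l) -[RHS]lin_id; congr (lin _ f).
  by apply: functional_extensionality_dep => i; rewrite /= /p1 lin_delta.
have E12 f : p1 (lin (fun i => delta R (inr i : I + J)) f) = 0.
  rewrite (lin_comp _ p1l); rewrite /lin big1 // => i _.
  by rewrite /= /p1 lin_delta scaler0.
have E21 f : p2 (lin (fun i => delta R (inl i : I + J)) f) = 0.
  rewrite (lin_comp _ p2l); rewrite /lin big1 // => i _.
  by rewrite /= /p2 lin_delta scaler0.
have E22 f : p2 (lin (fun i => delta R (inr i : I + J)) f) = f.
  rewrite (lin_comp _ p2l) -[RHS]lin_id; congr (lin _ f).
  by apply: functional_extensionality_dep => i; rewrite /= /p2 lin_delta.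
exists (fun q => (p1 q, p2 q)) => [[a b]|q] /=.
  by rewrite (linPD p1l) (linPD p2l) E11 E12 E21 E22 addr0 add0r.
move: q; apply: linear_ext => [||[i|j]] //.
- apply: linear_add; [apply: (linear_comp (lin_linear _))|apply: (linear_comp (lin_linear _))]; exact: lin_linear.
- by rewrite /p1 /p2 !lin_delta (linP0 (lin_linear _)) addr0.
- by rewrite /p1 /p2 !lin_delta (linP0 (lin_linear _)) add0r.
Qed.

End SumModules.

(** * The free A_oo-category on a DG quiver with a homogeneous basis *)

Section FreeCategory.
Variables (R : comPzRingType) (O : Type) (I : O -> O -> Type) (deg : forall x y, I x y -> int).
Notation Q := (famod R deg).
Variable d : forall x y, Q x y -> Q x y.
Hypothesis dl : forall x y, linear (@d x y).
Hypothesis dh : forall x y i m, homog i m -> homog (i + 1) (@d x y m).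
Hypothesis dd : forall x y (m : Q x y), d (d m) = 0.

Definition fquiv : dgquiver R O := fun x y => DGMod (@dl x y) (@dh x y) (@dd x y).

Definition feta x y (q : Q x y) : tmod R false deg x y :=
  lin (fun c => delta R (bt false (leaf c))) q.

Lemma feta_linear x y : linear (@feta x y). Proof. exact: lin_linear. Qed.

Lemma feta_delta x y (c : I x y) : feta (delta R c) = delta R (bt false (leaf c)).
Proof. exact: lin_delta. Qed.

Lemma feta_homog x y i (q : Q x y) : homog i q -> homog i (feta q).
Proof.
move/homog_free => hq; apply: (submod_lin (homog_submod _ i)) => c /hq <-.
rewrite -[deg c](subrK 1).
exact: (@homog_delta R _ (@bdeg O false _ deg x y) (bt false (leaf c))).
Qed.

(** The basis elements of the quiver become the generators, so the differential of a leaf is a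
    combination of leaves. *)
Definition fsys : gsys R false O :=
  @GSys R false O I deg (fun x y c => feta (d (delta R c))).

Lemma fsys_hom : gdif_homog fsys.
Proof. by move=> x y c; apply: feta_homog; apply: dh; exact: homog_delta. Qed.

Lemma feta_d x y (q : Q x y) : feta (d q) = td (S := fsys) (feta q).
Proof.
move: q; apply: linear_ext => [||c].
- exact: (linear_comp (@dl x y) (@feta_linear x y)).
- exact: (linear_comp (@feta_linear x y) (@td_linear _ _ _ fsys x y)).
by rewrite feta_delta; symmetry; exact: (@td_leaf _ _ _ fsys).
Qed.

Lemma fsys_cyc : gdif_cycle fsys.
Proof. by move=> x y c; rewrite -feta_d dd; exact: linP0 (@feta_linear x y). Qed.

Definition fcat : ainf R O := tainf fsys_hom fsys_cyc.

Section Induced.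
Variables (O' : Type) (B : preainf R O') (g0 : O -> O').
Variable g : forall x y, Q x y -> B (g0 x) (g0 y).
Arguments g {x y}.
Hypothesis gl : forall x y, linear (@g x y).
Hypothesis gh : forall x y i m, homog i m -> homog i (@g x y m).
Hypothesis gd : forall x y m, @g x y (d m) = pd B (g m).

Let no_unit x (h : false) : B (g0 x) (g0 x) := 0.
Let no_unitP x (h : false) : punit (no_unit x h).
Proof. by []. Qed.

Definition induced x y (f : tq fsys x y) : B (g0 x) (g0 y) :=
  ext no_unit (fun x y (c : gen fsys x y) => g (delta R c : Q x y)) f.

Lemma induced_feta x y (q : Q x y) : induced (feta q) = g q.
Proof.
move: q; apply: linear_ext => [||c].
- exact: (linear_comp (@feta_linear x y) (lin_linear _)).
- exact: gl.
by rewrite feta_delta; exact: lin_delta.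
Qed.

Let phi_h x y (c : gen fsys x y) : homog (gdeg c) (g (delta R c : Q x y)).
Proof. by apply: gh; exact: homog_delta. Qed.

Let phi_d x y (c : gen fsys x y) : induced (gdif c) = pd B (g (delta R c : Q x y)).
Proof. by rewrite -gd -induced_feta. Qed.

Lemma induced_gmap x y : is_gmap (@induced x y).
Proof. exact: (ext_gmap no_unitP phi_h). Qed.

Lemma induced_mu x y (p : gchain (tq fsys) x y) :
  induced (tmu p) = mu (@pd _ _ B) (@pnu _ _ B) (cmap (fun a b => B a b) g0 induced p).
Proof. exact: (ext_mu no_unitP phi_h phi_d). Qed.

End Induced.

Lemma fcat_free : is_free (R := R) (Q := fquiv) (F := fcat) feta.
Proof.
split.
  move=> x y; split; first by split; [exact: feta_linear|move=> i m; exact: feta_homog].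
  move=> m; rewrite [dif m]/=  [LHS]feta_d; symmetry.
  exact: (mu_sing (@td _ _ _ fsys) (@tnu_short _ _ _ fsys)).
move=> O' B g0 g hg; split.
  pose gl x y := (hg x y).1.1; pose gh x y := (hg x y).1.2; pose gd x y := (hg x y).2.
  exists (@induced O' (pre_of_ainf B) g0 g); split; last first.
    by move=> x y q; exact: (induced_feta (B := pre_of_ainf B) gl).
  split; first by move=> x y; exact: (induced_gmap (B := pre_of_ainf B) gh).
  by move=> x y p; rewrite [RHS]op_mu; exact: (induced_mu (B := pre_of_ainf B) gl gh gd).
move=> G G' [Gg Gop] [Gg' Gop'] E x y f.
have aux (H : forall x y, fcat x y -> B (g0 x) (g0 y)) :
    (forall x y (p : gchain fcat x y), H x y (op fcat p) = op B (cmap (fun a b => B a b) g0 H p)) ->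
    forall x y (p : gchain (tq fsys) x y), (1 < clen p)%N ->
      H _ _ (tnu p) = pnu (pre_of_ainf B) (cmap (fun a b => B a b) g0 H p).
  move=> Hop u v p p1; rewrite -[pnu _ _]/(opnu _) /opnu clen_cmap p1 -Hop.
  by congr H; symmetry; exact: (mu_long (@td_linear _ _ _ fsys)).
apply: (@tree_map_ext R false O fsys O' (pre_of_ainf B) g0 G G') f => //.
- by move=> a b; exact: (Gg a b).1.
- by move=> a b; exact: (Gg' a b).1.
- exact: aux.
- exact: aux.
- by move=> a b c; have := E a b (delta R c); rewrite feta_delta.
Qed.

End FreeCategory.

(** * Attaching the new generators *)

Section Attach.
Variables (R : comPzRingType) (O : Type) (A : uainf R O) (S : stage A).

Notation fn := (fmap (F0 := fun x => x) (@next_inl R O A S) (@next_deg R O A S)).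
Notation NB := (bas (gen S) true).
Notation S' := (snext S).

(** A basis of Q_n, in which every basis element of |A_(n-1)|, unit or whole tree, counts as a
    single arrow. The trees of F(Q_n) thus carry trees and units at their leaves, and the ideal has
    to flatten them. *)
Definition qgen x y : Type := (NB x y + newgen S x y)%type.

Definition qdeg x y (c : qgen x y) : int :=
  match c with inl b => bdeg (@gdeg _ _ _ S) b | inr e => ndeg e end.

Notation Qm := (famod R qdeg).

Definition qinl x y (v : tq S x y) : Qm x y := lin (fun b => delta R (inl b : qgen x y)) v.

Definition qd x y (q : Qm x y) : Qm x y :=
  lin (fun c : qgen x y => match c with inl b => qinl (td (delta R b)) | inr e => qinl (nz e) end) q.

Definition qout x y (q : Qm x y) : tq S' x y :=
  lin (fun c : qgen x y =>
    match c with inl b => fn (delta R b : tq S x y) | inr e => dl' (S := S') (leaf (inr e)) end) q.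

Lemma fn_linear x y : linear (fun v : tq S x y => fn v : tq S' x y).
Proof. exact: fmap_linear. Qed.

Lemma qinl_linear x y : linear (@qinl x y). Proof. exact: lin_linear. Qed.
Lemma qd_linear x y : linear (@qd x y). Proof. exact: lin_linear. Qed.
Lemma qout_linear x y : linear (@qout x y). Proof. exact: lin_linear. Qed.

Lemma qinl_homog x y i (v : tq S x y) : homog i v -> homog i (qinl v).
Proof.
move/homog_free => hv; apply: (submod_lin (homog_submod _ i)) => b /hv <-.
exact: (@homog_delta R _ (@qdeg x y) (inl b)).
Qed.

Lemma qd_qinl x y (v : tq S x y) : qd (qinl v) = qinl (td v).
Proof.
move: v; apply: linear_ext => [||b].
- exact: (linear_comp (@qinl_linear x y) (@qd_linear x y)).
- exact: (linear_comp (@td_linear _ _ _ S x y) (@qinl_linear x y)).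
by rewrite /qd /qinl !lin_delta.
Qed.

Lemma qd_inr x y (e : newgen S x y) : qd (delta R (inr e)) = qinl (nz e).
Proof. exact: lin_delta. Qed.

Lemma qd_homog x y i (q : Qm x y) : homog i q -> homog (i + 1) (qd q).
Proof.
move/homog_free => hq; apply: (submod_lin (homog_submod _ _)) => -[b|e] /hq <-.
  apply: qinl_homog; apply: td_homog; first exact: shom.
  exact: (@homog_delta R _ (@bdeg O true _ (@gdeg _ _ _ S) x y) b).
by apply: qinl_homog; exact: nz_homog.
Qed.

Lemma qd_qd x y (q : Qm x y) : qd (qd q) = 0.
Proof.
move: q; apply: linear_ext => [||[b|e]].
- exact: (linear_comp (@qd_linear x y) (@qd_linear x y)).
- exact: linear_zero.
- rewrite [qd (delta _ _)]lin_delta qd_qinl td_td; [|exact: shom|exact: scyc].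
  exact: linP0 (@qinl_linear x y).
- by rewrite qd_inr qd_qinl nz_cycle; exact: linP0 (@qinl_linear x y).
Qed.

Definition qquiv : dgquiver R O := fquiv qd_linear qd_homog qd_qd.

Lemma qout_qinl x y (v : tq S x y) : qout (qinl v) = fn v.
Proof.
move: v; apply: linear_ext => [||b].
- exact: (linear_comp (@qinl_linear x y) (@qout_linear x y)).
- exact: fmap_linear.
by rewrite /qout /qinl !lin_delta.
Qed.

Lemma qout_inr x y (e : newgen S x y) : qout (delta R (inr e)) = dl' (S := S') (leaf (inr e)).
Proof. exact: lin_delta. Qed.

Lemma qout_homog x y i (q : Qm x y) : homog i q -> homog i (qout q).
Proof.
move/homog_free => hq; apply: (submod_lin (homog_submod _ i)) => -[b|e] /hq <-.
  by apply: fmap_homog => //; exact: (@homog_delta R _ (@bdeg O true _ (@gdeg _ _ _ S) x y) b).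
rewrite /= -[ndeg e](subrK 1).
exact: (@homog_delta R _ (@bdeg O true _ (@gdeg _ _ _ S') x y) (bt true (leaf (inr e)))).
Qed.

Lemma qout_d x y (q : Qm x y) : qout (qd q) = td (qout q).
Proof.
move: q; apply: linear_ext => [||[b|e]].
- exact: (linear_comp (@qd_linear x y) (@qout_linear x y)).
- exact: (linear_comp (@qout_linear x y) (@td_linear _ _ _ S' x y)).
- by rewrite /qd /qout !lin_delta -/(qout _) qout_qinl fi_d.
- by rewrite qd_inr qout_qinl qout_inr; symmetry; exact: (@td_leaf _ _ _ S').
Qed.

Lemma qinl_inj x y : injective (@qinl x y).
Proof.
have [K fK _] := @sum_bijective R (NB x y) (newgen S x y).
move=> v w E; have := can_inj fK; move=> /(_ (v, 0) (w, 0)) /=.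
by rewrite -!/(qinl _) E => /(_ erefl) [].
Qed.

Definition leaf_new x y (t : tree (gen S') x y) : Qm x y :=
  match t in tree _ x y return Qm x y with
  | leaf _ _ g => match g with inl _ => 0 | inr e => delta R (inr e) end
  | node _ _ _ _ _ _ _ => 0
  end.

(* As in fmap_inj; the new generators are recovered from the one-leaf trees. *)
Lemma qout_inj x y : injective (@qout x y).
Proof.
pose B := pre_of_tree (@shom _ _ _ S).
pose u := fun x (hU : true) => te S hU x : B x x.
pose phi x y (g : gen S' x y) : B x y :=
  match g with inl g0 => dl' (leaf g0) | inr _ => 0 end.
pose r := @ext R true O S' O B (fun x => x) u phi.
pose n : tq S' x y -> Qm x y :=
  lin (fun b => match b with bt _ _ t => leaf_new t | bu _ _ => 0 end).
suff : cancel (@qout x y) (fun f => qinl (r x y f) + n f) by exact: can_inj.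
have nl : linear n by exact: lin_linear.
have rl : linear (r x y) by exact: lin_linear.
apply: linear_ext => [||[b|e]] //.
- apply: (linear_comp (g := fun f => qinl (r x y f) + n f) (@qout_linear x y)).
  by apply: linear_add => //; apply: (linear_comp rl (@qinl_linear x y)).
- rewrite /qout lin_delta; have -> : r x y (fn (delta R b : tq S x y)) = delta R b.
    rewrite /r ext_fmap -[RHS](@fmap_id R true O _ (@gdeg _ _ _ S) (fun x y g => g)) //.
    by rewrite (fmap_ext (@shom _ _ _ S)).
  rewrite [n _](_ : _ = 0) ?addr0; first exact: lin_delta.
  rewrite fmap_delta /n lin_delta.
  by case: b => //= {x y n r nl rl} x y [].
- by rewrite qout_inr /r ext_leaf (linP0 (@qinl_linear x y)) add0r; exact: lin_delta.
Qed.

Notation F := (fcat qd_linear qd_homog qd_qd).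
Notation FS := (fsys qd).
Notation eta := (@feta R O qgen qdeg _ _).

Lemma fF : gdif_homog FS.
Proof. exact: fsys_hom qd_homog. Qed.

Definition attach_pi x y (f : F x y) : scat S' x y :=
  induced (d := qd) (B := pre_of_tree (@shom _ _ _ S')) qout f.

Lemma attach_pi_strict : @is_strict R _ _ id F (scat S') attach_pi.
Proof.
split; first by move=> x y; exact: (induced_gmap qd (B := pre_of_tree (@shom _ _ _ S')) qout_homog).
by move=> x y p; exact: (induced_mu (d := qd) (B := pre_of_tree (@shom _ _ _ S')) qout_linear qout_homog qout_d).
Qed.

Lemma attach_pi_eta x y (q : Qm x y) : attach_pi (eta q) = qout q.
Proof. exact: (induced_feta qd (B := pre_of_tree (@shom _ _ _ S')) qout_linear). Qed.

Lemma attach_pi_linear x y : linear (@attach_pi x y).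
Proof. exact: (attach_pi_strict.1 x y).1. Qed.

Notation j := (fun x y (f : scat S x y) => eta (qinl f) : F x y).
Notation rel := (attach_rel j).
Notation K := (gen_ideal rel).

Lemma j_linear x y : linear (fun f : scat S x y => eta (qinl f) : F x y).
Proof. exact: (linear_comp (@qinl_linear x y) (@feta_linear _ _ _ _ x y)). Qed.

Lemma attach_pi_j x y (f : scat S x y) : attach_pi (eta (qinl f)) = fn f.
Proof. by rewrite attach_pi_eta qout_qinl. Qed.

Lemma kernel_ideal : is_ideal (A := F) (fun x y f => attach_pi f = 0).
Proof.
split; first by move=> x y; exact: linP0 (@attach_pi_linear x y).
split; first by move=> x y a f g Ef Eg; rewrite attach_pi_linear Ef Eg scaler0 addr0.
split.
  move=> x y i f Ef; rewrite (gmap_gpr (attach_pi_strict.1 x y)) Ef.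
  exact: linP0 (gpr_linear _).
move=> x y z w p f q Ef; rewrite attach_pi_strict.2 cmap_ccat /= Ef.
exact: linP0 (@op_linear _ _ (scat S') _ _ _ _ _ _).
Qed.

Lemma fn_op x y (p : gchain (scat S) x y) :
  fn (op (scat S) p) = op (scat S') (cmap (fun a b => scat S' a b) id (fun a b (f : scat S a b) => fn f) p).
Proof. exact: (fmap_mu (@shom _ _ _ S')). Qed.

Lemma rel_kernel x y (f : F x y) : rel f -> attach_pi f = 0.
Proof.
case=> {x y f} [x y p p2|x y f|x y i f hf|x y z p q pq].
- rewrite (linPB (@attach_pi_linear x y)) attach_pi_strict.2 attach_pi_j fn_op.
  rewrite [X in op _ X - _](_ : _ = cmap (fun a b => scat S' a b) id (fun a b (f : scat S a b) => fn f) p) ?subrr //.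
  by elim: p {p2} => //= a b c f p ->; rewrite attach_pi_j.
- rewrite (linPB (@attach_pi_linear x y)) attach_pi_strict.2 /= attach_pi_j fmap_delta.
  by rewrite [tmu _](op_idr (u := scat S') (attach_pi f)) subrr.
- rewrite (linPB (@attach_pi_linear x y)) (linPZ (@attach_pi_linear x y)) attach_pi_strict.2 /= attach_pi_j fmap_delta.
  have h := (attach_pi_strict.1 x y).2 _ _ hf.
  by rewrite -(op_idl (u := scat S') h) subrr.
- rewrite attach_pi_strict.2 cmap_ccat /= attach_pi_j fmap_delta.
  by apply: (op_idn (u := scat S')); rewrite !clen_cmap.
Qed.

(* A linear section of attach_pi; it respects the operations only modulo K. *)
Definition sec_gen x y (g : gen S' x y) : pre_of_tree fF x y :=
  match g with
  | inl g => eta (qinl (dl' (leaf g)))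
  | inr e => eta (delta R (inr e : qgen x y))
  end.

Definition sec x y (v : scat S' x y) : F x y :=
  ext (B := pre_of_tree fF) (F0 := fun x => x) (fun x hU => eta (qinl (te S hU x))) sec_gen v.

Lemma sec_linear x y : linear (@sec x y). Proof. exact: lin_linear. Qed.

Lemma sec_tree x y (t : tree (gen S') x y) : sec (dl' t) =
  etree (B := pre_of_tree fF) (F0 := fun x => x) sec_gen t.
Proof. exact: lin_delta. Qed.

Lemma sec_unit x (hU : true) : sec (delta R (bu x hU)) = eta (qinl (te S hU x)).
Proof. exact: lin_delta. Qed.

Lemma F_op_long x y (p : gchain F x y) : (1 < clen p)%N -> op F p = tnu p.
Proof. exact: (mu_long (@td_linear _ _ _ FS)). Qed.

Lemma sec_node x y z w (s : tree (gen S') x y) (t : tree (gen S') y z) (p : chain (tree (gen S')) z w) :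
  sec (dl' (node s t p)) = op F (cmapi (fun a b t => sec (dl' t)) (ccons s (ccons t p))).
Proof.
have E a b (q : chain (tree (gen S')) a b) : cmapi (fun a b t => sec (dl' t)) q =
    cmapf (F0 := fun x => x) (H' := fun a b => pre_of_tree fF a b)
      (etree (B := pre_of_tree fF) (F0 := fun x => x) sec_gen) q.
  by elim: q => //= u v r h q ->; rewrite sec_tree.
by rewrite F_op_long // E sec_tree.
Qed.

Lemma sec_delta_homog x y (b : bas (gen S') true x y) :
  homog (bdeg (@gdeg _ _ _ S') b) (sec (delta R b)).
Proof.
case: b => {x y} [x y t|x hU].
  rewrite -[delta R _]/(dl' t) sec_tree.
  apply: (etree_homog (B := pre_of_tree fF)) => a b [g|e].
    apply: feta_homog; apply: qinl_homog; rewrite -[gdeg _](subrK 1).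
    exact: (@homog_delta R _ (@bdeg O true _ (@gdeg _ _ _ S) a b) (bt true (leaf g))).
  by apply: feta_homog; exact: (@homog_delta R _ (@qdeg a b) (inr e)).
rewrite sec_unit; apply: feta_homog; apply: qinl_homog.
exact: (@homog_delta R _ (@bdeg O true _ (@gdeg _ _ _ S) x x) (bu x hU)).
Qed.

Lemma attach_pi_sec x y (v : scat S' x y) : attach_pi (sec v) = v.
Proof.
move: v; apply: linear_ext => [||b] //.
  exact: (linear_comp (@sec_linear x y) (@attach_pi_linear x y)).
case: b => {x y} [x y t|x hU]; last first.
  by rewrite sec_unit attach_pi_j; exact: fmap_delta.
rewrite -[delta R _]/(dl' t); elim/tree_ind': t => {x y} [x y [g|e]|x y z w s t p IHs IHt IHp].
- by rewrite sec_tree /= attach_pi_j; exact: fmap_delta.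
- by rewrite sec_tree /= attach_pi_eta; exact: lin_delta.
rewrite sec_node attach_pi_strict.2 -[RHS]tnu_node.
rewrite -[tnu _](mu_long (@td_linear _ _ _ S')) //; congr (@op _ _ (scat S') _ _ _).
rewrite /= IHs IHt; do 2 congr ccons.
by elim: p IHp {s t IHs IHt} => //= a b c h p IH [-> /IH ->].
Qed.

Lemma K_ideal : is_ideal (gen_ideal (A := F) rel). Proof. exact: gen_ideal_ideal. Qed.
Notation K_sub := (ideal_submod K_ideal).

Notation rl := (relabel (F0 := fun x => x) (@next_inl R O A S)).

(** A tree of old generators is a single leaf under [qinl] and an iterated composite under [sec];
    the relations [attach_op] identify the two vertex by vertex. *)
Lemma sec_fn x y (v : scat S x y) : K (eta (qinl v) - sec (fn v) : F x y).
Proof.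
have L : linear (fun v : scat S x y => eta (qinl v) - sec (fn v) : F x y).
  apply: linear_add; first exact: j_linear.
  by apply: linear_opp; exact: (linear_comp (@fn_linear x y) (@sec_linear x y)).
rewrite -[v]lin_id (lin_comp _ L); apply: (submod_lin (K_sub x y)) => b _ /=.
case: b {L v} => {x y} [x y t|x hU]; last first.
  by rewrite fmap_delta /= sec_unit subrr; exact: (K_sub _ _).1.
rewrite fmap_delta /= -[delta R _]/(dl' t) -[delta R (bt _ _)]/(dl' (S := S') (rl t)).
elim/tree_ind': t => {x y} [x y g|x y z w s t p IHs IHt IHp].
  by rewrite sec_tree subrr; exact: (K_sub _ _).1.
rewrite [sec _](sec_node (rl s) (rl t) (cmapf rl p)).
pose a x y (t : tree (gen S) x y) : F x y := eta (qinl (dl' t)).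
pose b x y (t : tree (gen S) x y) : F x y :=
  sec (dl' (S := S') (rl t)).
pose c := ccons s (ccons t p).
have -> : cmapi (fun a b t => sec (dl' t)) (ccons (rl s)
   (ccons (rl t) (cmapf rl p))) = cmapi b c.
  by rewrite /=; do 2 congr ccons; elim: p {c s t IHs IHt IHp} => //= u v r h p ->.
have E : dl' (node s t p) = op (scat S) (cS c) by rewrite -[LHS]tnu_node -[tnu _](mu_long (@td_linear _ _ _ S)).
rewrite E; have c2 : (2 <= clen (cS c))%N by [].
have h1 : K (op F (cmapi a c) - eta (qinl (op (scat S) (cS c))) : F _ _).
  have := gen_ideal_sub (attach_op (F := F) j c2).
  by rewrite cmap_idE /cS -(cmap_idE a) -(cmap_idE j) -cmap_idE -cmap_comp.
have h2 : K (op F (cmapi a c) - op F (cmapi b c)).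
  have := @ideal_op_congr R O F (gen_ideal rel) K_ideal _ a b _ _ _ (cnil x) c.
  by apply; split=> //; split.
have sub3 (V : zmodType) (X Y Z : V) : Y - Z = (X - Z) - (X - Y).
  by rewrite opprB [RHS]addrC addrA subrK.
rewrite (sub3 _ (op F (cmapi a c))).
by apply: (submodD (K_sub _ _)) => //; exact: (submodN (K_sub _ _)).
Qed.

(** On a chain of trees the two terms coincide by the definition of [sec]; on a chain with a unit
    their difference is, up to sign, one of the unit relations. *)
Lemma sec_op x y (p : gchain (scat S') x y) : (1 < clen p)%N ->
  K (sec (op (scat S') p) - op F (cmapi sec p)).
Proof.
move=> p1.
have M1 : mult (fun p : gchain (tq S') x y => sec (op (scat S') p) - op F (cmapi sec p)).
  apply: mult_add; first exact: (mult_map (@sec_linear x y) (@tmu_mult _ _ _ S' x y)).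
  apply: (mult_map (g := fun f => - f)); first by apply: linear_opp.
  rewrite (_ : (fun p => _) = fun p => op F (cmap (fun a b => F a b) id sec p)).
    exact: (mult_cmap (N := scat S') (F0 := id) sec_linear (@op_mult _ _ F x y)).
  by apply: functional_extensionality_dep => r; rewrite cmap_idE.
apply: (mult_submod (K_sub x y) M1) => q qp.
have {qp} q1 : (1 < clen q)%N by rewrite qp.
have [[r rE]|[z [hU [a [c qE]]]]] := chain_basP q.
  have cq : cdelta R (@bdeg O true _ (@gdeg _ _ _ S')) q = cS r by rewrite rE cdelta_cbt.
  rewrite cq; have r1 : (1 < clen r)%N by move: q1; rewrite rE clen_cmapi.
  case: r r1 {q q1 rE cq} => // u v w s r; case: r s => // u' v' w' t r s _.
  have -> : op (scat S') (cS (ccons s (ccons t r))) = dl' (node s t r).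
    by rewrite -[RHS]tnu_node -[tnu _](mu_long (@td_linear _ _ _ S')).
  rewrite sec_node [X in op F X - _](_ : _ = cmapi sec (cS (ccons s (ccons t r)))) ?subrr.
    exact: (K_sub _ _).1.
  by rewrite /cS; elim: (ccons s (ccons t r)) => //= i1 i2 i3 h q ->.
rewrite {hU}(bool_irrelevance hU isT) in qE.
have q2 : (2 <= (clen a + clen c).+1)%N by move: q1; rewrite qE clen_ccat /= addnS.
rewrite qE /cdelta cmapi_ccat /= cmapi_ccat /= sec_unit.
have [ac|ac] := leqP 2 (clen a + clen c).
  rewrite [@tmu _ _ _ S' _ _ _](tmu_idn (S := S') isT) ?clen_cmapi // (linP0 (@sec_linear _ _)) sub0r.
  apply: (submodN (K_sub _ _)); apply: gen_ideal_sub.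
  by apply: (attach_idn (F := F) j); rewrite !clen_cmapi.
case: a c {qE q1} q2 ac => [s|s t u b a] c q2 ac.
  case: c q2 ac => // s' t u b c q2 ac; case: c b {q2} ac => // {}u b _ /=.
  rewrite [@tmu _ _ _ S' _ _ _](tmu_idr (S := S') isT (delta R b)) -opprB.
  apply: (submodN (K_sub _ _)); apply: gen_ideal_sub.
  exact: (attach_idr (F := F) j).
case: a b c q2 ac => // t' b c; case: c b => // {t'}t b _ _ /=.
rewrite [@tmu _ _ _ S' _ _ _](tmu_idl (S := S') isT (delta R b)) tau_delta sgnB1 scaleNr opprK (linPZ (@sec_linear _ _)).
(* This relation has the sign on the product; multiplying by the sign moves it to the other term. *)
have := gen_ideal_sub (attach_idl (F := F) j (sec_delta_homog b)).
set i := bdeg _ b => /(submodZ (K_sub _ _) (sgn R i)).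
rewrite scalerBr scalerA sgn_sq scale1r => /(submodN (K_sub _ _)).
by rewrite opprB.
Qed.

(** This puts the kernel inside the ideal: when [attach_pi f] vanishes, what remains is [f]
    itself. *)
Lemma sec_attach_pi x y (f : F x y) : K (f - sec (attach_pi f)).
Proof.
have L : linear (fun f : F x y => f - sec (attach_pi f)).
  apply: linear_add => //; apply: linear_opp.
  exact: (linear_comp (@attach_pi_linear x y) (@sec_linear x y)).
rewrite -[f]lin_id (lin_comp _ L); apply: (submod_lin (K_sub x y)) => b _ /=.
case: b {L f} => // {x y} x y t; rewrite -[delta R _]/(dl' (S := FS) t).
elim/tree_ind': t => {x y} [x y [b|e]|x y z w s t p IHs IHt IHp].
- have -> : dl' (S := FS) (leaf (inl b)) = eta (qinl (delta R b)).
    by rewrite /qinl lin_delta feta_delta.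
  by rewrite attach_pi_j; exact: sec_fn.
- have -> : dl' (S := FS) (leaf (inr e)) = eta (delta R (inr e : qgen x y)) by rewrite feta_delta.
  by rewrite attach_pi_eta qout_inr sec_tree subrr; exact: (K_sub _ _).1.
have -> : dl' (S := FS) (node s t p) = op F (cS (ccons s (ccons t p))).
  by rewrite F_op_long // tnu_node.
rewrite attach_pi_strict.2 cmap_idE.
set c := cS _; set d := cmapi attach_pi c.
have h1 : K (op F (cmapi sec d) - sec (op (scat S') d)).
  by rewrite -opprB; apply: (submodN (K_sub _ _)); exact: sec_op.
have h2 : K (op F c - op F (cmapi sec d)).
  pose a u v (t : tree (gen FS) u v) : F u v := dl' t.
  pose b u v (t : tree (gen FS) u v) : F u v := sec (attach_pi (dl' (S := FS) t)).
  have := @ideal_op_congr R O F (gen_ideal rel) K_ideal _ a b _ _ _ (cnil x) (ccons s (ccons t p)).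
  rewrite /=; have -> : cmapi b p = cmapi sec (cmapi attach_pi (cmapi a p)).
    by elim: p {c d s t IHs IHt IHp h1} => //= i1 i2 i3 h p ->.
  by apply; split=> //; split.
by have := submodD (K_sub _ _) h2 h1; rewrite addrA subrK.
Qed.

Lemma attach_quotient : is_quotient (A := F) (B := scat S') (gen_ideal rel) attach_pi.
Proof.
split; first exact: attach_pi_strict.
- exact: K_ideal.
- by move=> x y v; exists (sec v); exact: attach_pi_sec.
move=> x y f; split=> [f0|Kf].
  by have := sec_attach_pi f; rewrite f0 (linP0 (@sec_linear _ _)) subr0.
by apply: (Kf (fun x y f => attach_pi f = 0)); [exact: kernel_ideal|exact: rel_kernel].
Qed.

Lemma qinl_dgqmap : @is_dgqmap R _ _ id (und (scat S)) qquiv qinl.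
Proof.
move=> x y; split; first by split; [exact: qinl_linear|move=> i m; exact: qinl_homog].
by move=> m; rewrite [dif m]tree_op_sing; symmetry; exact: qd_qinl.
Qed.

Lemma qout_dgqmap : @is_dgqmap R _ _ id qquiv (und (scat S')) qout.
Proof.
move=> x y; split; first by split; [exact: qout_linear|move=> i m; exact: qout_homog].
by move=> m; rewrite [RHS]tree_op_sing; exact: qout_d.
Qed.

Definition newmod : gquiver R O := famod R (@ndeg _ _ _ S).

Fact newmod_d0 x y i (m : newmod x y) : homog i m -> homog (i + 1) (0 : newmod x y).
Proof. by move=> _; exact: (homog_submod _ _).1. Qed.

(** The boundaries [nz] lie in |A_(n-1)|, hence the zero differential on the quotient. *)
Definition newquiv : dgquiver R O := fun x y =>
  @DGMod R (newmod x y) (fun=> 0) (@linear_zero R (newmod x y) (newmod x y)) (@newmod_d0 x y) (fun _ => erefl).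

Definition qproj x y (q : Qm x y) : newquiv x y :=
  lin (fun c : qgen x y => match c with inl _ => 0 | inr e => delta R e end) q.

Definition qinr x y (m : newmod x y) : Qm x y := lin (fun e => delta R (inr e : qgen x y)) m.

Lemma qproj_linear x y : linear (@qproj x y). Proof. exact: lin_linear. Qed.

Lemma qproj_qinl x y (v : tq S x y) : qproj (qinl v) = 0.
Proof.
rewrite /qinl (lin_comp _ (@qproj_linear x y)) /lin big1 // => b _.
by rewrite /= [qproj _]lin_delta scaler0.
Qed.

Lemma qproj_qinr x y (m : newmod x y) : qproj (qinr m) = m.
Proof.
rewrite /qinr (lin_comp _ (@qproj_linear x y)) -[RHS]lin_id; congr (lin _ m).
by apply: functional_extensionality_dep => e; exact: lin_delta.
Qed.

Lemma famod_graded_free x y : graded_free (newmod x y).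
Proof.
exists {classic newgen S x y}, (fun e => HMor (homog_delta R (@ndeg _ _ _ S x y) e)); split.
  by move=> m; exists (supp m), (fun e => m e); exact: (esym (lin_id m)).
move=> s c us /= E i is_.
have := congr1 (fun f : freemod R (newgen S x y) => f i) E.
rewrite fcoef_sum fcoef0 (big_rem i is_) /= eqxx mulr1 big1_seq ?addr0 // => j /andP[_].
by rewrite rem_filter // mem_filter eq_sym => /andP[/negbTE -> _]; rewrite mulr0.
Qed.

Lemma attach_step : semi_free_step (A' := scat S) (Q := qquiv) (A'' := scat S') qinl qout.
Proof.
split; [|split].
- exists newmod, qinr; split; last by move=> x y; exact: sum_bijective.
  move=> x y; split; first exact: lin_linear.
  move=> i m /homog_free hm; apply: (submod_lin (homog_submod _ i)) => e /hm <-.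
  exact: (@homog_delta R _ (@qdeg x y) (inr e)).
- exists F, (fun x y => @feta R O qgen qdeg x y), attach_pi; split.
  + exact: fcat_free.
  + exact: attach_quotient.
  + exact: attach_pi_eta.
exists newquiv, qproj; split.
- move=> x y; split; [split|].
  + exact: qproj_linear.
  + move=> i q /homog_free hq; apply: (submod_lin (homog_submod (newmod x y) i)) => -[b|e] /hq.
      by move=> _; exact: (homog_submod _ _).1.
    by move=> <-; exact: (@homog_delta R _ (@ndeg _ _ _ S x y) e).
  + move=> q; change (qproj (qd q) = 0); move: q; apply: linear_ext => [||[b|e]].
    * exact: (linear_comp (@qd_linear x y) (@qproj_linear x y)).
    * exact: linear_zero.
    * by rewrite [qd _]lin_delta qproj_qinl.
    * by rewrite qd_inr qproj_qinl.
- by move=> x y m; exists (qinr m); exact: qproj_qinr.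
- move=> x y q; split=> [|[f ->]]; last exact: qproj_qinl.
  have [K _ fK] := @sum_bijective R (NB x y) (newgen S x y).
  rewrite -[q]fK /= -/(qinl _) -/(qinr _) (linPD (@qproj_linear x y)) qproj_qinl qproj_qinr add0r => ->.
  by exists (K q).1; rewrite /qinr (linP0 (lin_linear _)) addr0.
- by [].
- by move=> x y; exact: famod_graded_free.
Qed.

End Attach.

(** * The resolution *)

(** Without generators there are no trees, and the units alone form the basis. *)
Lemma stage0_disc (R : comPzRingType) (O : Type) (A : uainf R O) : is_disc (scat (stage0 A)).
Proof.
have no_tree x y : tree (gen (stage0 A)) x y -> False.
  by move=> t; elim/tree_ind': t => // a b [].
split; [|split].
- move=> x; exists (fun v : scat (stage0 A) x x => (v : freemod R _) (bu x isT)) => [r|v].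
    by rewrite fcoefZ delta_eq mulr1.
  apply: freemodP => b; rewrite fcoefZ.
  suff -> : b = bu x isT by rewrite delta_eq mulr1.
  have [[t _]|[e [hU ->]]] := basP b; first by case: (no_tree _ _ t).
  by rewrite (Prop_irrelevance e erefl) (bool_irrelevance hU isT).
- move=> x y xy f; apply: freemodP => b.
  by have [[t _]|[e _]] := basP b; [case: (no_tree _ _ t)|case: xy].
- move=> x y f; rewrite tree_op_sing; move: f; apply: linear_ext => [||b].
  + exact: td_linear.
  + exact: linear_zero.
  by case: b => {x y} [x y t|x hU]; [case: (no_tree _ _ t)|exact: dif_unit].
Qed.

Lemma fmap_ustrict (R : comPzRingType) (O : Type) (A : uainf R O) (S S' : stage A)
    (f : forall x y, gen S x y -> gen S' x y) :
  (forall x y (g : gen S x y), gdeg (f x y g) = gdeg g) ->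
  (forall x y (g : gen S x y), gdif (f x y g) = fmap (F0 := fun x => x) f (@gdeg _ _ _ S') (gdif g)) ->
  @is_ustrict R _ _ id (scat S) (scat S')
    (fun x y (v : tq S x y) => fmap (F0 := fun x => x) f (@gdeg _ _ _ S') v).
Proof.
move=> fdeg fdif; split; first split.
- by move=> x y; apply: fmap_gmap.
- by move=> x y p; exact: (fmap_mu (@shom _ _ _ S') fdeg fdif).
- by move=> x; exact: fmap_delta.
Qed.

Section Resolution.
Variables (R : comPzRingType) (A : ainfCat R).

Notation fincl n := (fmap (F0 := fun x => x) (@incl R (ob A) A n) (@inf_deg R (ob A) A)).

Lemma sf_semi_free : semi_free (sfC A).
Proof.
exists (fun n => scat (stg A n)), (fun n => qquiv (stg A n)),
  (fun n => @qinl R (ob A) A (stg A n)), (fun n => @qout R (ob A) A (stg A n)),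
  (fun n x y (v : tq (stg A n) x y) => fincl n v).
split=> [n|]; [|split; [|split; [|split; [|split]]]].
- split; [exact: qinl_dgqmap|exact: qout_dgqmap| |].
  + have := @fmap_ustrict R (ob A) A (stg A n) (stg A n.+1) (@next_inl R (ob A) A (stg A n)).
    move=> /(_ (fun x y g => erefl) (fun x y g => erefl)).
    (* The composite of the two inclusions is the relabelling along [next_inl]. *)
    congr (is_ustrict (R := R) _).
    apply: functional_extensionality_dep => x; apply: functional_extensionality_dep => y.
    by apply: functional_extensionality_dep => v; symmetry; exact: qout_qinl.
  + apply: (@fmap_ustrict R (ob A) A (stg A n) (sinf A)) => x y g; [exact: incl_deg|exact: incl_dif].
- by move=> n x y; split; [exact: qinl_inj|exact: qout_inj|exact: fincl_inj].
- by move=> n x y f; rewrite qout_qinl; exact: fincl_next.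
- by move=> x y f; have [n [w wE]] := fincl_surj f; exists n, w.
- exact: stage0_disc.
- by move=> n; exact: attach_step.
Qed.

Lemma Psi_quasi_equivalence : quasi_equivalence (Psi A).
Proof.
split=> [x y|y].
  split=> [v dv [b E]|b db].
    have dv' : td v = 0 by rewrite -tree_op_sing.
    have [v' v'E] := saug_boundary_inj dv' E.
    by exists v'; rewrite v'E; symmetry; exact: tree_op_sing.
  have [v [dv vb]] := saug_cycle_surj db; exists v; split.
    by rewrite -[RHS]dv; exact: tree_op_sing.
  exists 0; rewrite (linP0 (@dif_linear _ (und A x y))).
  by apply/eqP; rewrite subr_eq0; apply/eqP; exact: esym vb.
(* [Psi A] fixes the objects, and the unit is its own inverse, with 0 as homotopy. *)
exists y; exists (idm A y), (idm A y); split; first by split; rewrite ?idm_closed //; exact: idm_homog.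
have E : op A (ccons (idm A y) (csing (idm A y))) - idm A y = op A (csing (0 : A y y)).
  by rewrite op_idr subrr (linP0 (@m1_linear _ _ A y y)).
by split; exists 0; split=> //; exact: (homog_submod _ _).1.
Qed.

End Resolution.
(* [AInfCat (sf A)] has the same objects as A by construction, so that
   [fob (Psi A)] can be compared with the identity. *)
Theorem theoremB (R : comPzRingType) :
  exists (sf : forall A : ainfCat R, uainf R (ob A))
         (Psi : forall A : ainfCat R, functor (AInfCat (sf A)) A)
         (sfF : forall A B : ainfCat R, functor A B ->
                  functor (AInfCat (sf A)) (AInfCat (sf B))),
    (forall A : ainfCat R,
       is_semi_free_resolution (Psi A) /\
       has_cofibrant_morphisms (AInfCat (sf A)) /\
       surjective_on_morphisms (Psi A) /\
       fob (Psi A) = id) /\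
    (forall A : ainfCat R, sfF A A (idF A) = idF (AInfCat (sf A))) /\
    (forall (A B C : ainfCat R) (G : functor B C) (F : functor A B),
       sfF A C (compF G F) = compF (sfF B C G) (sfF A B F)) /\
    (forall (A B : ainfCat R) (F : functor A B),
       compF (Psi B) (sfF A B F) = compF F (Psi A)).
Proof.
exists (@sf R), (@Psi R), (@sfF R); split; [|split; [|split]].
- move=> A; split; first by split; [exact: sf_semi_free|exact: Psi_quasi_equivalence].
  split; first by move=> x y; exact: cofibrant_sinf.
  by split=> // x y b; exact: saug_surj.
- exact: sfF_id.
- exact: sfF_comp.
- exact: Psi_natural.
Qed.
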